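(* Let $f:\mathbb R_+\cup\{\infty\}\to[0,1]\cup\{-\infty\}$ be upper semi-continuous, and suppose $\mathrm{dom}(f)$ is a closed subset $\mathcal I$ of $[0,\infty]$ with $0<\min(\mathcal I)<\infty$. Then there exists a homogeneously multifractal Hölder continuous function $F$ such that $\underline f^H_F=f$ on $\mathbb R_+\cup\{\infty\}$.
   Context: Work on $\mathbb R$ ($d=1$). Fix an orthonormal wavelet basis $\{\psi_I\}$ indexed by the dyadic intervals $I$ of $\mathbb R$, whose mother wavelet belongs to the Schwartz class, with the $\psi_I$ normalized to have the same supremum norm. For a bounded Hölder continuous $F:\mathbb R\to\mathbb R$ with wavelet coefficients $\{\lambda_I\}$, set $L_I=\sup\{|\lambda_{I'}|\}$, the supremum over dyadic intervals $I'$ contained in $I$ or in one of the two dyadic intervals of the same generation as $I$ neighboring $I$. For $x\in\mathbb R$, $I_n(x)$ is the closure of the dyadic interval $[k2^{-n},(k+1)2^{-n})$ containing $x$. $\mathrm{supp}(F)=\{x\in[0,1]:L_{I_n(x)}>0\ \forall n\ge1\}$. The pointwise Hölder exponent is $h_F(x_0)=\sup\{h\ge0:\exists P\in\mathbb R[X],\ |F(x)-P(x-x_0)|=O(|x-x_0|^h)\text{ as }x\to x_0\}$. For $h\in\mathbb R\cup\{\infty\}$, $\underline E(F,h)=\{x\in\mathrm{supp}(F):h_F(x)=h\}$ and $\underline f^H_F(h)=\dim_H\underline E(F,h)$ (with $\dim_H\emptyset=-\infty$). $F$ is homogeneously multifractal if for every $h$, $\dim_H(\underline E(F,h)\cap B)$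 does not depend on the ball $B$ whose interior intersects $\mathrm{supp}(F)$. $\mathrm{dom}(f)=\{h:f(h)>-\infty\}$; upper semi-continuity on $\mathbb R_+\cup\{\infty\}$ refers to the topology generated by open subsets of $\mathbb R_+$ and sets $(\alpha,\infty)\cup\{\infty\}$. *)

(* Defs.v *)
From HB Require Import structures.
From mathcomp Require Import all_boot all_order all_algebra.
From mathcomp Require Import all_classical all_reals all_analysis.
Set Implicit Arguments. Unset Strict Implicit. Unset Printing Implicit Defensive.
Import Order.TTheory GRing.Theory Num.Theory.
Import numFieldNormedType.Exports.
Local Open Scope classical_set_scope.
Local Open Scope ring_scope.

Section Defs.
Variable R : realType.

Definition schwartz (psi : R -> R) : Prop :=
  (forall (n : nat) (x : R), derivable (derive1n n psi) x 1) /\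
  (forall a b : nat, exists C : R, forall x : R,
      `| x ^+ a * derive1n b psi x | <= C).

Definition psiL2 (psi : R -> R) (j k : int) (x : R) : R :=
  Num.sqrt ((2:R) ^ j) * psi ((2:R) ^ j * x - k%:~R).

Definition orthonormal_wavelet_basis (psi : R -> R) : Prop :=
  measurable_fun setT psi /\
  (forall j k j' k' : int,
     (lebesgue_measure : measure _ R).-integrable setT
        (fun x => (psiL2 psi j k x * psiL2 psi j' k' x)%:E) /\
     \int[lebesgue_measure]_(x in setT) (psiL2 psi j k x * psiL2 psi j' k' x)
        = (if (j == j') && (k == k') then 1 else 0)) /\
  (forall g : R -> R, measurable_fun setT g ->
     (lebesgue_measure : measure _ R).-integrable setT (fun x => (g x ^+ 2)%:E) ->
     (forall j k : int,
        \int[lebesgue_measure]_(x in setT) (g x * psiL2 psi j k x) = 0) ->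
     {ae lebesgue_measure, forall x, g x = 0}).

Definition wavelet (psi : R -> R) : Prop :=
  schwartz psi /\ orthonormal_wavelet_basis psi.

Definition dyadic (j k : int) : set R :=
  [set x | k%:~R * (2:R) ^ (- j) <= x < (k + 1)%:~R * (2:R) ^ (- j)].

(* L^infty-normalised wavelet psi_I(x) = psi(2^j x - k), I = I_{j,k},
   and coefficient lambda_I = 2^j \int F psi_I, so that F = sum lambda_I psi_I *)
Definition wcoef (psi F : R -> R) (j k : int) : R :=
  (2:R) ^ j * \int[lebesgue_measure]_(x in setT) (F x * psi ((2:R) ^ j * x - k%:~R)).

Definition wleader (psi F : R -> R) (j k : int) : \bar R :=
  ereal_sup [set (`| wcoef psi F jk.1 jk.2 |)%:E | jk in
     [set jk : int * int | exists m : int,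
        [|| m == k - 1, m == k | m == k + 1] /\ dyadic jk.1 jk.2 `<=` dyadic j m]].

Definition wsupp (psi F : R -> R) : set R :=
  [set x | 0 <= x <= 1 /\ forall n : nat, (1 <= n)%N ->
      (0 < wleader psi F n%:Z (Num.floor ((2:R) ^+ n * x)))%E].

Definition holder_exponent (F : R -> R) (x0 : R) : \bar R :=
  ereal_sup [set h%:E | h in [set h : R | 0 <= h /\
     exists P : {poly R}, exists C : R, exists delta : R, 0 < delta /\
       forall x : R, `| x - x0 | < delta ->
         `| F x - P.[x - x0] | <= C * (`| x - x0 | `^ h)]].

Definition iso_set (psi F : R -> R) (h : \bar R) : set R :=
  [set x | wsupp psi F x /\ holder_exponent F x = h].

Definition diam (A : set R) : R := sup [set `| x - y | | x in A & y in A].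

Definition hcost (s : R) (A : set R) : R :=
  if pselect (A = set0) then 0 else diam A `^ s.

Definition hausdorff_pre (s delta : R) (E : set R) : \bar R :=
  ereal_inf [set (\sum_(0 <= i <oo) (hcost s (U i))%:E)%E | U in
    [set U : nat -> set R | E `<=` \bigcup_i U i /\
       forall i x y, U i x -> U i y -> `| x - y | <= delta]].

Definition hausdorff_measure (s : R) (E : set R) : \bar R :=
  ereal_sup [set hausdorff_pre s delta E | delta in [set d : R | 0 < d]].

Definition dimH (E : set R) : \bar R :=
  if pselect (E = set0) then -oo%E
  else ereal_inf [set s%:E | s in [set s : R | 0 <= s /\ hausdorff_measure s E = 0%E]].

Definition holder_continuous (F : R -> R) : Prop :=
  exists alpha C : R, 0 < alpha /\
    forall x y, `| F x - F y | <= C * (`| x - y | `^ alpha).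

Definition cball (c r : R) : set R := [set x | `| x - c | <= r].

Definition homogeneously_multifractal (psi F : R -> R) : Prop :=
  forall (h : \bar R) (c1 r1 c2 r2 : R), 0 < r1 -> 0 < r2 ->
    (exists x, wsupp psi F x /\ `| x - c1 | < r1) ->
    (exists x, wsupp psi F x /\ `| x - c2 | < r2) ->
    dimH (iso_set psi F h `&` cball c1 r1) = dimH (iso_set psi F h `&` cball c2 r2).

(* P holds on a neighbourhood of h in [0, oo] (topology generated by the open
   subsets of R_+ and the sets (alpha, oo) \cup {oo}) *)
Definition near_ext (h : \bar R) (P : \bar R -> Prop) : Prop :=
  match h with
  | r%:E => exists e : R, 0 < e /\
      forall r' : R, 0 <= r' -> `| r' - r | < e -> P r'%:E
  | +oo%E => exists alpha : R, forall h' : \bar R, (alpha%:E < h')%E -> P h'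
  | -oo%E => True
  end.

Definition usc_ext (f : \bar R -> \bar R) : Prop :=
  forall h : \bar R, (0 <= h)%E -> forall a : R, (f h < a%:E)%E ->
    near_ext h (fun h' => (f h' < a%:E)%E).

Definition closed_ext (I : set (\bar R)) : Prop :=
  forall h : \bar R, (0 <= h)%E -> ~ I h -> near_ext h (fun h' => ~ I h').

Definition dom_ext (f : \bar R -> \bar R) : set (\bar R) :=
  [set h | (0 <= h)%E /\ (-oo < f h)%E].

End Defs.

(* Main.v *)
(* The function is a lacunary wavelet series carried by a tree: [F] is the sum
   over the nodes [I] of [2 ^ (- eta_I J_n) * psi_I], where the nodes of depth [n]
   are dyadic intervals of a very fast growing generation [J_n].  Each node of
   depth [n + 1] carries one of [n + 1] labels, which determines the exponent
   [eta_I] and the number of its siblings with the same label.  Nodes with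
   different labels are separated on a scale much larger than their length, so at
   a point [x] of the limit set [K] of the tree, which is the wavelet support of
   [F], the exponent is the lower limit of [eta_I] along the branch of [x]: the
   upper bound follows from the vanishing moments of [psi], and the lower bound
   from Taylor expansion of the layers and the decay of [psi].

   The labels run through a sequence [q_l] of elements of [dom f] such that the
   points [(q_l, f q_l)] are dense in the graph of [f]; a node with label [l] has
   exponent [q_l] (truncated at [n + m]) and about [2 ^ (f q_l * (J_(n+1) - J_n))]
   siblings with its label.  If [h_F x = h], then the labels of the branch of [x]
   approach [h] infinitely often, and covering those [x] by the nodes with such
   labels bounds the dimension by the upper limit of [f] at [h], which is [f h] as
   [f] is upper semi-continuous.  Conversely, the points of [K] below a given node
   whose labels converge to [(h, f h)] contain a Cantor set of dimension [f h]. *)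
Require Import Defs.
From HB Require Import structures.
From mathcomp Require Import all_boot all_order all_algebra.
From mathcomp Require Import all_classical all_reals all_analysis.
From mathcomp Require Import measurable_realfun ring lra zify.
Set Implicit Arguments. Unset Strict Implicit. Unset Printing Implicit Defensive.
Import Order.TTheory GRing.Theory Num.Theory.
Import numFieldNormedType.Exports.

(** * The tree of dyadic intervals *)

(** Two requirements compete. Only the labels of its own branch may influence the exponent at a
    point of [K], although [psi] has tails and nodes with other labels may carry much larger
    coefficients; and nodes with a given label must be as numerous as [f] allows, up to a vanishing
    fraction of bits. The recursion for [J] settles both. The bits of the parent and of the slot
    number [J n + n + 3], less than [J n.+1 / (n + 2)], so they do not affect dimensions. A slot is
    [2 ^ wid n] node lengths wide, with [wid n] more than half of [J n.+1], so the decay of [psi]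
    across an empty slot beats any fixed power [2 ^ (- (h * J n.+1))]. Points beyond half a slot are
    at distance at least [2 ^ (- (J n + n + 4))], against which a whole layer, of size
    [2 ^ (- (m * J n.+1))], is negligible. Since every node has children with all available labels,
    each cylinder contains Cantor sets for every exponent, whence homogeneity. Closedness of the
    domain of [f] enters like semi-continuity, through neighbourhoods: it excludes the exponents
    outside the domain. *)

(* A node of depth [n] is a dyadic interval of generation [J n], given by its
   index [k < 2 ^ J n].  Among the [J n.+1 - J n] binary digits leading to a child,
   the first [n + 3] form its slot [2 * l + 1], where [l <= n] is its label; of the
   last [wid n] digits only the first [b n l] are free, so that a node has
   [2 ^ b n l] children with label [l].  Slots are odd to separate nodes with
   different labels, and in the first quarter, away from the ends of the parent. *)
Fixpoint J (n : nat) : nat := if n is m.+1 then (m + 2) * (J m + m + 5) else 0.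

Definition wid (n : nat) : nat := J n.+1 - (J n + (n + 3)).

Arguments J : simpl never.

Lemma J_S n : J n.+1 = (n + 2) * (J n + n + 5). Proof. by []. Qed.

Lemma J_wid n : J n.+1 = J n + (n + 3) + wid n.
Proof. by rewrite /wid subnKC// J_S; nia. Qed.

Lemma J_lt n : J n < J n.+1. Proof. by rewrite J_S; nia. Qed.

Lemma J_mono m n : m <= n -> J m <= J n.
Proof. by move=> mn; rewrite -(subnKC mn); elim: (n - m) => [|d IH];
  rewrite ?addn0// addnS (leq_trans IH)// ltnW// J_lt. Qed.

Lemma J_ltn m n : m < n -> J m < J n.
Proof. by move=> mn; apply: (leq_trans (J_lt m)); exact: J_mono. Qed.

Lemma J_ge n : n <= J n.
Proof. by elim: n => // n IH; exact: leq_ltn_trans IH (J_lt n). Qed.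

Section Tree.
Variable b : nat -> nat -> nat.
Hypothesis b_le : forall n l, b n l <= wid n.

Definition slot n k := k %/ 2 ^ wid n.

Definition lab n k := (slot n k %% 2 ^ (n + 3))./2.

Definition good n k :=
  [&& odd (slot n k), lab n k <= n & 2 ^ (wid n - b n (lab n k)) %| k].

Fixpoint T n k : bool :=
  if n is m.+1 then T m (k %/ 2 ^ (J n - J m)) && good m k else k == 0.

Arguments T : simpl never.

Lemma T_S n k : T n.+1 k = T n (k %/ 2 ^ (J n.+1 - J n)) && good n k.
Proof. by []. Qed.

Lemma JB n : J n.+1 - J n = n + 3 + wid n.
Proof. by rewrite J_wid; lia. Qed.

Lemma T_lt n k : T n k -> k < 2 ^ J n.
Proof.
elim: n k => [k /eqP->//|n IH k]; rewrite T_S => /andP[/IH + _].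
by rewrite ltn_divLR ?expn_gt0// -expnD subnKC// ltnW ?J_lt.
Qed.

Lemma T_anc n N k : n <= N -> T N k -> T n (k %/ 2 ^ (J N - J n)).
Proof.
move=> nN; rewrite -(subnKC nN); elim: (N - n) k => [k|d IH k].
  by rewrite addn0 subnn divn1.
rewrite addnS T_S => /andP[/IH + _]; rewrite -divnMA -expnD.
by have := J_mono (leq_addr d n); have := J_lt (n + d) => ? ?; congr (T _ (_ %/ 2 ^ _)); lia.
Qed.

Lemma slot_mod n k : slot n k %% 2 ^ (n + 3) = (k %% 2 ^ (J n.+1 - J n)) %/ 2 ^ wid n.
Proof.
rewrite /slot {1}(divn_eq k (2 ^ (J n.+1 - J n))) JB expnD mulnA divnMDl ?expn_gt0//.
rewrite modnMDl modn_small// ltn_divLR ?expn_gt0//.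
by rewrite ltn_mod muln_gt0 !expn_gt0.
Qed.

Lemma odd_slot_mod n k : odd (slot n k %% 2 ^ (n + 3)) = odd (slot n k).
Proof.
rewrite {2}(divn_eq (slot n k) (2 ^ (n + 3))) oddD oddM oddX/=.
by rewrite addn3/= andbF.
Qed.

Lemma expn_lin n : (n.+1 <= 2 ^ n)%N. Proof. exact: ltn_expl. Qed.

(** An odd slot is at least 1, which gives the left margin; a slot with label at most [n] is at most
    [2 * n + 1], and the 3 in [n + 3] puts this in the first quarter of the slots. *)
Lemma good_margin n k : good n k ->
  2 ^ wid n <= k %% 2 ^ (J n.+1 - J n) /\
  4 * (k %% 2 ^ (J n.+1 - J n)).+1 <= 2 ^ (J n.+1 - J n).
Proof.
move=> /and3P[od]; rewrite /lab slot_mod => ln _.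
move: od; rewrite -odd_slot_mod slot_mod.
set r := k %% _ => od; set s := r %/ _ in od ln *.
have s1 : 0 < s by case: (s) od.
have sn : s <= 2 * n + 1 by lia.
split.
  by apply: leq_trans (leq_divM r (2 ^ wid n)); rewrite -/s leq_pmull.
have rs : r < s.+1 * 2 ^ wid n by rewrite -ltn_divLR ?expn_gt0.
have := expn_lin n => e.
rewrite [X in _ <= 2 ^ X]JB expnD.
apply: (@leq_trans (4 * ((2 * n + 2) * 2 ^ wid n))).
  rewrite leq_mul2l/=; apply: (leq_trans rs); rewrite leq_mul2r; apply/orP; right; lia.
by rewrite mulnA leq_mul2r; apply/orP; right; rewrite expnD; nia.
Qed.

(** A descendant inherits the margins of the child that contains it. They keep limits of nodes
    inside the half-open intervals of all ancestors. *)
Lemma T_margin n N k : n < N -> T N k ->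
  2 ^ (J N - J n) <= 2 ^ (n + 3) * (k %% 2 ^ (J N - J n)) /\
  4 * (k %% 2 ^ (J N - J n)).+1 <= 2 ^ (J N - J n).
Proof.
move=> nN /(T_anc nN); rewrite T_S => /andP[_ /good_margin].
have := J_lt n; have := J_mono nN => h1 h2.
set d := J N - J n.+1; set D := J n.+1 - J n.
have dD : J N - J n = D + d by rewrite /D /d; lia.
rewrite dD; set r := (k %/ 2 ^ d) %% 2 ^ D => -[r1 r2].
have kr : k %% 2 ^ (D + d) = r * 2 ^ d + k %% 2 ^ d.
  by rewrite /r modn_divl -expnD {1}(divn_eq (k %% 2 ^ (D +
    d)) (2 ^ d)) modn_dvdm// expnD dvdn_mull.
have kd : k %% 2 ^ d < 2 ^ d by rewrite ltn_mod expn_gt0.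
rewrite kr expnD; split.
  rewrite mulnDr; apply: (leq_trans _ (leq_addr _ _)).
  rewrite mulnA leq_mul2r; apply/orP; right.
  by rewrite /D JB expnD leq_mul2l r1 orbT.
apply: (@leq_trans (4 * r.+1 * 2 ^ d)); last by rewrite leq_mul2r r2 orbT.
by rewrite -mulnA leq_mul2l /= mulSn addnC ltn_add2r.
Qed.

(** Distinct odd numbers differ by at least 2, so a whole empty slot lies in between. *)
Lemma slot_far n k k' : odd (slot n k) -> odd (slot n k') ->
  slot n k != slot n k' -> k + 2 ^ wid n < k' \/ k' + 2 ^ wid n < k.
Proof.
have H m m' : odd (slot n m) -> odd (slot n m') -> slot n m < slot n m' ->
    m + 2 ^ wid n < m'.
  move=> o o' l.
  have : (slot n m).+2 <= slot n m' by lia.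
  rewrite /slot leq_divRL ?expn_gt0//; apply: leq_trans.
  by have := ltn_ceil m (expn_gt0 2 (wid n) : 0 < 2 ^ wid n); rewrite -/(slot n m); nia.
move=> o o'; rewrite neq_ltn => /orP[l|l]; [left|right]; exact: H.
Qed.

Lemma lab_slot n k k' : slot n k = slot n k' -> lab n k = lab n k'.
Proof. by rewrite /lab => ->. Qed.

(** All these indices are multiples of [2 ^ (wid n - B)]. The multiples are counted without regard
    to the ancestors: the [J n + (n + 3)] bits lost are negligible against [J n.+1]. *)
Lemma count_T n B : B <= wid n ->
  \sum_(k < 2 ^ J n.+1 | T n.+1 k && (b n (lab n k) <= B)) 1 <= 2 ^ (J n + (n + 3) + B).
Proof.
move=> Bw; set g := 2 ^ (wid n - B).
have g0 : 0 < g by rewrite expn_gt0.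
have JE : 2 ^ J n.+1 = 2 ^ (J n + (n + 3) + B) * g.
  by rewrite -expnD; congr (_ ^ _); rewrite J_wid; lia.
apply: (@leq_trans (\sum_(k < 2 ^ J n.+1 | g %| k) 1)).
  rewrite [X in X <= _]big_mkcond [X in _ <= X]big_mkcond/=; apply: leq_sum => k _.
  case: ifP => // /andP[]; rewrite T_S => /andP[_ /and3P[_ _ dk]] bB.
  by rewrite (dvdn_trans _ dk)// dvdn_exp2l// leq_sub2l.
rewrite sum1_card JE; set m := 2 ^ (J n + (n + 3) + B).
have lt (k : 'I_(m * g)) : k %/ g < m by rewrite ltn_divLR.
rewrite -[X in _ <= X]card_ord.
rewrite -(@card_in_imset _ _ (fun k : 'I_(m * g) => Ordinal (lt k))) ?max_card//.
move=> k k' dk0 dk0' [e].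
have dk : g %| k := dk0; have dk' : g %| k' := dk0'.
by apply: val_inj; rewrite /= -(divnK dk) -(divnK dk') e.
Qed.

Definition child n k l i :=
  k * 2 ^ (J n.+1 - J n) + ((2 * l + 1) * 2 ^ wid n + i * 2 ^ (wid n - b n l)).

Lemma childP n k l i : l <= n -> i < 2 ^ b n l ->
  [/\ child n k l i %/ 2 ^ (J n.+1 - J n) = k, lab n (child n k l i) = l &
      T n k -> T n.+1 (child n k l i)].
Proof.
move=> ln ib; set c := child n k l i.
have bw := b_le n l.
have iw : i * 2 ^ (wid n - b n l) < 2 ^ wid n.
  by rewrite -[X in _ < 2 ^ X](subnKC bw) expnD ltn_mul2r expn_gt0.
have e3 : 2 ^ (J n.+1 - J n) = 2 ^ (n + 3) * 2 ^ wid n by rewrite JB expnD.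
have n3 : 2 * n + 2 <= 2 ^ (n + 3) by rewrite expnD; have := expn_lin n; lia.
have o_lt : (2 * l + 1) * 2 ^ wid n + i * 2 ^ (wid n - b n l) < 2 ^ (J n.+1 - J n).
  rewrite e3; apply: (@leq_trans ((2 * l + 2) * 2 ^ wid n)); first by nia.
  by rewrite leq_mul2r; apply/orP; right; lia.
have cdiv : c %/ 2 ^ (J n.+1 - J n) = k.
  by rewrite /c /child divnMDl ?expn_gt0// divn_small// addn0.
have cmod : c %% 2 ^ (J n.+1 - J n) = (2 * l + 1) * 2 ^ wid n + i * 2 ^ (wid n - b n l).
  by rewrite /c /child modnMDl modn_small.
have sl : slot n c %% 2 ^ (n + 3) = 2 * l + 1.
  by rewrite slot_mod cmod divnMDl ?expn_gt0// divn_small ?addn0.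
have lc : lab n c = l by rewrite /lab sl addn1 mul2n /= uphalf_double.
split=> // Tk; rewrite T_S cdiv Tk /good lc ln -odd_slot_mod sl addn1 mul2n /= odd_double /=.
have dv : 2 ^ (wid n - b n l) %| 2 ^ wid n by rewrite dvdn_exp2l// leq_subr.
rewrite /c /child !dvdn_add// ?dvdn_mull//.
by rewrite e3 dvdn_mull.
Qed.

End Tree.

Arguments T : simpl never.

Local Open Scope classical_set_scope.
Local Open Scope ring_scope.

(** * Sums and Taylor expansions *)

Section SumBound.
Variable R : realType.
Implicit Types (t y : R).

(** A bounded antiderivative of the inverse square of [1 + |t|]: twice its unit increments dominate
    the terms of the series below, and they telescope. *)
Let g t := t / (1 + `|t|).

Let g_le1 t : `|g t| <= 1.
Proof.
rewrite normrM normfV (ger0_norm (_ : 0 <= 1 + `|t|)) ?addr_ge0//.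
by rewrite ler_pdivrMr ?mul1r ?lerDr// ltr_pwDl.
Qed.

Let g_step t : ((1 + `|t|) ^+ 2)^-1 <= 2 * (g (t + 1) - g t).
Proof.
have p : 0 < 1 + `|t| by rewrite ltr_pwDl.
have p1 : 0 < 1 + `|t + 1| by rewrite ltr_pwDl.
have -> : 2 * (g (t + 1) - g t) =
    (2 * ((t + 1) * (1 + `|t|) - t * (1 + `|t + 1|))) / ((1 + `|t|) * (1 + `|t + 1|)).
  by rewrite /g; field; rewrite !gt_eqF.
rewrite ler_pdivlMr ?mulr_gt0// mulrC ler_pdivrMr ?exprn_gt0//.
have [t0|t0] := lerP 0 t.
  rewrite (ger0_norm t0) (ger0_norm (_ : 0 <= t + 1)); last by lra.
  rewrite -subr_ge0 (_ : _ - _ = t * (1 + t)); last by ring.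
  by apply: mulr_ge0; lra.
have [t1|t1] := lerP 0 (t + 1).
  rewrite (ltr0_norm t0) (ger0_norm t1).
  rewrite -subr_ge0 (_ : _ - _ = (1 - t) * (- t) * (7 - 4 * t ^+ 2)); last by ring.
  apply: mulr_ge0; first by apply: mulr_ge0; lra.
  by nra.
rewrite (ltr0_norm t0) (ltr0_norm t1).
rewrite -subr_ge0 (_ : _ - _ = (1 - t) * (2 - t)); last by ring.
by apply: mulr_ge0; lra.
Qed.

Lemma sum_invsqr_le y M : \sum_(k < M) ((1 + `|y - k%:R|) ^+ 2)^-1 <= 4.
Proof.
have E : \sum_(k < M) ((1 + `|y - k%:R|) ^+ 2)^-1 <= 2 * (g (M%:R - y) - g (- y)).
  elim: M => [|M IH]; first by rewrite big_ord0 sub0r subrr mulr0.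
  rewrite big_ord_recr/=; apply: (le_trans (lerD IH (_ : _ <= 2 * (g (M%:R - y +
    1) - g (M%:R - y))))).
    by rewrite distrC; exact: g_step.
  rewrite -mulrDr (_ : M.+1%:R - y = M%:R - y + 1); last by rewrite -natr1; ring.
  by rewrite le_eqVlt; apply/orP; left; apply/eqP; ring.
have := g_le1 (M%:R - y); have := g_le1 (- y); rewrite !ler_norml.
move=> /andP[? ?] /andP[? ?]; lra.
Qed.

End SumBound.

Definition smooth (R : realType) (g : R -> R) :=
  forall (n : nat) (x : R), derivable (derive1n n g) x 1.

Definition taylor (R : realType) (g : R -> R) (a : R) (N : nat) : {poly R} :=
  \poly_(q < N) (derive1n q g a / q`!%:R).

Section Taylor.
Variable R : realType.
Implicit Types (g h dh : R -> R) (a t : R).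

Lemma is_derive_continuous h dh :
  (forall x : R, is_derive x (1 : R) h (dh x)) -> continuous h.
Proof.
by move=> hd x; apply/differentiable_continuous/derivable1_diffP; have [] := hd x.
Qed.

Lemma MVT_between h dh a t : (forall x : R, is_derive x (1 : R) h (dh x)) ->
  exists2 c, `|c| <= `|t| & h (a + t) - h a = dh (a + c) * t.
Proof.
move=> hd; have hc := is_derive_continuous hd.
have [t0|t0] := lerP 0 t.
  have [| |c] := @MVT_segment R h dh a (a + t); first by rewrite lerDl.
    exact: continuous_subspaceT.
  rewrite in_itv/= => /andP[ac ct] e; exists (c - a); first by rewrite !ger0_norm; lra.
  by rewrite e subrKC addrC addKr.
have [||c] := @MVT_segment R h dh (a + t) a; first by rewrite gerDl ltW.
  exact: continuous_subspaceT.
rewrite in_itv/= => /andP[ac ct] e; exists (c - a).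
  by rewrite ler0_norm ?(ltr0_norm t0); lra.
by rewrite subrKC -opprB e; ring.
Qed.

Lemma derive1n_is_derive g n (x : R) : smooth g ->
  is_derive (x : R) (1 : R) (derive1n n g) (derive1n n.+1 g x).
Proof. by move=> sg; rewrite derive1nS derive1E; exact/derivableP/sg. Qed.

Lemma smooth_derive1 g : smooth g -> smooth (derive1 g).
Proof. by move=> sg n x; rewrite -derive1Sn; exact: sg. Qed.

Lemma taylorS_deriv g a N : (taylor g a N.+1)^`() = taylor (derive1 g) a N.
Proof.
apply/polyP => i; rewrite coef_deriv !coef_poly ltnS -derive1Sn.
case: ifP => _; last by rewrite mul0rn.
rewrite factS natrM -mulr_natr; field.
by rewrite pnatr_eq0 -lt0n fact_gt0 /= nat1r pnatr_eq0.
Qed.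

Lemma horner_is_derive (p : {poly R}) (x : R) :
  is_derive (x : R) (1 : R) (fun y => p.[y]) (p^`()%R).[x].
Proof. exact: is_derive_poly. Qed.

Lemma taylor0 g a N : (0 < N)%N -> (taylor g a N).[0] = g a.
Proof.
case: N => // N _; rewrite horner_coef0 coef_poly/= divr1 //.
Qed.

(** Induction on [N]: the remainder vanishes at 0 and its derivative is the remainder of [derive1 g]
    with one term fewer, so the mean value theorem gains a factor [|t|]. The usual [1 / N!] is given
    up. *)
Lemma taylor_bound g a (M r : R) N : smooth g ->
  (forall t, `|t| <= r -> `|derive1n N g (a + t)| <= M) ->
  forall t : R, `|t| <= r -> `|g (a + t) - (taylor g a N).[t]| <= M * `|t| ^+ N.
Proof.
elim: N g => [|N IH] g sg gM t tr.
  by rewrite /taylor horner_poly big_ord0 subr0 expr0 mulr1; exact: gM.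
pose h s := g (a + s) - (taylor g a N.+1).[s].
have hd (s : R) : is_derive (s : R) (1 : R) h
    (derive1 g (a + s) - (taylor (derive1 g) a N).[s]).
  rewrite -taylorS_deriv.
  have gd := derive1n_is_derive 0 (a + s) sg.
  have ad : is_derive (s : R) (1 : R) (fun z => a + z) 1.
    by apply: (is_derive_eq (is_deriveD (is_derive_cst _ _ _) (is_derive_id _ _))); rewrite add0r.
  have gad := is_derive1_comp gd ad; rewrite mulr1 in gad.
  exact: is_deriveB gad (horner_is_derive _ _).
have [c ct] := MVT_between 0 t hd; rewrite !add0r /h addr0 taylor0// subrr subr0.
move=> ->.
rewrite normrM exprSr mulrA ler_wpM2r//.
apply: (le_trans (IH _ _ _ _ (le_trans ct tr))).
- exact: smooth_derive1.
- by move=> s sr; rewrite -derive1Sn; exact: gM.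
apply: ler_wpM2l; last by rewrite lerXn2r// nnegrE.
by apply: le_trans (gM _ tr).
Qed.

Lemma taylor_bound_all g a M N : smooth g ->
  (forall x, `|derive1n N g x| <= M) ->
  forall x, `|g x - (taylor g a N).[x - a]| <= M * `|x - a| ^+ N.
Proof.
move=> sg gM x; rewrite -{1}(subrKC a x).
by apply: (@taylor_bound g a M `|x - a| N).
Qed.

End Taylor.

(** * Moments of Schwartz wavelets *)

Section Integrals.
Variable R : realType.
Notation mu := (@lebesgue_measure R).
Implicit Types (g h : R -> R) (a b C : R).

Lemma continuous_mfun g : continuous g ->
  measurable_fun (@setT (measurableTypeR R)) (fun x => (g x)%:E).
Proof. by move=> cg; apply/measurable_EFinP; exact: continuous_measurable_fun. Qed.

Lemma continuous_affine a b : continuous (fun x : R => a * x + b).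
Proof. by move=> x; apply: cvgD; [apply: cvgMr; exact: cvg_id|exact: cvg_cst]. Qed.

Lemma continuous_comp_affine g a b : continuous g ->
  continuous (fun x : R => g (a * x + b)).
Proof. by move=> cg x; apply: continuous_comp; [exact: continuous_affine|exact: cg]. Qed.

Lemma is_derive_affine a b (x : R) :
  is_derive (x : R) (1 : R) (fun x : R => a * x + b) a.
Proof.
have -> : (fun x : R => a * x + b) = (fun x : R => (b%:P + a *: 'X)%R.[x]).
  by apply/funext => y; rewrite !hornerE addrC.
apply: is_derive_eq (is_derive_poly _ _) _.
by rewrite derivD derivC derivZ derivX !hornerE.
Qed.

Lemma ge0_integral_affine g a b : 0 < a -> continuous g -> (forall x, 0 <= g x) ->
  (\int[mu]_x (g (a * x + b))%:E = a^-1%:E * \int[mu]_x (g x)%:E)%E.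
Proof.
move=> a0 cg g0; pose F (x : R) : R := a * x + b.
have dF : F^`()%classic = cst a.
  apply/funext => x; rewrite derive1E.
  by have := is_derive_affine a b x => /@derive_val.
rewrite (@increasing_ge0_integration_by_substitutionT R F g).
- rewrite dF -ge0_integralZl//.
  + by apply: eq_integral => x _; rewrite -EFinM /= mulrCA mulVf ?mulr1 ?gt_eqF.
  + apply: (@continuous_mfun (fun x => g (a * x + b) * a)) => x.
    by apply: cvgMl; exact: continuous_comp_affine.
  + by move=> x _; rewrite lee_fin mulr_ge0// ?g0// ltW.
  + by rewrite lee_fin invr_ge0 ltW.
- by move=> x y xy; rewrite ltrD2r ltr_pM2l.
- by rewrite dF => x; exact: cvg_cst.
- by rewrite dF; apply: is_cvg_cst.
- by rewrite dF; apply: is_cvg_cst.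
- by move=> x; have [] := is_derive_affine a b x.
- apply/cvgrNyPle => A; near=> x.
  rewrite /F -lerBrDr mulrC -ler_pdivlMr//; near: x; exact: nbhs_ninfty_le.
- apply/cvgryPge => A; near=> x.
  rewrite /F -lerBlDr mulrC -ler_pdivrMr//; near: x; exact: nbhs_pinfty_ge.
- by [].
- by [].
Unshelve. all: by end_near. Qed.

Lemma integrable_affine g a b : 0 < a -> continuous g ->
  mu.-integrable setT (EFin \o g) ->
  mu.-integrable setT (EFin \o (fun x => g (a * x + b))).
Proof.
move=> a0 cg /integrableP[mg ig]; apply/integrableP; split.
  by apply: continuous_mfun; exact: continuous_comp_affine.
have := @ge0_integral_affine (fun x => `|g x|) a b a0.
rewrite /= => ->//; last by move=> x; apply: continuous_comp; [exact: cg|exact: norm_continuous].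
by rewrite lte_mul_pinfty// ?lee_fin ?invr_ge0 ?ltW.
Qed.

Let integral_pos g : (\int[mu]_x (EFin \o g)^\+ x = \int[mu]_x (Num.max (g x) 0)%:E)%E.
Proof. by apply: eq_integral => x _; rewrite funeposE EFin_max. Qed.

Let integral_neg g : (\int[mu]_x (EFin \o g)^\- x = \int[mu]_x (Num.max (- g x) 0)%:E)%E.
Proof. by apply: eq_integral => x _; rewrite funenegE EFin_max EFinN. Qed.

(** Positive and negative parts reduce this to the non-negative case; integrability makes their
    difference meaningful. *)
Lemma Rintegral_affine g a b : 0 < a -> continuous g ->
  mu.-integrable setT (EFin \o g) ->
  \int[mu]_(x in setT) g (a * x + b) = a^-1 * \int[mu]_(x in setT) g x.
Proof.
move=> a0 cg ig.
have cmax g' : continuous g' -> continuous (fun x => Num.max (g' x) 0).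
  by move=> cg' x; apply: continuous_max; [exact: cg'|exact: cvg_cst].
have cN : continuous (fun x => - g x) by move=> x; apply: cvgN; exact: cg.
have mx0 (u : R) : 0 <= Num.max u 0 by rewrite le_max lexx orbT.
rewrite /Rintegral integralE [in RHS]integralE.
rewrite (integral_pos (fun x => g (a * x + b))) (integral_neg (fun x => g (a * x + b))).
rewrite (integral_pos g) (integral_neg g).
rewrite (@ge0_integral_affine (fun x => Num.max (g x) 0) a b)//; last exact: cmax.
rewrite (@ge0_integral_affine (fun x => Num.max (- g x) 0) a b)//;
  last exact: (cmax (fun x => - g x)).
rewrite -muleBr//; last first.
  rewrite -integral_pos; apply: fin_num_adde_defr.
  exact: integrable_pos_fin_num.
rewrite fineM//.
by rewrite fin_numB -integral_pos -integral_neg integrable_pos_fin_num ?integrable_neg_fin_num.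
Qed.

Lemma integrable_oneDsqr : mu.-integrable setT (fun x : R => ((oneDsqr x)^-1)%:E).
Proof.
apply/integrableP; split.
  by apply: continuous_mfun; exact: continuous_oneDsqrV.
under eq_integral do rewrite gee0_abs ?lee_fin ?invr_ge0 ?(le_trans _ (oneDsqr_ge1 _))//.
rewrite ge0_symfun_integralT//.
- have -> : [set x : R | 0 <= x] = `[0%R, +oo[%classic.
    by apply/seteqP; split => x /=; rewrite in_itv/= andbT.
  by rewrite integral0y_oneDsqr -EFinM ltry.
- exact: continuous_oneDsqrV.
- by move=> x; rewrite /= /oneDsqr sqrrN.
Qed.

Lemma integrable_dom g C : continuous g ->
  (forall x, `|g x| <= C * (oneDsqr x)^-1) -> mu.-integrable setT (EFin \o g).
Proof.
move=> cg gC; apply: (le_integrable _ _ _ (integrableZl (@measurableT _ _) C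
  integrable_oneDsqr)) => //.
- exact: continuous_mfun.
- move=> x _; rewrite /= lee_fin (le_trans (gC x))// ler_norm//.
Qed.

Definition Wint : R := \int[mu]_(x in setT) (oneDsqr x)^-1.

Lemma Wint_ge0 : 0 <= Wint.
Proof. by apply: Rintegral_ge0 => x _; rewrite invr_ge0 (le_trans _ (oneDsqr_ge1 x)). Qed.

(** Integrals against dilated wavelets are dominated by an affine copy of the Cauchy weight; the
    factor [a^-1] later cancels the [2 ^ j] in [wcoef]. *)
Lemma dom_affine h a b C : 0 < a -> continuous h ->
  (forall x, `|h x| <= C * (oneDsqr (a * x + b))^-1) ->
  mu.-integrable setT (EFin \o h) /\
  `| \int[mu]_(x in setT) h x | <= C * (a^-1 * Wint).
Proof.
move=> a0 ch hC.
have iW := integrable_affine b a0 (@continuous_oneDsqrV R) integrable_oneDsqr.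
have iCW := integrableZl (@measurableT _ _) C iW.
have ih : mu.-integrable setT (EFin \o h).
  apply: (le_integrable _ _ _ iCW) => //.
  - exact: continuous_mfun.
  - by move=> x _; rewrite /= lee_fin (le_trans (hC x))// ler_norm.
split=> //; apply: (le_trans (le_normr_Rintegral _ ih)) => //.
rewrite -(Rintegral_affine b a0 (@continuous_oneDsqrV R) integrable_oneDsqr).
rewrite -RintegralZl//.
apply: le_Rintegral => //.
exact: integrable_norm.
Qed.

End Integrals.

Section Misc.
Variable R : realType.

Lemma ltr_nat_pow2 (n : nat) : n%:R < 2 ^+ n :> R.
Proof. by rewrite -natrX ltr_nat ltn_expl. Qed.

Lemma pow2_gt0 (n : nat) : 0 < 2 ^+ n :> R.
Proof. by rewrite exprn_gt0. Qed.

Lemma eq0_le_geometric (c C : R) (n0 : nat) :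
  (forall n : nat, (n0 <= n)%N -> `|c| <= C * (2 ^+ n)^-1) -> c = 0.
Proof.
move=> cC; apply/eqP/negPn/negP => c0.
have c1 : 0 < `|c| by rewrite normr_gt0.
pose n := maxn n0 (Num.bound `|C / `|c| |).
have := cC n (leq_maxl _ _); rewrite ler_pdivlMr ?pow2_gt0// leNgt => /negP; apply.
rewrite mulrC -ltr_pdivrMr//.
apply: (lt_trans _ (ltr_nat_pow2 n)).
apply: (le_lt_trans (ler_norm _)); apply: (lt_le_trans (archi_boundP (normr_ge0 _))).
by rewrite ler_nat leq_max leqnn orbT.
Qed.

End Misc.

Section Moments.
Variable R : realType.
Notation mu := (@lebesgue_measure R).
Implicit Types (g h : R -> R) (p : {poly R}).

Lemma Rintegral_sum n (h : nat -> R -> R) :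
  (forall i, mu.-integrable setT (EFin \o h i)) ->
  mu.-integrable setT (EFin \o (fun x => \sum_(i < n) h i x)) /\
  \int[mu]_(x in setT) (\sum_(i < n) h i x) = \sum_(i < n) \int[mu]_(x in setT) h i x.
Proof.
move=> ih; elim: n => [|n [IHi IHe]].
  have -> : (fun x => \sum_(i < 0) h i x) = cst 0 by apply/funext => x; rewrite big_ord0.
  split; last by rewrite big_ord0 Rintegral_cst// mul0r.
  exact: integrable0.
have -> : (fun x => \sum_(i < n.+1) h i x) = (fun x => \sum_(i < n) h i x + h n x).
  by apply/funext => x; rewrite big_ord_recr.
split; last by rewrite big_ord_recr/= RintegralD// IHe.
by have := integrableD (@measurableT _ _) IHi (ih n).
Qed.

Lemma poly_growth p : exists C : R, exists N : nat, 0 <= C /\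
  forall x : R, `|p.[x]| <= C * (1 + `|x|) ^+ N.
Proof.
exists (\sum_(i < size p) `|p`_i|), (size p); split.
  by apply: sumr_ge0.
move=> x; rewrite horner_coef; apply: (le_trans (ler_norm_sum _ _ _)).
rewrite mulr_suml; apply: ler_sum => i _; rewrite normrM normrX ler_wpM2l//.
apply: (@le_trans _ _ ((1 + `|x|) ^+ i)).
  by rewrite lerXn2r ?nnegrE// ?addr_ge0// lerDr.
by apply: ler_weXn2l; [rewrite lerDl|exact: ltnW].
Qed.

Lemma oneDsqr_le (x : R) : oneDsqr x <= (1 + `|x|) ^+ 2.
Proof.
rewrite /oneDsqr -real_normK ?num_real// -subr_ge0.
have -> : (1 + `|x|) ^+ 2 - (1 + `|x| ^+ 2) = 2 * `|x| by ring.
by rewrite mulr_ge0.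
Qed.

Lemma oneDsqr_gt0 (x : R) : 0 < oneDsqr x.
Proof. exact: lt_le_trans (oneDsqr_ge1 x). Qed.

End Moments.

Section Schwartz.
Variables (R : realType) (psi : R -> R).
Hypothesis Spsi : schwartz psi.
Notation mu := (@lebesgue_measure R).

Lemma schwartz_smooth : smooth psi.
Proof. exact: Spsi.1. Qed.

Lemma schwartz_continuous q : continuous (derive1n q psi).
Proof.
exact: (is_derive_continuous (fun x => derive1n_is_derive q x schwartz_smooth)).
Qed.

Lemma schwartz_decay (a q : nat) : exists2 C : R, 0 < C &
  forall x : R, `|derive1n q psi x| <= C * ((1 + `|x|) ^+ a)^-1.
Proof.
have [C0 h0] := Spsi.2 0%N q; have [C1 h1] := Spsi.2 a q.
have C00 : 0 <= C0 by apply: le_trans (h0 0).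
have C10 : 0 <= C1 by apply: le_trans (h1 0).
exists (2 ^+ a * (C0 + C1) + 1) => [|x].
  by rewrite ltr_wpDl// mulr_ge0 ?exprn_ge0// addr_ge0.
have p : 0 < 1 + `|x| by rewrite ltr_pwDl.
rewrite ler_pdivlMr ?exprn_gt0//.
apply: (@le_trans _ _ (2 ^+ a * (C0 + C1))); last by rewrite lerDl.
(* [1 + |x|] is at most 2 in the first case and at most [2 * |x|] in the second. *)
have [x1|x1] := lerP `|x| 1.
  rewrite mulrC; apply: ler_pM => //.
  - by rewrite lerXn2r ?nnegrE// ?(ltW p)//; lra.
  by have := h0 x; rewrite expr0 mul1r; lra.
have -> : `|derive1n q psi x| * (1 + `|x|) ^+ a =
    (1 + `|x|) ^+ a * `|derive1n q psi x| by rewrite mulrC.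
apply: (@le_trans _ _ (2 ^+ a * `|x ^+ a * derive1n q psi x|)).
  rewrite normrM normrX mulrA -exprMn ler_wpM2r//.
  by rewrite lerXn2r ?nnegrE// ?(ltW p)// ?mulr_ge0//; lra.
by rewrite ler_wpM2l ?exprn_ge0//; have := h1 x; lra.
Qed.

Lemma schwartz_bounded q : exists2 C : R, 0 < C & forall x : R, `|derive1n q psi x| <= C.
Proof.
have [C C0 h] := schwartz_decay 0 q; exists C => // x.
by have := h x; rewrite expr0 invr1 mulr1.
Qed.

Lemma schwartz_lip q : exists2 C : R, 0 < C &
  forall x y : R, `|derive1n q psi x - derive1n q psi y| <= C * `|x - y|.
Proof.
have [C C0 h] := schwartz_bounded q.+1; exists C => // x y.
have [c _] := MVT_between y (x - y) (fun x => derive1n_is_derive q x schwartz_smooth).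
by rewrite subrKC => ->; rewrite normrM ler_wpM2r.
Qed.

Lemma schwartz_growth (N : nat) : exists2 C : R, 0 < C &
  forall x : R, (1 + `|x|) ^+ N * `|psi x| <= C * (oneDsqr x)^-1.
Proof.
have [C C0 h] := schwartz_decay N.+2 0; exists C => // x.
have p : 0 < 1 + `|x| by rewrite ltr_pwDl.
apply: (le_trans (ler_wpM2l (exprn_ge0 _ (ltW p)) (h x))).
rewrite mulrCA ler_pM2l// -[N.+2]addn2 exprD invfM mulrA divff ?expf_neq0 ?gt_eqF// mul1r.
by rewrite lef_pV2 ?oneDsqr_le// posrE ?exprn_gt0// oneDsqr_gt0.
Qed.

Lemma integrable_poly_schwartz (p : {poly R}) :
  mu.-integrable setT (EFin \o (fun x => p.[x] * psi x)).
Proof.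
have [C [N [C0 pC]]] := poly_growth p; have [D D0 hD] := schwartz_growth N.
apply: (@integrable_dom _ _ (C * D)) => [|x].
  move=> x; apply: cvgM; first exact: continuous_horner.
  exact: (@schwartz_continuous 0 x).
rewrite normrM -mulrA; apply: (le_trans _ (ler_wpM2l C0 (hD x))).
by rewrite mulrA ler_wpM2r.
Qed.

Lemma Rintegral_poly_schwartz (p : {poly R}) N : (size p <= N)%N ->
  \int[mu]_(x in setT) (p.[x] * psi x) =
  \sum_(i < N) p`_i * \int[mu]_(x in setT) (x ^+ i * psi x).
Proof.
move=> sp.
have iX i : mu.-integrable setT (EFin \o (fun x => x ^+ i * psi x)).
  have := integrable_poly_schwartz 'X^i.
  by under [X in EFin \o X]funext do rewrite hornerXn.
have iX' i : mu.-integrable setT (EFin \o (fun x => p`_i * (x ^+ i * psi x))).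
  exact: (integrableZl (@measurableT _ _) _ (iX i)).
rewrite (_ : (fun x => _) = (fun x => \sum_(i < N) p`_i * (x ^+ i * psi x))); last first.
  apply/funext => x; rewrite (horner_coef_wide _ sp) mulr_suml.
  by apply: eq_bigr => i _; rewrite mulrA.
rewrite (Rintegral_sum N iX').2; apply: eq_bigr => i _.
by rewrite RintegralZl.
Qed.

(** If a derivative vanishes, the previous one is constant, and [x] times a constant is bounded only
    if the constant is 0. *)
Lemma schwartz_eq0 q : (forall x, derive1n q psi x = 0) -> forall x, psi x = 0.
Proof.
elim: q => // q IH dq; apply: IH.
have cst c : derive1n q psi c = derive1n q psi 0.
  have [d _] := MVT_between 0 c (fun x => derive1n_is_derive q x schwartz_smooth).
  by rewrite !add0r dq mul0r => /eqP; rewrite subr_eq0 => /eqP.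
have [C hC] := Spsi.2 1%N q.
move=> x; rewrite cst; apply: (@eq0_le_geometric _ _ C 0) => n _.
have := hC (2 ^+ n); rewrite expr1 cst normrM.
by rewrite ger0_norm ?exprn_ge0// ler_pdivlMr ?pow2_gt0// mulrC.
Qed.

(** Dyadic points are dense and the derivatives are Lipschitz, so a derivative that vanishes at all
    of them is 0. A dyadic point is wanted because there the dilates of [psi] at fine scales are
    elements of the basis. *)
Lemma schwartz_dyadic q : ~ (forall x, psi x = 0) ->
  exists j : nat, exists k : int, derive1n q psi (k%:~R * (2 ^+ j)^-1) != 0.
Proof.
move=> psi0; apply/not_existsP => h; apply: psi0; apply: (@schwartz_eq0 q) => x.
have [C C0 lip] := schwartz_lip q.
apply: (@eq0_le_geometric _ _ C 0) => n _.
pose k := Num.floor (2 ^+ n * x).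
have h0 : derive1n q psi (k%:~R * (2 ^+ n)^-1) = 0.
  by apply/eqP/negPn/negP => hk; apply: (h n); exists k.
have := lip x (k%:~R * (2 ^+ n)^-1); rewrite h0 subr0 => /le_trans; apply.
rewrite ler_pM2l//.
have -> : x - k%:~R * (2 ^+ n)^-1 = (2 ^+ n * x - k%:~R) / 2 ^+ n.
  by field; rewrite expf_neq0.
rewrite normrM [X in _ * X]ger0_norm ?invr_ge0 ?exprn_ge0// ler_piMl ?invr_ge0 ?exprn_ge0//.
have /andP[k1 k2] := Num.Theory.floor_itv (2 ^+ n * x).
rewrite ger0_norm ?subr_ge0// lerBlDr.
by move: k2; rewrite intrD -/k; lra.
Qed.

End Schwartz.

Section WaveletMoments.
Variables (R : realType) (psi : R -> R).
Hypothesis Wpsi : wavelet psi.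
Notation mu := (@lebesgue_measure R).

Let Spsi : schwartz psi := Wpsi.1.
Let cpsi : continuous psi := schwartz_continuous Spsi (q := 0).

Lemma psi_comp_schwartz_integrable (e b a c : R) : 0 < e ->
  mu.-integrable setT (EFin \o (fun x => psi (a * x + c) * psi (e * x + b))).
Proof.
move=> e0; have [C C0 hC] := schwartz_growth Spsi 0.
have [D D0 hD] := schwartz_bounded Spsi 0.
apply: (proj1 (@dom_affine R _ e b (D * C) e0 _ _)).
  by move=> x; apply: cvgM; apply: continuous_comp_affine.
move=> x; rewrite normrM -mulrA; apply: ler_pM => //.
by have := hC (e * x + b); rewrite expr0 mul1r.
Qed.

Lemma orthonormal_psi (j k j' k' : int) :
  \int[mu]_(x in setT) (psi ((2:R) ^ j * x - k%:~R) * psi ((2:R) ^ j' * x - k'%:~R))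
  = if (j == j') && (k == k') then (2:R) ^ (- j) else 0.
Proof.
have [_] := Wpsi.2.2.1 j k j' k'.
have p2 (i : int) : 0 < (2:R) ^ i by rewrite exprz_gt0.
have s2 (i : int) : 0 < Num.sqrt ((2:R) ^ i) by rewrite sqrtr_gt0.
rewrite (_ : (fun x => _) = (fun x => (Num.sqrt ((2:R) ^ j) * Num.sqrt ((2:R) ^ j')) *
   (psi ((2:R) ^ j * x - k%:~R) * psi ((2:R) ^ j' * x - k'%:~R)))); last first.
  by apply/funext => x; rewrite /psiL2; ring.
rewrite RintegralZl//; last exact: psi_comp_schwartz_integrable.
case: ifPn => [/andP[/eqP <- _] e|_ e].
  move: e; rewrite -expr2 sqr_sqrtr ?(ltW (p2 _))// => e.
  by apply: (mulfI (lt0r_neq0 (p2 j))); rewrite e -expfzDr ?gt_eqF// subrr expr0z.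
move/eqP: e; rewrite mulf_eq0 => /orP[|/eqP//].
by rewrite mulf_eq0 !gt_eqF.
Qed.

Lemma psi_neq0 : ~ (forall x, psi x = 0).
Proof.
move=> h; have := orthonormal_psi 0 0 0 0; rewrite !eqxx/= oppr0 expr0z.
under eq_Rintegral do rewrite h mul0r.
by rewrite Rintegral_cst// mul0r => /esym/eqP; rewrite oner_eq0.
Qed.

(* Since psi is orthogonal to its finer translates, rescaling around a dyadic
   point a where psi^(q)(a) <> 0 isolates the q-th moment. *)
Lemma moment_eq0 q : \int[mu]_(x in setT) (x ^+ q * psi x) = 0.
Proof.
have [n] := ubnP q; elim: n q => // n IH q; rewrite ltnS => qn.
have [j0 [k0 d0]] := schwartz_dyadic Spsi q psi_neq0.
set a := k0%:~R * _ in d0.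
set M := \int[mu]_(x in setT) (x ^+ q * psi x).
have [D D0 hD] := schwartz_bounded Spsi q.+1.
have [C C0 hC] := schwartz_growth Spsi q.+1.
pose T := taylor psi a q.+1.
suff : T`_q * M = 0.
  rewrite coef_poly ltnSn => /eqP; rewrite !mulf_eq0 (negPf d0)/= => /orP[|/eqP//].
  by rewrite invr_eq0 pnatr_eq0 gtn_eqF ?fact_gt0.
(* [j > j0] makes [a] a dyadic point of generation [j], and [j != 0] makes the dilate located at [a]
   a basis element other than [psi]. *)
apply: (@eq0_le_geometric _ _ (D * C * Wint R) j0.+1) => j j0j.
pose e : R := (2 ^+ j)^-1.
have e0 : 0 < e by rewrite invr_gt0 pow2_gt0.
pose k : int := k0 * 2 ^+ (j - j0).
have ka : a = k%:~R * e.
  rewrite /a /k /e rmorphM rmorphXn/= -mulrA; congr (_ * _).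
  have -> : (2:R) ^+ j = 2 ^+ (j - j0) * 2 ^+ j0 by rewrite -exprD subnK// ltnW.
  by field; rewrite !expf_neq0.
have cpa : continuous (fun y => psi (a + e * y)).
  rewrite (_ : (fun y => _) = (fun y => psi (e * y + a))).
    exact: continuous_comp_affine.
  by apply/funext => y; rewrite addrC.
have orth : \int[mu]_(y in setT) (psi (a + e * y) * psi y) = 0.
  have := orthonormal_psi 0 0 j%:Z k; rewrite expr0z.
  have -> : (0 == j%:Z) = false by case: (j) j0j.
  rewrite /= -exprnP.
  have ig : mu.-integrable setT (EFin \o (fun y => psi (a + e * y) * psi y)).
    have := psi_comp_schwartz_integrable 0 e a (@ltr01 R).
    by congr (mu.-integrable _ _); apply/funext => y /=; rewrite mul1r addr0 addrC.
  have cg : continuous (fun y => psi (a + e * y) * psi y).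
    by move=> y; apply: cvgM; [exact: cpa|exact: cpsi].
  have := Rintegral_affine (- k%:~R) (pow2_gt0 R j) cg ig.
  rewrite -/e => E.
  rewrite (_ : (fun x => _) = (fun x => psi (a + e * (2 ^+ j * x + - k%:~R)) * psi (2 ^+ j * x +
    - k%:~R))).
    by rewrite E => /eqP; rewrite mulf_eq0 gt_eqF// => /eqP.
  apply/funext => x; congr (psi _ * _); rewrite ka /e.
  by rewrite mul1r subr0; field; rewrite expf_neq0.
pose Te := \poly_(i < q.+1) (T`_i * e ^+ i).
have TeE y : Te.[y] = T.[e * y].
  rewrite /Te horner_poly (@horner_coef_wide _ q.+1) ?size_poly//.
  by apply: eq_bigr => i _; rewrite exprMn mulrA.
(* The lower moments vanish by induction, so only the term of degree [q] survives. It has size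
   [e ^+ q] while the Taylor remainder contributes [e ^+ q.+1]. *)
have MT : \int[mu]_(y in setT) (Te.[y] * psi y) = T`_q * e ^+ q * M.
  rewrite (Rintegral_poly_schwartz Spsi (N := q.+1)) ?size_poly//.
  rewrite big_ord_recr/= coef_poly ltnSn big1 ?add0r// => i _.
  by rewrite IH ?mulr0// (leq_trans (ltn_ord i)).
have ig1 : mu.-integrable setT (EFin \o (fun y => psi (a + e * y) * psi y)).
  have := psi_comp_schwartz_integrable 0 e a (@ltr01 R).
  by congr (mu.-integrable _ _); apply/funext => y /=; rewrite mul1r addr0 addrC.
have B : `|\int[mu]_(y in setT) (psi (a + e * y) * psi y - Te.[y] * psi y)|
    <= D * e ^+ q.+1 * C * (1^-1 * Wint R).
  apply: (proj2 (@dom_affine R _ 1 0 (D * e ^+ q.+1 * C) ltr01 _ _)).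
    move=> y; apply: cvgB; apply: cvgM; try exact: cpsi; last exact: continuous_horner.
    exact: cpa.
  move=> y; rewrite -mulrBl normrM mul1r addr0 TeE.
  have tb := taylor_bound_all a (schwartz_smooth Spsi) hD (a + e * y).
  rewrite addrAC subrr add0r in tb.
  apply: (le_trans (ler_wpM2r (normr_ge0 _) tb)).
  rewrite normrM exprMn (ger0_norm (ltW e0)) -!mulrA.
  rewrite ler_pM2l// ler_pM2l ?exprn_gt0//.
  apply: (le_trans _ (hC y)); rewrite ler_wpM2r//.
  by rewrite lerXn2r ?nnegrE ?addr_ge0// lerDr.
rewrite RintegralB// ?orth ?sub0r ?normrN ?MT in B; last exact: integrable_poly_schwartz.
rewrite -/e; move: B; rewrite invr1 mul1r.
have -> : T`_q * e ^+ q * M = e ^+ q * (T`_q * M) by ring.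
rewrite normrM normrX (ger0_norm (ltW e0)).
have -> : D * e ^+ q.+1 * C * Wint R = e ^+ q * (D * C * Wint R * e) by rewrite exprS; ring.
by rewrite ler_pM2l ?exprn_gt0.
Qed.

(** Makes the wavelet coefficients blind to the polynomial in the definition of
    [holder_exponent]. *)
Lemma Rintegral_poly_psi (P : {poly R}) (x0 : R) (j k : int) :
  \int[mu]_(x in setT) (P.[x - x0] * psi ((2:R) ^ j * x - k%:~R)) = 0.
Proof.
have p2 : 0 < (2:R) ^ j by rewrite exprz_gt0.
pose Q : {poly R} := P \Po (((2:R) ^ j)^-1 *: 'X + (k%:~R * ((2:R) ^ j)^-1 - x0)%:P).
have cg : continuous (fun y => Q.[y] * psi y).
  by move=> y; apply: cvgM; [exact: continuous_horner|exact: cpsi].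
have := Rintegral_affine (- k%:~R) p2 cg (integrable_poly_schwartz Spsi Q).
rewrite (Rintegral_poly_schwartz Spsi (leqnn _)) big1 ?mulr0; last first.
  by move=> i _; rewrite moment_eq0 mulr0.
move=> <-; congr Rintegral; apply/funext => x; congr (_ * _).
rewrite /Q horner_comp hornerD hornerZ hornerX hornerC; congr (P.[_]).
by field; rewrite gt_eqF.
Qed.

End WaveletMoments.

(** * The limit set of the tree *)

Section Kset.
Variables (R : realType) (b : nat -> nat -> nat).
Implicit Types (x : R) (n N : nat).

Definition kap n x : nat := Num.truncn (2 ^+ J n * x).

Definition Kset : set R := [set x | 0 <= x /\ forall n, T b n (kap n x)].

Lemma kap_itv n x : 0 <= x -> (kap n x)%:R <= 2 ^+ J n * x < (kap n x).+1%:R.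
Proof. by move=> x0; apply: truncn_itv; rewrite mulr_ge0// exprn_ge0. Qed.

Lemma kap_eq n x k : k%:R <= 2 ^+ J n * x < k.+1%:R -> kap n x = k.
Proof. by move=> h; apply: truncn_def. Qed.

Lemma natr_divn_itv (m d : nat) : (0 < d)%N ->
  ((m %/ d)%:R * d%:R : R) <= m%:R /\ (m.+1%:R : R) <= (m %/ d).+1%:R * d%:R.
Proof.
move=> d0; rewrite -!natrM !ler_nat leq_divM; split=> //.
by rewrite mulnC; have := ltn_ceil m d0; rewrite mulnC.
Qed.

Lemma pow2_natr n : ((2 ^ n)%N%:R : R) = 2 ^+ n. Proof. by rewrite natrX. Qed.

Lemma pow2_J n N : (n <= N)%N -> (2 : R) ^+ J N = 2 ^+ J n * (2 ^ (J N - J n))%N%:R.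
Proof. by move=> nN; rewrite pow2_natr -exprD subnKC// J_mono. Qed.

Lemma kap_div n N x : (n <= N)%N -> 0 <= x ->
  (kap N x %/ 2 ^ (J N - J n))%N = kap n x.
Proof.
move=> nN x0; apply/esym/kap_eq.
set d := (2 ^ (J N - J n))%N; have d0 : (0 < d)%N by rewrite expn_gt0.
have [h1 h2] := natr_divn_itv (kap N x) d0.
have /andP[k1 k2] := kap_itv N x0.
have dR : 0 < (d%:R : R) by rewrite ltr0n.
rewrite (pow2_J nN) -/d mulrAC in k1 k2.
rewrite -(ler_pM2r dR) -[X in _ && X](ltr_pM2r dR).
by rewrite (le_trans h1 k1) (lt_le_trans k2 h2).
Qed.

Lemma kap_floor n x : 0 <= x -> Num.floor (2 ^+ J n * x) = (kap n x)%:Z.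
Proof.
move=> x0; apply: floor_def.
have /andP[h1 h2] := kap_itv n x0; rewrite -[(kap n x).+1%:R]natr1 in h2.
by apply/andP; split=> //; rewrite intrD.
Qed.

Lemma Kset_lt1 x : Kset x -> x < 1.
Proof.
move=> [x0 /(_ 0%N)/eqP k0]; have := kap_itv 0 x0.
by rewrite k0 expr0 mul1r => /andP[].
Qed.

(** Children lie in the first quarter of their parent. Thus distances between points of [Kset]
    follow the differences of their indices up to an error of a quarter. *)
Lemma Kset_quarter x n : Kset x -> 2 ^+ J n * x <= (kap n x)%:R + 4^-1.
Proof.
move=> [x0 Tx]; have [_ m] := T_margin (ltnSn n) (Tx n.+1).
have /andP[_ k2] := kap_itv n.+1 x0.
set d := (2 ^ _)%N in m.
have dR : 0 < (d%:R : R) by rewrite ltr0n expn_gt0.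
rewrite (pow2_J (leqnSn n)) -/d mulrAC in k2.
rewrite -(ler_pM2r dR) (le_trans (ltW k2))// -(kap_div (leqnSn n) x0) -/d.
rewrite {1}(divn_eq (kap n.+1 x) d) -addnS natrD natrM mulrDl lerD2l.
by rewrite mulrC ler_pdivlMr// -natrM ler_nat mulnC.
Qed.

(** The left ends of the nested intervals increase, but their supremum might be a right end, which a
    half-open interval excludes; the margins keep all of them below each midpoint. *)
Lemma Kset_exists (k : nat -> nat) : (forall n, T b n (k n)) ->
  (forall n, (k n.+1 %/ 2 ^ (J n.+1 - J n))%N = k n) ->
  exists2 x, Kset x & forall n, kap n x = k n.
Proof.
move=> Tk dk.
have dkN n N : (n <= N)%N -> (k N %/ 2 ^ (J N - J n))%N = k n.
  move=> nN; rewrite -(subnKC nN); elim: (N - n)%N => [|d IH].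
    by rewrite addn0 subnn divn1.
  rewrite -[RHS]IH -(dk (n + d)%N) -divnMA -expnD addnS; congr (_ %/ 2 ^ _)%N.
  by have := J_mono (leq_addr d n); have := J_lt (n + d); lia.
pose v n : R := (k n)%:R / 2 ^+ J n.
have vle n N : v N * 2 ^+ J n <= (k n)%:R + 2^-1.
  have [nN|Nn] := ltnP n N.
    have [_ m] := T_margin nN (Tk N).
    rewrite /v (pow2_J (ltnW nN)); set d := (2 ^ _)%N in m *.
    have dR : 0 < (d%:R : R) by rewrite ltr0n expn_gt0.
    have -> : (k N)%:R / (2 ^+ J n * d%:R) * 2 ^+ J n = (k N)%:R / d%:R :> R.
      by field; rewrite expf_neq0 ?gt_eqF.
    rewrite ler_pdivrMr// {1}(divn_eq (k N) d) (dkN _ _ (ltnW nN)) natrD natrM mulrDl lerD2l.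
    rewrite mulrC ler_pdivlMr// -natrM ler_nat; lia.
  rewrite /v (pow2_J Nn); set d := (2 ^ _)%N.
  have d0 : (0 < d)%N by rewrite expn_gt0.
  have [h1 _] := natr_divn_itv (k n) d0.
  rewrite (dkN _ _ Nn) in h1.
  rewrite mulrA divfK ?expf_neq0//; lra.
pose S := [set v n | n in setT].
have S0 : S !=set0 by exists (v 0%N), 0%N.
have ubS n : ubound S (((k n)%:R + 2^-1) / 2 ^+ J n).
  by move=> _ [N _ <-]; rewrite ler_pdivlMr ?pow2_gt0.
have hS : has_sup S by split => //; exists (((k 0%N)%:R + 2^-1) / 2 ^+ J 0); exact: ubS.
have x0 : 0 <= sup S.
  by apply: (@le_trans _ _ (v 0%N)); [rewrite /v mulr_ge0// invr_ge0 exprn_ge0|apply: ub_le_sup;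
    [exact: hS.2|exists 0%N]].
have ks n : kap n (sup S) = k n.
  apply: kap_eq; apply/andP; split.
    rewrite mulrC -ler_pdivrMr ?pow2_gt0//; apply: ub_le_sup; [exact: hS.2|by exists n].
  have : sup S <= ((k n)%:R + 2^-1) / 2 ^+ J n by apply: ge_sup.
  by rewrite ler_pdivlMr ?pow2_gt0// (mulrC (sup S)) -[(k n).+1%:R]natr1; lra.
by exists (sup S) => //; split=> // n; rewrite ks.
Qed.

(** Left ends of deep nodes stay away from both ends of every ancestor, so a small enough error
    cannot move [x] out of that ancestor. *)
Lemma Kset_limit x : 0 <= x ->
  (forall n : nat, exists N k, [/\ T b N.+1 k, (n <= J N.+1)%N &
     `|x - k%:R / 2 ^+ J N.+1| <= 2 * (2 ^+ n)^-1]) -> Kset x.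
Proof.
(* In units of a node of depth [i], the error is [2 * 2 ^- (i + 6)], below the left margin
   [2 ^- (i + 3)] and the right margin of three quarters. *)
move=> x0 H; split=> // i; have [N [k [Tk nJ xk]]] := H (J i + i + 6)%N.
have iN : (i < N.+1)%N.
  by rewrite ltnNge; apply/negP => /J_mono; lia.
have [m1 m2] := T_margin iN Tk.
rewrite (pow2_J (ltnW iN)) in xk.
have Tkk := T_anc (ltnW iN) Tk.
set d := (2 ^ _)%N in m1 m2 xk Tkk; set kk := (k %/ d)%N in Tkk.
suff -> : kap i x = kk by [].
apply: kap_eq.
have dR : 0 < (d%:R : R) by rewrite ltr0n expn_gt0.
have P := pow2_gt0 R (J i).
set t := 2 ^+ J i * x.
set r := (k %% d)%N in m1 m2.
have kE : k%:R / d%:R = kk%:R + r%:R / d%:R :> R.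
  by rewrite {1}(divn_eq k d) natrD natrM mulrDl mulfK ?gt_eqF.
have r2 : r%:R / d%:R <= 4^-1 :> R.
  rewrite ler_pdivrMr// mulrC ler_pdivlMr// -natrM ler_nat; lia.
have r1 : (2 ^+ (i + 3))^-1 <= r%:R / d%:R :> R.
  by rewrite ler_pdivlMr// mulrC ler_pdivrMr ?pow2_gt0// -natrX -natrM ler_nat mulnC.
have tx : `|t - k%:R / d%:R| <= 2 * (2 ^+ (i + 6))^-1.
  have -> : t - k%:R / d%:R = 2 ^+ J i * (x - k%:R / (2 ^+ J i * d%:R)).
    by rewrite /t; field; rewrite expf_neq0 ?gt_eqF.
  rewrite normrM ger0_norm ?(ltW P)// -ler_pdivlMl//; apply: (le_trans xk).
  by rewrite -addnA exprD invfM le_eqVlt; apply/orP; left; apply/eqP; ring.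
have e8 : (2 ^+ (i + 3))^-1 = 8 * (2 ^+ (i + 6))^-1 :> R.
  have -> : (2 : R) ^+ (i + 6) = 2 ^+ (i + 3) * 8.
    by rewrite (_ : (i + 6 = i + 3 + 3)%N); [rewrite exprD; congr (_ * _); rewrite -natrX|lia].
  by field; rewrite expf_neq0.
have eb : 0 < (2 ^+ (i + 6) : R)^-1 <= 64^-1.
  rewrite invr_gt0 pow2_gt0 lef_pV2 ?posrE ?pow2_gt0//= exprD.
  have : 1 <= 2 ^+ i :> R by rewrite exprn_ege1// ler1n.
  by rewrite (_ : 2 ^+ 6 = 64 :> R); [lra|ring].
move: tx; rewrite ler_norml kE -[kk.+1%:R]natr1 => /andP[tx1 tx2].
move: eb => /andP[eb1 eb2]; lra.
Qed.

End Kset.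

(** * Geometric series *)

Section GeometricSums.
Variable R : realType.
Implicit Types (u v : nat -> R) (C r : R).

Definition sumn_lim u : R := limn (series u).

Definition geombd u C r := forall n, `|u n| <= C * r ^+ n.

Lemma geombd_cvg u C r : 0 <= r < 1 -> geombd u C r -> cvgn (series u).
Proof.
move=> /andP[r0 r1] h; apply: normed_cvg.
apply: (@series_le_cvg _ _ (geometric C r)) => //.
- by move=> n; rewrite /=.
- by move=> n; exact: le_trans (normr_ge0 _) (h n).
- by apply: is_cvg_geometric_series; rewrite ger0_norm.
Qed.

Lemma geometric_sum_nat r N M : (N <= M)%N ->
  (\sum_(N <= i < M) r ^+ i) * (1 - r) = r ^+ N - r ^+ M.
Proof.
move=> NM; rewrite -(subnKC NM); elim: (M - N)%N => [|k IH].
  by rewrite addn0 big_geq// mul0r subrr.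
by rewrite addnS big_nat_recr ?leq_addr//= mulrDl IH exprS; ring.
Qed.

Lemma geombd_tail u C r N : 0 <= r < 1 -> geombd u C r ->
  `|sumn_lim u - \sum_(n < N) u n| <= C * r ^+ N / (1 - r).
Proof.
move=> rr h; have cu := geombd_cvg rr h; move: rr => /andP[r0 r1].
have C0 : 0 <= C by have := h 0%N; rewrite expr0 mulr1; exact: le_trans.
have p1 : 0 < 1 - r by rewrite subr_gt0.
have E n : (N <= n)%N -> `|series u n - \sum_(n < N) u n| <= C * r ^+ N / (1 - r).
  move=> Nn; rewrite /series/= (@big_cat_nat _ _ _ N)//= big_mkord addrAC subrr add0r.
  apply: (le_trans (ler_norm_sum _ _ _)).
  apply: (@le_trans _ _ (\sum_(N <= i < n) C * r ^+ i)); first by apply: ler_sum => i _; exact: h.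
  rewrite -mulr_sumr -mulrA ler_wpM2l// ler_pdivlMr//.
  by rewrite geometric_sum_nat// gerBl exprn_ge0.
have cv : (fun n => `|series u n - \sum_(n < N) u n|) @ \oo --> `|sumn_lim u - \sum_(n < N) u n|.
  by apply: cvg_norm; apply: cvgB; [exact: cu|exact: cvg_cst].
rewrite -(cvg_lim _ cv)//; apply: limr_le; first by apply/cvg_ex; eexists; exact: cv.
by near=> n; apply: E; near: n; exact: nbhs_infty_ge.
Unshelve. all: by end_near. Qed.

Lemma geombd_sum u C r : 0 <= r < 1 -> geombd u C r -> `|sumn_lim u| <= C / (1 - r).
Proof. by move=> rr h; have := geombd_tail 0 rr h; rewrite big_ord0 subr0 expr0 mulr1. Qed.

Lemma sumn_limB u v C r C' r' : 0 <= r < 1 -> 0 <= r' < 1 ->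
  geombd u C r -> geombd v C' r' ->
  sumn_lim (fun n => u n - v n) = sumn_lim u - sumn_lim v.
Proof.
move=> rr rr' hu hv; rewrite /sumn_lim -limB; [|exact: geombd_cvg rr hu|exact: geombd_cvg rr' hv].
by congr (limn _); apply/funext => n; rewrite /series/= sumrB.
Qed.

Lemma sumn_lim_lin (N : nat) (t : nat -> nat -> R) (c : nat -> R) C r : 0 <= r < 1 ->
  (forall i, (i < N)%N -> geombd (t i) C r) ->
  sumn_lim (fun n => \sum_(i < N) t i n * c i) = \sum_(i < N) sumn_lim (t i) * c i.
Proof.
move=> rr; elim: N => [|N IH] ht.
  rewrite big_ord0 /sumn_lim; apply: cvg_lim => //.
  rewrite (_ : series _ = cst 0); first exact: cvg_cst.
  by apply/funext => n; rewrite /series/= big1// => i _; rewrite big_ord0.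
rewrite big_ord_recr/= -IH; last by move=> i iN; apply: ht; exact: ltnW.
have cN := geombd_cvg rr (ht N (ltnSn N)).
have cS : cvgn (series (fun n => \sum_(i < N) t i n * c i)).
  apply: (@geombd_cvg _ (\sum_(i < N) C * `|c i|) r) => // n.
  apply: (le_trans (ler_norm_sum _ _ _)); rewrite mulr_suml; apply: ler_sum => i _.
  by rewrite normrM mulrAC ler_wpM2r//; apply: ht; rewrite ltnS ltnW.
rewrite /sumn_lim (_ : series _ = (fun n => series (fun n => \sum_(i < N) t i n * c i) n +
  series (t N) n * c N)).
  rewrite limD//; last by apply: is_cvgMl; exact: cN.
  by congr (_ + _); apply/cvg_lim => //; apply: cvgMl; exact: cN.
apply/funext => n; rewrite /series/= mulr_suml -big_split/=.
by apply: eq_bigr => i _; rewrite big_ord_recr.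
Qed.

(* Finitely many terms can be absorbed into the constant. *)
Lemma geombd_eventually (X : Type) (D : set X) (g : X -> R) (u : nat -> X -> R) C r n1 :
  0 < r -> (forall x, D x -> 0 <= g x) ->
  (forall n, exists A : R, forall x, D x -> `|u n x| <= A * g x) ->
  (forall n x, (n1 <= n)%N -> D x -> `|u n x| <= C * r ^+ n * g x) ->
  exists2 C' : R, 0 <= C' & forall n x, D x -> `|u n x| <= C' * r ^+ n * g x.
Proof.
move=> r0 g0 hA hC; have [A hA'] := choice hA.
exists (`|C| + \sum_(i < n1) `|A i| / r ^+ i) => [|n x Dx].
  by rewrite addr_ge0// sumr_ge0// => i _; rewrite mulr_ge0// invr_ge0 exprn_ge0// ltW.
have S0 : 0 <= \sum_(i < n1) `|A i| / r ^+ i.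
  by apply: sumr_ge0 => i _; rewrite divr_ge0// exprn_ge0// ltW.
have rn : 0 < r ^+ n by rewrite exprn_gt0.
have [n1n|nn1] := leqP n1 n.
  apply: (le_trans (hC _ _ n1n Dx)); rewrite ler_wpM2r ?g0// ler_pM2r//.
  by apply: (le_trans (ler_norm _)); rewrite lerDl.
apply: (le_trans (hA' _ _ Dx)); rewrite ler_wpM2r ?g0//.
rewrite -ler_pdivrMr// (bigD1 (Ordinal nn1))//=.
apply: (@le_trans _ _ (`|A n| / r ^+ n)).
  by rewrite ler_pM2r ?invr_gt0// ler_norm.
rewrite addrCA lerDl addr_ge0// sumr_ge0// => i _.
by rewrite divr_ge0// exprn_ge0// ltW.
Qed.

End GeometricSums.

(** * Powers of two with real exponents *)

Section Powers.
Variable R : realType.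
Implicit Types (x y h : R).

Lemma powR2_nat (n : nat) : (2 : R) `^ n%:R = 2 ^+ n.
Proof. by rewrite powR_mulrn. Qed.

Lemma powR2D x y : (2 : R) `^ (x + y) = 2 `^ x * 2 `^ y.
Proof. by rewrite powRD// pnatr_eq0 implybT. Qed.

Lemma powR2_gt0 x : 0 < (2 : R) `^ x. Proof. by rewrite powR_gt0. Qed.

Lemma powR2_le x y : x <= y -> (2 : R) `^ x <= 2 `^ y.
Proof. by move=> xy; apply: ler_powR => //; rewrite ler1n. Qed.

Lemma powR2_exp x (n : nat) : (2 : R) `^ (x * n%:R) = (2 `^ x) ^+ n.
Proof. by rewrite powRrM powR_mulrn// powR_ge0. Qed.

Lemma powR2_lt1 x : x < 0 -> (2 : R) `^ x < 1.
Proof.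
move=> x0; rewrite -[X in _ < X](powRr0 2) /powR pnatr_eq0/= ltr_expR.
by rewrite ltr_pM2r// ln_gt0// ltr1n.
Qed.

Lemma powR_ge_id x h : 0 <= x <= 1 -> 0 <= h <= 1 -> x <= x `^ h.
Proof.
move=> /andP[]; rewrite le_eqVlt => /predU1P[<- _ _|x0 x1 /andP[h0 h1]]; first exact: powR_ge0.
by apply: ger1_powR; rewrite ?x0.
Qed.

Lemma powR_ge1 x h : 1 <= x -> 0 <= h -> 1 <= x `^ h.
Proof. by move=> x1 h0; rewrite -(powRr0 x) ler_powR. Qed.

End Powers.

(** * The lacunary wavelet series *)

Section Layers.
Variables (R : realType) (psi : R -> R).
Hypothesis Wpsi : wavelet psi.
Variables (b : nat -> nat -> nat) (eta : nat -> nat -> R) (m : R).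
Hypothesis m_gt0 : 0 < m.
Hypothesis eta_ge : forall n l, m <= eta n l.
Notation mu := (@lebesgue_measure R).

Let Spsi : schwartz psi := Wpsi.1.

Definition amp n k : R :=
  if T b n.+1 k then 2 `^ (- (eta n (lab n k) * (J n.+1)%:R)) else 0.

(* [layer n q] is, up to the factor [(2 ^+ J n.+1) ^+ q], the [q]-th derivative
   of the [n]-th layer of the wavelet series. *)
Definition layer n q (x : R) : R :=
  \sum_(k < 2 ^ J n.+1) amp n k * derive1n q psi (2 ^+ J n.+1 * x - k%:R).

Definition Fsum (x : R) : R := sumn_lim (fun n => layer n 0 x).

(** Rate at which the layers are summed; the other half of [m] is kept for the factor [|x - y| ^ al]
    in [Fsum_holder]. *)
Definition rho : R := 2 `^ (- (m / 2)).

Lemma rho_itv : 0 < rho /\ 0 <= rho < 1.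
Proof.
have r0 : 0 < rho by exact: powR2_gt0.
by rewrite (ltW r0) powR2_lt1// oppr_lt0 divr_gt0.
Qed.

Lemma amp_ge0 n k : 0 <= amp n k.
Proof. by rewrite /amp; case: ifP => // _; exact: powR_ge0. Qed.

Lemma amp_le n k : amp n k <= 2 `^ (- (m * (J n.+1)%:R)).
Proof.
rewrite /amp; case: ifP => _; last exact: powR_ge0.
by rewrite powR2_le// lerN2 ler_wpM2r.
Qed.

Lemma powR_scale_le (c : R) n : 0 <= c -> 2 `^ (- (c * (J n.+1)%:R)) <= (2 `^ (- c)) ^+ n.
Proof.
move=> c0; rewrite -powR2_exp powR2_le// mulNr lerN2 ler_wpM2l// ler_nat.
exact: leq_trans (leqnSn n) (J_ge n.+1).
Qed.

Lemma wsum_le M (y : R) (c : nat -> R) (g : R -> R) (A C : R) : 0 <= A -> 0 <= C ->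
  (forall k, (k < M)%N -> `|c k * g (y - k%:R)| <= A * C * ((1 + `|y - k%:R|) ^+ 2)^-1) ->
  `|\sum_(k < M) c k * g (y - k%:R)| <= 4 * C * A.
Proof.
move=> A0 C0 h; apply: (le_trans (ler_norm_sum _ _ _)).
apply: (@le_trans _ _ (\sum_(k < M) A * C * ((1 + `|y - k%:R|) ^+ 2)^-1)).
  by apply: ler_sum => k _; exact: h.
rewrite -mulr_sumr mulrC -mulrA [C * A]mulrC ler_wpM2r ?mulr_ge0//.
exact: sum_invsqr_le.
Qed.

Lemma layer_bound q : exists2 C : R, 0 < C &
  forall n x, `|layer n q x| <= C * 2 `^ (- (m * (J n.+1)%:R)).
Proof.
have [C C0 hC] := schwartz_decay Spsi 2 q; exists (4 * C) => [|n x]; first by rewrite mulr_gt0.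
apply: wsum_le; [exact: powR_ge0|exact: ltW|move=> k _].
rewrite normrM -mulrA; apply: ler_pM => //.
by rewrite ger0_norm ?amp_ge0// amp_le.
Qed.

Lemma layer_is_derive n q (x : R) :
  is_derive (x : R) (1 : R) (layer n q) (2 ^+ J n.+1 * layer n q.+1 x).
Proof.
rewrite /layer mulr_sumr.
rewrite (_ : (fun x => _) =
  \sum_(k < 2 ^ J n.+1) (fun x => amp n k * derive1n q psi (2 ^+ J n.+1 * x - k%:R))); last first.
  by apply/funext => y; rewrite fct_sumE.
apply: is_derive_sum => k.
have h1 := is_derive_affine (2 ^+ J n.+1) (- k%:R) x.
have h2 := derive1n_is_derive q (2 ^+ J n.+1 * x - k%:R) (schwartz_smooth Spsi).
have h3 := @is_derive1_comp R (derive1n q psi) (fun x => 2 ^+ J n.+1 * x + - k%:R) x _ _ h2 h1.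
have h4 := is_deriveZ (amp n k) h3.
apply: (is_derive_eq h4).
by rewrite /GRing.scale/=; ring.
Qed.

Lemma layer_derive1n n q : derive1n q (layer n 0) = (fun x => (2 ^+ J n.+1) ^+ q * layer n q x).
Proof.
elim: q => [|q IH]; first by apply/funext => x; rewrite expr0 mul1r.
apply/funext => x; rewrite derive1nS IH derive1E.
have h := is_deriveZ ((2 ^+ J n.+1) ^+ q) (layer_is_derive n q x).
by have E := @derive_val _ _ _ _ _ _ _ h; rewrite exprSr -mulrA; exact: E.
Qed.

Lemma layer_smooth n : smooth (layer n 0).
Proof.
move=> q x; rewrite layer_derive1n.
by have [] := is_deriveZ ((2 ^+ J n.+1) ^+ q) (layer_is_derive n q x).
Qed.

Lemma layer_continuous n : continuous (layer n 0).
Proof. exact: is_derive_continuous (layer_is_derive n 0). Qed.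

Lemma rho_scale (c : R) n : m / 2 <= c -> 2 `^ (- (c * (J n.+1)%:R)) <= rho ^+ n.
Proof.
move=> mc; have m2 : 0 <= m / 2 by rewrite ltW// divr_gt0.
apply: (le_trans (powR_scale_le n (le_trans m2 mc))).
by rewrite lerXn2r ?nnegrE ?powR_ge0// powR2_le// lerN2.
Qed.

Lemma layer_geombd : exists2 C : R, 0 < C & forall x, geombd (fun n => layer n 0 x) C rho.
Proof.
have [C C0 hC] := layer_bound 0; exists C => // x n.
apply: (le_trans (hC n x)); rewrite ler_pM2l// rho_scale//.
by rewrite ler_pdivrMr// ler_peMr ?ler1n// ltW.
Qed.

Lemma Fsum_bounded : exists2 C : R, 0 < C & forall x, `|Fsum x| <= C.
Proof.
have [C C0 hC] := layer_geombd; have [r0 rr] := rho_itv.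
exists (C / (1 - rho)); first by rewrite divr_gt0// subr_gt0; case/andP: rr.
by move=> x; exact: geombd_sum (hC x).
Qed.

Lemma Fsum_tail : exists2 C : R, 0 < C &
  forall N x, `|Fsum x - \sum_(n < N) layer n 0 x| <= C * rho ^+ N.
Proof.
have [C C0 hC] := layer_geombd; have [r0 rr] := rho_itv.
exists (C / (1 - rho)); first by rewrite divr_gt0// subr_gt0; case/andP: rr.
by move=> N x; rewrite mulrAC; exact: geombd_tail (hC x).
Qed.

Lemma Fsum_holder : holder_continuous Fsum.
Proof.
(* [al <= 1] allows interpolation between the sup bound and the Lipschitz bound of a layer;
   [al <= m / 2] keeps the sum over the layers convergent. *)
pose al := Num.min m 1 / 2.
have min0 : 0 < Num.min m 1 by rewrite lt_min m_gt0 ltr01.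
have al0 : 0 < al by rewrite divr_gt0.
have alm : al <= m / 2 by rewrite ler_wpM2r ?invr_ge0// ge_min lexx.
have al1 : al <= 1.
  by rewrite ler_pdivrMr// mul1r ge_min; apply/orP; right; rewrite ler1n.
have [r0 rr] := rho_itv.
have [C0 C00 h0] := layer_bound 0; have [C1 C10 h1] := layer_bound 1.
pose C := 2 * C0 + C1.
have Cp : 0 < C by rewrite addr_gt0// mulr_gt0.
exists al, (C / (1 - rho)); split=> // x y.
have [D D0 hD] := layer_geombd.
rewrite /Fsum -(sumn_limB rr rr (hD x) (hD y)).
rewrite mulrAC; apply: geombd_sum => // n.
set a := (J n.+1)%:R : R.
pose u := 2 ^+ J n.+1 * `|x - y|.
have u0 : 0 <= u by rewrite mulr_ge0// exprn_ge0.
have main : `|layer n 0 x - layer n 0 y| <= C * 2 `^ (- (m * a)) * u `^ al.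
  have p0 := powR2_gt0 (- (m * a)).
  have [u1|u1] := lerP u 1.
    have [c _] := MVT_between y (x - y) (layer_is_derive n 0).
    rewrite subrKC => ->; rewrite normrM normrM ger0_norm ?exprn_ge0//.
    have -> : 2 ^+ J n.+1 * `|layer n 1 (y + c)| * `|x - y| = `|layer n 1 (y + c)| * u.
      by rewrite /u; ring.
    apply: ler_pM => //; last by apply: powR_ge_id; rewrite ?u0 ?(ltW al0).
    apply: (le_trans (h1 _ _)); rewrite ler_pM2r// /C lerDr mulr_ge0// ltW//.
  apply: (@le_trans _ _ (C * 2 `^ (- (m * a)))).
    apply: (le_trans (ler_normB _ _)); apply: (le_trans (lerD (h0 _ _) (h0 _ _))).
    rewrite -/a -mulrDl ler_pM2r// /C; lra.
  by rewrite ler_peMr ?mulr_ge0 ?(ltW Cp) ?(ltW p0)// powR_ge1 ?(ltW u1) ?(ltW al0).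
apply: (le_trans main); rewrite /u powRM ?exprn_ge0//.
have -> : (2 ^+ J n.+1) `^ al = 2 `^ (al * a) by rewrite -powR2_nat -powRrM mulrC.
have -> : C * 2 `^ (- (m * a)) * (2 `^ (al * a) * `|x - y| `^ al) =
    C * `|x - y| `^ al * (2 `^ (- (m * a)) * 2 `^ (al * a)) by ring.
rewrite -powR2D ler_wpM2l ?mulr_ge0 ?powR_ge0 ?(ltW Cp)//.
have -> : - (m * a) + al * a = - ((m - al) * a) by ring.
by apply: rho_scale; lra.
Qed.

Lemma holder_continuousW (g : R -> R) : holder_continuous g -> continuous g.
Proof.
move=> [al [C [al0 hg]]] x; apply/cvgrPdist_le => e e0.
have C1 : 0 < `|C| + 1 by rewrite ltr_wpDl.
have eC : 0 < e / (`|C| + 1) by rewrite divr_gt0.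
pose d := (e / (`|C| + 1)) `^ al^-1.
have d0 : 0 < d by rewrite powR_gt0.
have nd : \forall y \near x, `|x - y| <= d.
  by apply/nbhs_ballP; exists d => //= y; rewrite /ball/= => /ltW.
near=> y; have xd : `|x - y| <= d by near: y.
apply: (le_trans (hg _ _)).
have xy : `|x - y| `^ al <= e / (`|C| + 1).
  have -> : e / (`|C| + 1) = d `^ al by rewrite -powRrM mulVf ?gt_eqF// powRr1// ltW.
  by apply: ge0_ler_powR => //; rewrite ?nnegrE ltW.
apply: (@le_trans _ _ ((`|C| + 1) * `|x - y| `^ al)).
  rewrite ler_wpM2r ?powR_ge0//; apply: (le_trans (ler_norm _)); rewrite lerDl//.
by rewrite mulrC -ler_pdivlMr.
Unshelve. all: by end_near. Qed.

Lemma Fsum_continuous : continuous Fsum.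
Proof. exact: holder_continuousW Fsum_holder. Qed.

Lemma Rintegral_layer_psi n (j k : int) :
  mu.-integrable setT (EFin \o (fun x => layer n 0 x * psi ((2:R) ^ j * x - k%:~R))) /\
  \int[mu]_(x in setT) (layer n 0 x * psi ((2:R) ^ j * x - k%:~R)) =
  \sum_(i < 2 ^ J n.+1) amp n i * (if (j == (J n.+1)%:Z) && (k ==
    i%:Z) then (2:R) ^ (- j) else 0).
Proof.
pose h (i : nat) x := amp n i * (psi ((2:R) ^ j * x - k%:~R) * psi ((2:R) ^ (J n.+1)%:Z *
  x - i%:Z%:~R)).
have i0 (i : nat) : mu.-integrable setT (EFin \o (fun x => psi ((2:R) ^ j * x - k%:~R) *
  psi ((2:R) ^ (J n.+1)%:Z * x - i%:Z%:~R))).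
  by apply: psi_comp_schwartz_integrable => //; rewrite exprz_gt0.
have ih i : mu.-integrable setT (EFin \o h i).
  exact: (integrableZl (@measurableT _ _) _ (i0 i)).
have E : (fun x => layer n 0 x * psi ((2:R) ^ j * x - k%:~R)) = (fun x =>
  \sum_(i < 2 ^ J n.+1) h i x).
  apply/funext => x; rewrite /layer mulr_suml; apply: eq_bigr => i _.
  by rewrite /h -mulrA; congr (_ * _); rewrite mulrC.
have [h1 h2] := Rintegral_sum (2 ^ J n.+1) ih.
rewrite E; split=> //; rewrite h2; apply: eq_bigr => i _.
by rewrite RintegralZl// orthonormal_psi.
Qed.

(** Orthonormality gives the coefficients of the partial sums, and uniform convergence against an
    integrable wavelet bounds the rest. For fixed [j] and [k] the partial sums are eventually
    constant, so letting [N] grow determines the coefficient. *)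
Lemma wcoef_Fsum_cvg (j k : int) :
  exists2 C : R, 0 < C & forall N, `|wcoef psi Fsum j k - \sum_(n < N)
    \sum_(i < 2 ^ J n.+1) amp n i * (if (j == (J n.+1)%:Z) && (k == i%:Z) then 1 else 0)|
    <= C * rho ^+ N.
Proof.
have p2 : 0 < (2:R) ^ j by rewrite exprz_gt0.
have [C C0 hC] := Fsum_tail; have [D D0 hD] := schwartz_growth Spsi 0.
have cpsi : continuous psi := schwartz_continuous Spsi (q := 0).
have W0 := Wint_ge0 R.
exists (C * D * Wint R + 1) => [|N]; first by rewrite ltr_wpDl// !mulr_ge0// ltW.
pose S x := \sum_(n < N) layer n 0 x.
pose g x := psi ((2:R) ^ j * x - k%:~R).
have cg : continuous g by exact: continuous_comp_affine.
have [iS eS] : mu.-integrable setT (EFin \o (fun x => S x * g x)) /\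
    \int[mu]_(x in setT) (S x * g x) = \sum_(n < N) \int[mu]_(x in setT) (layer n 0 x * g x).
  have E : (fun x => S x * g x) = (fun x => \sum_(n < N) layer n 0 x * g x).
    by apply/funext => x; rewrite /S mulr_suml.
  by rewrite E; apply: (@Rintegral_sum R N (fun n x => layer n 0 x * g x)) => n;
    exact: (Rintegral_layer_psi n j k).1.
have cS : continuous S.
  rewrite /S; elim: (N) => [|N' IH].
    by under [X in continuous X]eq_fun do rewrite big_ord0; move=> x; exact: cvg_cst.
  under [X in continuous X]eq_fun do rewrite big_ord_recr/=.
  by move=> x; apply: cvgD; [exact: IH|exact: layer_continuous].
have gD x : `|g x| <= D * (oneDsqr ((2:R) ^ j * x + - k%:~R))^-1.
  by have := hD ((2:R) ^ j * x - k%:~R); rewrite expr0 mul1r.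
have [iD bD] : mu.-integrable setT (EFin \o (fun x => (Fsum x - S x) * g x)) /\
   `|\int[mu]_(x in setT) ((Fsum x - S x) * g x)| <= (C * rho ^+ N * D) * (((2:R) ^ j)^-1 *
     Wint R).
  apply: (dom_affine p2 (b := - k%:~R)).
    by move=> x; apply: cvgM; [apply: cvgB; [exact: Fsum_continuous|exact: cS]|exact: cg].
  move=> x; rewrite normrM -mulrA; apply: ler_pM => //; exact: hC.
have E : \int[mu]_(x in setT) (Fsum x * g x) =
   \int[mu]_(x in setT) ((Fsum x - S x) * g x) + \int[mu]_(x in setT) (S x * g x).
  rewrite -RintegralD//; apply: eq_Rintegral => x _; ring.
rewrite /wcoef -/g E mulrDr eS.
have -> : \sum_(n < N) \int[mu]_(x in setT) (layer n 0 x * g x) =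
    \sum_(n < N) \sum_(i < 2 ^ J n.+1) amp n i * (if (j == (J n.+1)%:Z) && (k ==
      i%:Z) then (2:R) ^ (- j) else 0).
  by apply: eq_bigr => n _; rewrite (Rintegral_layer_psi n j k).2.
rewrite mulr_sumr.
have -> : \sum_(n < N) ((2:R) ^ j * \sum_(i < 2 ^ J n.+1) amp n i * (if (j ==
  (J n.+1)%:Z) && (k == i%:Z) then (2:R) ^ (- j) else 0)) =
   \sum_(n < N) \sum_(i < 2 ^ J n.+1) amp n i * (if (j == (J n.+1)%:Z) && (k ==
     i%:Z) then 1 else 0).
  apply: eq_bigr => n _; rewrite mulr_sumr; apply: eq_bigr => i _.
  rewrite mulrCA; case: ifP => _; last by rewrite mulr0.
  by rewrite -expfzDr ?pnatr_eq0// subrr expr0z.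
rewrite addrK normrM (ger0_norm (ltW p2)) -ler_pdivlMl//.
apply: (le_trans bD).
have -> : C * rho ^+ N * D * (((2:R) ^ j)^-1 * Wint R) = ((2:R) ^ j)^-1 * (C * D * Wint R *
  rho ^+ N) by ring.
rewrite ler_wpM2l ?invr_ge0 ?(ltW p2)// ler_wpM2r ?lerDl//.
by rewrite exprn_ge0//; case: rho_itv => /ltW.
Qed.

Lemma rho_small (c C : R) : (forall N : nat, `|c| <= C * rho ^+ N) -> c = 0.
Proof.
have [r0 /andP[_ r1]] := rho_itv => h.
apply/eqP/negPn/negP; rewrite -normr_gt0 => c0.
have : (fun N => C * rho ^+ N) @ \oo --> C * 0.
  by apply: cvgMr; apply: cvg_expr; rewrite ger0_norm// ltW.
rewrite mulr0 => /cvgrPdist_lt/(_ _ c0)[N _ /(_ N (leqnn N))].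
rewrite sub0r normrN ltNge => /negP; apply.
exact: le_trans (h N) (ler_norm _).
Qed.

Lemma wcoef_Fsum_level n (k : nat) : (k < 2 ^ J n.+1)%N ->
  wcoef psi Fsum (J n.+1)%:Z k%:Z = amp n k.
Proof.
move=> kn; have [C C0 hC] := wcoef_Fsum_cvg (J n.+1)%:Z k%:Z.
have [r0 rr] := rho_itv.
apply/eqP; rewrite -subr_eq0; apply/eqP.
apply: (@rho_small _ (C * rho ^+ n.+1)) => N.
(* The generations [J n.+1] are distinct, so only layer [n] contributes and the partial sum is
   constant from [n.+1] layers on. *)
have := hC (n.+1 + N)%N; rewrite exprD mulrA.
congr (`| _ - _ | <= _).
rewrite big_split_ord/= big_ord_recr/= [X in X + _ + _]big1 ?add0r; last first.
  move=> i _; rewrite big1// => l _; rewrite eqz_nat.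
  by rewrite gtn_eqF ?mulr0// J_ltn// ltnS.
rewrite [X in _ + X]big1 ?addr0; last first.
  move=> i _; rewrite big1// => l _; rewrite eqz_nat.
  by rewrite ltn_eqF ?mulr0// J_ltn//; lia.
rewrite (bigD1 (Ordinal kn))//= !eqxx mulr1 big1 ?addr0// => i ik.
have -> : (k%:Z == i%:Z) = false.
  by rewrite eqz_nat; apply/negbTE; move: ik; apply: contra => /eqP e; apply/eqP/val_inj.
by rewrite andbF mulr0.
Qed.

Lemma wcoef_Fsum_neq0 (j k : int) : wcoef psi Fsum j k != 0 ->
  exists n i, [/\ T b n.+1 i, j = (J n.+1)%:Z & k = i%:Z].
Proof.
move=> w0; apply/not_existsP => H; move/eqP: w0; apply.
have [C C0 hC] := wcoef_Fsum_cvg j k.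
apply: (@rho_small _ C) => N; have := hC N.
rewrite big1 ?subr0// => n _; rewrite big1// => i _.
rewrite /amp; case: ifP => Ti; last by rewrite mul0r.
case: ifP => [/andP[/eqP ej /eqP ek]|_]; last by rewrite mulr0.
by exfalso; apply: (H n); exists (nat_of_ord i).
Qed.

End Layers.

(** * The wavelet support of the series *)

Section Support.
Variables (R : realType) (psi : R -> R).
Hypothesis Wpsi : wavelet psi.
Variables (b : nat -> nat -> nat) (eta : nat -> nat -> R) (m : R).
Hypothesis m_gt0 : 0 < m.
Hypothesis eta_ge : forall n l, m <= eta n l.
Notation F := (Fsum psi b eta).

Lemma dyadicE (j : nat) (k : int) (x : R) :
  dyadic j%:Z k x <-> k%:~R <= 2 ^+ j * x < k%:~R + 1.
Proof.
rewrite /dyadic/= -invr_expz -exprnP intrD.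
by rewrite ler_pdivrMr ?pow2_gt0// ltr_pdivlMr ?pow2_gt0// [x * _]mulrC.
Qed.

Lemma dyadic_sub (j n : nat) (x : R) : (n <= j)%N ->
  @dyadic R j%:Z (Num.floor (2 ^+ j * x)) `<=` @dyadic R n%:Z (Num.floor (2 ^+ n * x)).
Proof.
move=> nj y /dyadicE/andP[y1 y2]; apply/dyadicE.
have D0 : 0 < (2 : R) ^+ (j - n) by exact: pow2_gt0.
have E z : 2 ^+ j * z = 2 ^+ n * z * 2 ^+ (j - n) :> R by rewrite mulrAC -exprD subnKC.
have DE : (2 : R) ^+ (j - n) = (2 ^ (j - n))%N%:Z%:~R by rewrite -pmulrn natrX.
set M := Num.floor (2 ^+ n * x).
have [M1 M2] : M%:~R <= 2 ^+ n * x /\ 2 ^+ n * x < M%:~R + 1.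
  by have /andP[h1 h2] := Num.Theory.floor_itv (2 ^+ n * x); rewrite intrD in h2.
have f1 : M * (2 ^ (j - n))%N%:Z <= Num.floor (2 ^+ j * x).
  by rewrite Num.Theory.floor_ge_int intrM -DE E ler_pM2r.
have f2 : Num.floor (2 ^+ j * x) < (M + 1) * (2 ^ (j - n))%N%:Z.
  by rewrite Num.Theory.floor_lt_int intrM -DE E ltr_pM2r// intrD.
have f2' : Num.floor (2 ^+ j * x) + 1 <= (M + 1) * (2 ^ (j - n))%N%:Z by rewrite lezD1.
apply/andP; split.
  rewrite -(ler_pM2r D0) -E DE -intrM; apply: le_trans y1; by rewrite ler_int.
rewrite -(ltr_pM2r D0) -E; apply: (lt_le_trans y2).
have : (Num.floor (2 ^+ j * x) + 1)%:~R <= ((M + 1) *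
  (2 ^ (j - n))%N%:Z)%:~R :> R by rewrite ler_int.
by rewrite intrM -DE !intrD.
Qed.

(** A positive leader at [x] comes from a node inside a neighbouring interval, whose left end is
    within two interval lengths of [x], and [Kset_limit] applies. Conversely, the nodes containing a
    point of [Kset] have non-zero coefficients. *)
Lemma wsupp_Fsum : wsupp psi F = Kset b.
Proof.
apply/seteqP; split => x /=.
  move=> [/andP[x0 x1] H]; apply: Kset_limit => // n.
  have /ereal_sup_gt[_ [jk [M [hM sub]] <-]] := H n.+1 isT.
  case: jk sub => j k /= sub; rewrite lte_fin normr_gt0 => /(wcoef_Fsum_neq0 Wpsi m_gt0 eta_ge).
  move=> [N [i [Ti ej ek]]]; subst j k; exists N, i.
  have fl := Num.Theory.floor_itv (2 ^+ n.+1 * x).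
  set f := Num.floor _ in hM fl; move: fl; rewrite intrD => /andP[f1 f2].
  have hM' : M%:~R - f%:~R <= 1 :> R /\ f%:~R - M%:~R <= 1 :> R.
    rewrite -!intrB -[X in _ <= X /\ _ <= X]/(1%:~R) !ler_int.
    by move/or3P: hM => [] /eqP ->; lia.
  pose p : R := 2 ^+ n.+1; pose P : R := 2 ^+ J N.+1.
  have p0 : 0 < p by exact: pow2_gt0.
  have P0 : 0 < P by exact: pow2_gt0.
  pose y : R := i%:R / P.
  have dy : dyadic n.+1%:Z M y.
    apply: sub; apply/dyadicE; rewrite /y -/P mulrCA mulfV ?gt_eqF// mulr1 lexx/=.
    by rewrite ltrDl.
  move/dyadicE : dy; rewrite -/p => /andP[y1 y2].
  split=> //.
    (* A longer node would also contain [y + p^-1], which leaves an interval of length [p^-1] that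
       contains [y]. *)
    rewrite leqNgt; apply/negP => Jn.
    have : dyadic n.+1%:Z M (y + p^-1).
      apply: sub; apply/dyadicE; rewrite /y -/P mulrDr mulrCA mulfV ?gt_eqF// mulr1.
      rewrite lerDl mulr_ge0 ?invr_ge0 ?(ltW p0) ?(ltW P0)//= ltrD2l.
      by rewrite ltr_pdivrMr// mul1r /P /p ltr_eXn2l ?ltr1n// ltnW.
    move/dyadicE; rewrite -/p mulrDr mulfV ?gt_eqF// => /andP[_].
    by rewrite ltrD2r ltNge y1.
  have E : x - y = (p * x - p * y) / p by field; rewrite gt_eqF.
  rewrite -/P -/y E normrM [`|p^-1|]ger0_norm ?invr_ge0 ?(ltW p0)//.
  have np : p^-1 <= (2 ^+ n)^-1.
    by rewrite lef_pV2 ?posrE ?pow2_gt0// ler_eXn2l ?ltr1n.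
  apply: ler_pM => //; first by rewrite invr_ge0 ltW.
  by case: hM' => ? ?; rewrite ler_norml -/p in f1 f2 *; apply/andP; split; lra.
move=> Kx; have [x0 Tx] := Kx; split; first by rewrite x0 ltW// (Kset_lt1 Kx).
move=> n _; apply: (@lt_le_trans _ _ (`|amp b eta n (kap n.+1 x)|)%:E).
  by rewrite lte_fin normr_gt0 /amp Tx gt_eqF// powR2_gt0.
apply: ereal_sup_ubound; exists ((J n.+1)%:Z, (kap n.+1 x)%:Z) => /=.
  exists (Num.floor (2 ^+ n * x)); split; first by rewrite eqxx orbT.
  rewrite -(kap_floor n.+1 x0); apply: dyadic_sub.
  exact: leq_trans (leqnSn n) (J_ge n.+1).
by rewrite (wcoef_Fsum_level Wpsi b m_gt0 eta_ge)//; exact: T_lt (Tx n.+1).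
Qed.

End Support.

(** * Pointwise exponents *)

Section ExponentUpper.
Variables (R : realType) (psi : R -> R).
Hypothesis Wpsi : wavelet psi.
Variables (b : nat -> nat -> nat) (eta : nat -> nat -> R) (m : R).
Hypothesis m_gt0 : 0 < m.
Hypothesis eta_ge : forall n l, m <= eta n l.
Notation mu := (@lebesgue_measure R).
Let Spsi : schwartz psi := Wpsi.1.
Notation F := (Fsum psi b eta).

(** The coefficient is the integral of [F - P] against the wavelet, as polynomials integrate to 0.
    Since [x0] lies in the interval of the wavelet, [|x - x0|] is at most [1 + |y|] interval
    lengths, [y] being the rescaled variable. *)
Lemma holder_amp (x0 h : R) : Kset b x0 -> 0 <= h ->
  (exists P : {poly R}, exists C : R, exists delta : R, 0 < delta /\
       forall x : R, `| x - x0 | < delta ->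
         `| F x - P.[x - x0] | <= C * (`| x - x0 | `^ h)) ->
  exists2 C : R, 0 < C & forall n, amp b eta n (kap n.+1 x0) <= C * 2 `^ (- (h * (J n.+1)%:R)).
Proof.
move=> [x00 Tx0] h0 [P [C [d [d0 hC]]]].
have [B B0 hB] := Fsum_bounded Wpsi b m_gt0 eta_ge.
have [Cp [N [Cp0 hP]]] := poly_growth P.
(* The local estimate is made global at the price of polynomial growth: away from [x0], [F] is
   bounded, [P] grows polynomially and [|x - x0| ^ h] is at least [d ^ h]. *)
have C1 : exists2 C1 : R, 0 <= C1 & forall x, `|F x - P.[x - x0]| <= C1 * `|x - x0| `^ h * (1 +
  `|x - x0|) ^+ N.
  have dh : 0 < d `^ h by exact: powR_gt0.
  exists (`|C| + (B + Cp) / d `^ h) => [|x].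
    by rewrite addr_ge0// divr_ge0 ?addr_ge0 ?(ltW B0)// ltW.
  set t : R := `|x - x0|; have t0 : 0 <= t by exact: normr_ge0.
  have t1 : 1 <= (1 + t) ^+ N by rewrite exprn_ege1// lerDl.
  have th : 0 <= t `^ h by exact: powR_ge0.
  have BC : 0 <= (B + Cp) / d `^ h by rewrite divr_ge0 ?addr_ge0 ?(ltW B0)// ltW.
  have [td|td] := ltP t d.
    apply: (le_trans (hC _ td)); rewrite -/t.
    apply: (@le_trans _ _ ((`|C| + (B + Cp) / d `^ h) * t `^ h)).
      by rewrite ler_wpM2r//; apply: (le_trans (ler_norm _)); rewrite lerDl.
    by rewrite ler_peMr// mulr_ge0// addr_ge0.
  apply: (le_trans (ler_normB _ _)).
  apply: (@le_trans _ _ ((B + Cp) * (1 + t) ^+ N)).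
    rewrite mulrDl; apply: lerD; last exact: hP.
    by apply: (le_trans (hB x)); rewrite ler_peMr// ltW.
  rewrite ler_wpM2r ?(le_trans ler01)//.
  apply: (@le_trans _ _ ((B + Cp) / d `^ h * t `^ h)); last by rewrite ler_wpM2r// lerDr.
  rewrite -mulrA ler_peMr ?addr_ge0 ?(ltW B0)// mulrC ler_pdivlMr// mul1r.
  by apply: ge0_ler_powR; rewrite // ?nnegrE ?(ltW d0)//; exact: le_trans (ltW d0) td.
have {hC} [{}C C0 hC] := C1.
(* An integer exponent above [h], so that the decay of [psi] can absorb [(1 + |y|) ^ h]. *)
pose H := Num.bound h.
have hH : h <= H%:R by apply: (le_trans (ler_norm _)); apply: ltW; have := archi_boundP h0;
  rewrite (ger0_norm h0).
have [D D0 hD] := schwartz_growth Spsi (H + N).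
have W0 := Wint_ge0 R.
exists (C * 2 ^+ N * D * Wint R + 1) => [|n].
  by rewrite ltr_wpDl// !mulr_ge0// ?exprn_ge0// ltW.
set k := kap n.+1 x0.
rewrite -(wcoef_Fsum_level Wpsi b m_gt0 eta_ge (T_lt (Tx0 n.+1))) -/k.
set a := J n.+1.
have p0 : 0 < (2 : R) ^+ a by exact: pow2_gt0.
pose g (x : R) := psi ((2:R) ^ a%:Z * x - k%:Z%:~R).
have cpsi : continuous psi := schwartz_continuous Spsi (q := 0).
have cg : continuous g by exact: continuous_comp_affine.
have bd x : `|(F x - P.[x - x0]) * g x| <=
    C * 2 ^+ N * D * 2 `^ (- (h * a%:R)) * (oneDsqr ((2:R) ^+ a * x + - k%:R))^-1.
  rewrite /g -exprnP -[k%:Z%:~R]/(k%:R); set y := 2 ^+ a * x - k%:R.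
  have y1 : 0 <= 1 + `|y| by rewrite addr_ge0.
  have /andP[k1 k2] := kap_itv n.+1 x00; rewrite -/k -/a -[k.+1%:R]natr1 in k1 k2.
  have xy : `|x - x0| <= (1 + `|y|) / 2 ^+ a.
    rewrite ler_pdivlMr// -[X in _ * X](ger0_norm (ltW p0)) -normrM.
    have -> : (x - x0) * 2 ^+ a = y - (2 ^+ a * x0 - k%:R) by rewrite /y; ring.
    apply: (le_trans (ler_normB _ _)); rewrite addrC lerD2r ger0_norm; lra.
  have xy1 : `|x - x0| <= 1 + `|y|.
    apply: (le_trans xy); rewrite ler_piMr// invf_le1//.
    by rewrite exprn_ege1// ler1n.
  have e1 : `|x - x0| `^ h <= (1 + `|y|) ^+ H * 2 `^ (- (h * a%:R)).
    apply: (@le_trans _ _ (((1 + `|y|) / 2 ^+ a) `^ h)).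
      by apply: ge0_ler_powR; rewrite // nnegrE divr_ge0// ltW.
    rewrite powRM// ?invr_ge0 ?(ltW p0)//.
    have -> : ((2 : R) ^+ a)^-1 `^ h = 2 `^ (- (h * a%:R)).
      by rewrite -powR2_nat -powRN -powRrM mulNr mulrC.
    rewrite ler_pM2r ?powR2_gt0// -powR_mulrn//; apply: ler_powR => //.
    by rewrite lerDl.
  have e2 : (1 + `|x - x0|) ^+ N <= 2 ^+ N * (1 + `|y|) ^+ N.
    rewrite -exprMn lerXn2r ?nnegrE ?addr_ge0 ?mulr_ge0//.
    by have := normr_ge0 y; lra.
  rewrite normrM; apply: (le_trans (ler_wpM2r (normr_ge0 _) (hC x))).
  apply: (@le_trans _ _ (C * ((1 + `|y|) ^+ H * 2 `^ (- (h * a%:R))) * (2 ^+ N * (1 + `|y|) ^+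
    N) * `|psi y|)).
    rewrite ler_wpM2r//; apply: ler_pM => //.
    - by rewrite mulr_ge0// powR_ge0.
    - by rewrite ler_wpM2l.
  have -> : C * ((1 + `|y|) ^+ H * 2 `^ (- (h * a%:R))) * (2 ^+ N * (1 + `|y|) ^+ N) * `|psi y| =
    C * 2 ^+ N * 2 `^ (- (h * a%:R)) * ((1 + `|y|) ^+ (H + N) * `|psi y|) by rewrite exprD; ring.
  have -> : C * 2 ^+ N * D * 2 `^ (- (h * a%:R)) * (oneDsqr y)^-1 =
    C * 2 ^+ N * 2 `^ (- (h * a%:R)) * (D * (oneDsqr y)^-1) by ring.
  by rewrite ler_wpM2l// !mulr_ge0 ?powR_ge0 ?exprn_ge0.
have cP : continuous (fun x => P.[x - x0]).
  rewrite (_ : (fun x => _) = (fun x => P.[1 * x + - x0])); last first.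
    by apply/funext => z; rewrite mul1r.
  by apply: (@continuous_comp_affine R (fun z => P.[z])); exact: continuous_horner.
have [iD bD] : mu.-integrable setT (EFin \o (fun x => (F x - P.[x - x0]) * g x)) /\
   `|\int[mu]_(x in setT) ((F x - P.[x - x0]) * g x)| <= (C * 2 ^+ N * D * 2 `^ (- (h *
     a%:R))) * ((2 ^+ a)^-1 * Wint R).
  apply: (dom_affine p0 (b := - k%:R)) => // x.
  apply: cvgM; last exact: cg.
  apply: cvgB; first exact: (Fsum_continuous Wpsi m_gt0 eta_ge).
  exact: cP.
have iP : mu.-integrable setT (EFin \o (fun x => P.[x - x0] * g x)).
  have := integrable_affine (a := 2 ^+ a) (- k%:R) p0 _ (integrable_poly_schwartz Spsi (P \Po
    ((2 ^+ a)^-1 *: 'X + (k%:R * (2 ^+ a)^-1 - x0)%:P))).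
  move=> /(_ _)/wrap[|]; first by move=> y; apply: cvgM; [exact: continuous_horner|exact: cpsi].
  congr (_.-integrable _ _); apply/funext => x /=; rewrite /g -exprnP.
  rewrite horner_comp hornerD hornerZ hornerX hornerC; congr (P.[_] * _)%:E.
  by field; rewrite expf_neq0.
have E : \int[mu]_(x in setT) (F x * g x) = \int[mu]_(x in setT) ((F x - P.[x - x0]) * g x).
  rewrite -[RHS]addr0 -(Rintegral_poly_psi Wpsi P x0 a%:Z k%:Z) -RintegralD//.
  by apply: eq_Rintegral => x _; rewrite /g; ring.
rewrite /wcoef -/g E -exprnP; apply: (le_trans (ler_norm _)).
rewrite normrM (ger0_norm (ltW p0)); apply: (le_trans (ler_wpM2l (ltW p0) bD)).
have -> : 2 ^+ a * (C * 2 ^+ N * D * 2 `^ (- (h * a%:R)) * ((2 ^+ a)^-1 * Wint R)) =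
   C * 2 ^+ N * D * Wint R * 2 `^ (- (h * a%:R)) by field; rewrite expf_neq0.
by rewrite ler_wpM2r ?powR_ge0// lerDl.
Qed.

Lemma holder_exponent_le (x0 h' : R) : Kset b x0 ->
  (forall n0, exists2 n, (n0 <= n)%N & eta n (lab n (kap n.+1 x0)) <= h') ->
  (holder_exponent F x0 <= h'%:E)%E.
Proof.
move=> Kx H; apply: ge_ereal_sup => _ [h [h0 hh] <-]; rewrite lee_fin.
have [C C0 hC] := holder_amp Kx h0 hh.
rewrite leNgt; apply/negP => h'h.
have e0 : 0 < h - h' by rewrite subr_gt0.
have l2 : 0 < ln (2 : R) by rewrite ln_gt0// ltr1n.
have el0 : 0 < (h - h') * ln 2 by rewrite mulr_gt0.
(* From here on [2 ^ ((h - h') * J n.+1)] exceeds [C], by [expR x >= 1 + x]. *)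
pose n0 := Num.bound (C / ((h - h') * ln 2)).
have [n n0n hn] := H n0.
have := hC n; have [x00 Tx] := Kx; rewrite /amp Tx.
set a := (J n.+1)%:R : R.
have a0 : 0 <= a by rewrite ler0n.
apply/negP; rewrite -ltNge.
apply: (@lt_le_trans _ _ (2 `^ (- (h' * a)))); last first.
  by rewrite powR2_le// lerN2 ler_wpM2r.
have -> : - (h' * a) = (h - h') * a + - (h * a) by ring.
rewrite powR2D ltr_pM2r ?powR2_gt0//.
have Ca : C / ((h - h') * ln 2) < a.
  have := archi_boundP (divr_ge0 (ltW C0) (ltW el0)).
  move=> /lt_le_trans; apply.
  by rewrite ler_nat -/n0 (leq_trans n0n)// (leq_trans (leqnSn n))// J_ge.
rewrite ltr_pdivrMr// in Ca; apply: (lt_le_trans Ca).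
rewrite /powR pnatr_eq0/=.
apply: (le_trans _ (expR_ge1Dx _)).
by rewrite mulrCA mulrA -subr_ge0; have -> : 1 + (h - h') * a * ln 2 - (h - h') * a * ln 2 =
  1 by ring.
Qed.

Lemma holder_exponent_ge0 (x0 : R) : (0 <= holder_exponent F x0)%E.
Proof.
have [B B0 hB] := Fsum_bounded Wpsi b m_gt0 eta_ge.
apply: ereal_sup_ubound; exists 0 => //=; split=> //.
exists 0, B, 1; split=> // x _.
by rewrite horner0 subr0 powRr0 mulr1.
Qed.

End ExponentUpper.

(** * Lower bound for the pointwise exponent *)

Section ExponentLower.
Variables (R : realType) (psi : R -> R).
Hypothesis Wpsi : wavelet psi.
Variables (b : nat -> nat -> nat) (eta : nat -> nat -> R) (m : R).
Hypothesis m_gt0 : 0 < m.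
Hypothesis eta_ge : forall n l, m <= eta n l.
Let Spsi : schwartz psi := Wpsi.1.
Notation F := (Fsum psi b eta).

Variables (x0 h h' : R) (n0 : nat).
Hypothesis Kx0 : Kset b x0.
Hypothesis h_ge0 : 0 <= h.
Hypothesis h_lt : h < h'.
Hypothesis eta_lb : forall n, (n0 <= n)%N -> h' <= eta n (lab n (kap n.+1 x0)).

Notation a n := ((J n.+1)%:R : R).

(** Amounts to [2 * (J n + n + 5) <= J n.+1], an equality at [n = 0]. The 4 pays for the halved slot
    width in [layer_near]. *)
Lemma wid_half n : (J n.+1 + 4 <= 2 * wid n)%N.
Proof. by have := J_wid n; have := J_S n; nia. Qed.

Lemma wid_gt0 n : (0 < wid n)%N.
Proof. by have := wid_half n; lia. Qed.

Lemma amp_le1 n k : amp b eta n k <= 1.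
Proof.
apply: (le_trans (amp_le b eta_ge n k)); rewrite -[X in _ <= X](powRr0 2) powR2_le//.
by rewrite oppr_le0 mulr_ge0// ltW.
Qed.

(* A node with another label sits in another slot, hence so far from [x0] that
   the decay of [psi] makes its contribution negligible. *)
Lemma layer_near q : exists2 C : R, 0 < C & forall n x, (n0 <= n)%N ->
  2 ^+ J n.+1 * `|x - x0| <= 2 ^+ wid n / 2 ->
  `|layer psi b eta n q x| <= C * 2 `^ (- (h' * a n)).
Proof.
have [x00 Tx0] := Kx0.
(* Across half a slot the decay of order [Q] gives a power of 2 with exponent about [- Q * wid n],
   and [wid n] is only known to exceed half of [J n.+1]; hence the factor 2. *)
pose Q := Num.bound (2 * h').
have h'0 : 0 < h' by exact: le_lt_trans h_lt.
have Qh : 2 * h' <= Q%:R by apply: ltW; apply: archi_boundP; rewrite mulr_ge0// ltW.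
have [C1 C10 hC1] := schwartz_decay Spsi 2 q.
have [C2 C20 hC2] := schwartz_decay Spsi (2 + Q) q.
exists (4 * (C1 + C2)) => [|n x n0n xn]; first by rewrite mulr_gt0// addr_gt0.
have p0 := powR2_gt0 (- (h' * a n)).
apply: wsum_le => [||k _]; [exact: ltW|by rewrite addr_ge0// ltW|].
set y := 2 ^+ J n.+1 * x.
have s0 : 0 <= ((1 + `|y - k%:R|) ^+ 2)^-1 by rewrite invr_ge0 exprn_ge0// addr_ge0.
have [Tk|Tk] := boolP (T b n.+1 k); last first.
  by rewrite /amp (negPf Tk) mul0r normr0 !mulr_ge0// ?(ltW p0)// addr_ge0// ltW.
rewrite normrM (ger0_norm (amp_ge0 _ _ _ _)).
set k0 := kap n.+1 x0.
have [sk|sk] := eqVneq (slot n k) (slot n k0).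
  rewrite -[_ * (C1 + C2) * _]mulrA; apply: ler_pM => //; first exact: amp_ge0.
    by rewrite /amp Tk powR2_le// lerN2 ler_wpM2r// (lab_slot sk) eta_lb.
  by apply: (le_trans (hC1 _)); rewrite ler_wpM2r// lerDl ltW.
have far : 2 ^+ wid n <= `|2 ^+ J n.+1 * x0 - k%:R|.
  have ok : odd (slot n k) by move: Tk; rewrite T_S => /andP[_ /and3P[]].
  have ok0 : odd (slot n k0) by move: (Tx0 n.+1); rewrite T_S => /andP[_ /and3P[]].
  have /andP[z1 z2] := kap_itv n.+1 x00; rewrite -/k0 in z1 z2.
  have [l|l] := slot_far ok ok0 sk.
    have : ((k + 2 ^ wid n)%N%:R : R) <= k0%:R by rewrite ler_nat ltnW.
    rewrite natrD natrX => l'; have w0 := pow2_gt0 R (wid n); rewrite ger0_norm; lra.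
  have : ((k0.+1 + 2 ^ wid n)%N%:R : R) <= k%:R by rewrite ler_nat addSn.
  rewrite natrD natrX => l'; have w0 := pow2_gt0 R (wid n); rewrite ltr0_norm; lra.
have yk : 2 ^+ wid n / 2 <= `|y - k%:R|.
  have -> : y - k%:R = (2 ^+ J n.+1 * x0 - k%:R) - 2 ^+ J n.+1 * (x0 - x) by rewrite /y; ring.
  apply: le_trans (lerB_dist _ _); rewrite [`|_ *
    (x0 - x)|]normrM (distrC x0 x) (ger0_norm (exprn_ge0 _ (ler0n R 2))).
  by apply: le_trans (lerB far xn); lra.
rewrite -[_ * (C1 + C2) * _]mulrA; apply: (@le_trans _ _ (`|derive1n q psi (y - k%:R)|)).
  by rewrite ler_piMl// amp_le1.
apply: (le_trans (hC2 _)); rewrite exprD invfM.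
have -> : C2 * (((1 + `|y - k%:R|) ^+ 2)^-1 * ((1 + `|y - k%:R|) ^+ Q)^-1) =
   ((1 + `|y - k%:R|) ^+ Q)^-1 * (C2 * ((1 + `|y - k%:R|) ^+ 2)^-1) by ring.
apply: ler_pM => //.
- by rewrite mulr_ge0// ltW.
- rewrite powRN lef_pV2 ?posrE ?powR_gt0//.
  apply: (@le_trans _ _ ((2 `^ (a n / 2)) ^+ Q)).
    rewrite -powR2_exp powR2_le//.
    have := ler_wpM2r (ler0n R (J n.+1)) Qh; lra.
  rewrite lerXn2r ?nnegrE ?addr_ge0 ?powR_ge0//.
  apply: (@le_trans _ _ (2 ^+ wid n / 2)); last by move: yk; lra.
  rewrite ler_pdivlMr// -powR2_nat -[X in _ * X](powRr1 (ler0n R 2)) -powR2D powR2_le//.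
  have : ((J n.+1 + 4)%:R : R) <= (2 * wid n)%:R by rewrite ler_nat wid_half.
  by rewrite natrD natrM; lra.
- by rewrite ler_wpM2r// lerDr ltW.
Qed.

(** Such an [x] satisfies [|x - x0| >= 2 ^ (- (J n + n + 4))]. For [n >= 2 * h / m] the lacunarity
    of [J] makes the [h]-th power of this exceed [2 ^ (- (m / 2 * J n.+1))], so half of the sup
    bound of the layer is still left for summation. *)
Lemma layer_far : exists C : R, exists2 n1 : nat, 0 < C & forall n x, (n1 <= n)%N ->
  2 ^+ wid n / 2 <= 2 ^+ J n.+1 * `|x - x0| ->
  `|layer psi b eta n 0 x| <= C * 2 `^ (- (m / 2 * a n)) * `|x - x0| `^ h.
Proof.
have [C C0 hC] := layer_bound Wpsi b eta_ge 0.
exists C, (Num.bound (2 * h / m)) => // n x n1 xn.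
apply: (le_trans (hC n x)); rewrite -mulrA ler_pM2l//.
have hn : 2 * h / m < n%:R.
  apply: (lt_le_trans (archi_boundP _)); first by rewrite divr_ge0 ?mulr_ge0// ltW.
  by rewrite ler_nat.
have hn' : 2 * h <= n%:R * m by move: hn; rewrite ltr_pdivrMr// => /ltW.
pose t : R := (J n + n + 4)%:R.
have t0 : 0 <= t by rewrite ler0n.
have ta : n%:R * t <= a n.
  by rewrite -natrM ler_nat J_S; nia.
have xt : 2 `^ (- t) <= `|x - x0|.
  rewrite -(ler_pM2l (pow2_gt0 R (J n.+1))); apply: le_trans xn.
  rewrite -powR2_nat -powR2D ler_pdivlMr// -[X in _ * X](powRr1 (ler0n R 2)) -powR2D.
  rewrite -powR2_nat powR2_le// /t J_wid !natrD; lra.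
have : (2 `^ (- t)) `^ h <= `|x - x0| `^ h.
  by apply: ge0_ler_powR; rewrite // nnegrE ?powR_ge0.
rewrite -powRrM => xh.
apply: le_trans (ler_wpM2l (powR_ge0 _ _) xh).
rewrite -powR2D powR2_le//.
have h1 : h * t <= m / 2 * a n.
  have := ler_wpM2r t0 hn'; have := ler_wpM2l (ltW m_gt0) ta; lra.
lra.
Qed.

(** The first term is what remains for summation where [layer_near] applies, the second where
    [layer_far] does. *)
Definition gap : R := Num.min (h' - h) (m / 2).
Definition rate : R := 2 `^ (- gap).

Lemma gap_gt0 : 0 < gap.
Proof. by rewrite lt_min subr_gt0 h_lt divr_gt0. Qed.

Lemma rate_itv : 0 < rate /\ 0 <= rate < 1.
Proof.
have r0 : 0 < rate by exact: powR2_gt0.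
by rewrite (ltW r0) powR2_lt1// oppr_lt0 gap_gt0.
Qed.

Lemma rate_le (c : R) n : gap <= c -> 2 `^ (- (c * a n)) <= rate ^+ n.
Proof.
move=> gc; apply: (le_trans _ (powR_scale_le n (ltW gap_gt0))).
by rewrite powR2_le// lerN2 ler_wpM2r.
Qed.

Let D := Num.truncn h.

Let Dh : D%:R <= h < D.+1%:R. Proof. exact: truncn_itv. Qed.

Let t n i : R := (taylor (layer psi b eta n 0) x0 D.+1)`_i.

Let tE n i : (i <= D)%N -> t n i = (2 ^+ J n.+1) ^+ i * layer psi b eta n i x0 / i`!%:R.
Proof. by move=> iD; rewrite /t coef_poly ltnS iD layer_derive1n. Qed.

Lemma rate_pow n u : 0 <= u -> 2 `^ (- (h' * a n)) * (2 ^+ J n.+1 * u) `^ h <= rate ^+ n * u `^ h.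
Proof.
move=> u0; rewrite powRM ?exprn_ge0// mulrA ler_wpM2r ?powR_ge0//.
rewrite -powR2_nat -powRrM -powR2D.
have -> : - (h' * a n) + a n * h = - ((h' - h) * a n) by ring.
by apply: rate_le; rewrite ge_min lexx.
Qed.

Lemma taylor_coef_bound : exists2 C : R, 0 <= C &
  forall n i, (n0 <= n)%N -> (i <= D)%N ->
  `|t n i| <= C * 2 `^ (- (h' * a n)) * (2 ^+ J n.+1) ^+ i.
Proof.
have /choice[C hC] : forall i, exists c : R, 0 < c /\ forall n x, (n0 <= n)%N ->
    2 ^+ J n.+1 * `|x - x0| <= 2 ^+ wid n / 2 ->
    `|layer psi b eta n i x| <= c * 2 `^ (- (h' * a n)).
  by move=> i; have [c c0 hc] := layer_near i; exists c.
exists (\sum_(i < D.+1) C i) => [|n i n0n iD].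
  by apply: sumr_ge0 => i _; apply: ltW; exact: (hC i).1.
rewrite tE// normrM normrM normrX [`|2 ^+ _|]ger0_norm ?exprn_ge0//.
have f1 : `|(i`!%:R : R)^-1| <= 1.
  by rewrite ger0_norm ?invr_ge0// invf_le1 ?ltr0n ?fact_gt0// ler1n fact_gt0.
apply: (@le_trans _ _ ((2 ^+ J n.+1) ^+ i * `|layer psi b eta n i x0|)).
  by rewrite ler_piMr// mulr_ge0// exprn_ge0// exprn_ge0.
rewrite mulrC ler_wpM2r ?exprn_ge0//.
apply: (le_trans ((hC i).2 n x0 n0n _)).
  by rewrite subrr normr0 mulr0 divr_ge0// exprn_ge0.
rewrite ler_wpM2r ?powR_ge0// (bigD1 (Ordinal (iD : (i < D.+1)%N)))//= lerDl sumr_ge0// => l _.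
by apply: ltW; exact: (hC l).1.
Qed.

Lemma taylor_geombd : exists2 C : R, 0 <= C &
  forall i, (i < D.+1)%N -> geombd (fun n => t n i) C rate.
Proof.
have [C C0 hC] := taylor_coef_bound; have [r0 rr] := rate_itv.
have H1 n : exists A : R, forall i : 'I_D.+1, setT i -> `|t n i| <= A * 1.
  exists (\sum_(i < D.+1) `|t n i|) => i _; rewrite mulr1 (bigD1 i)//= lerDl.
  exact: sumr_ge0.
have H2 n (i : 'I_D.+1) : (n0 <= n)%N -> setT i -> `|t n i| <= C * rate ^+ n * 1.
  move=> n0n _; rewrite mulr1; apply: (le_trans (hC n i n0n (ltn_ord i))).
  rewrite -mulrA ler_wpM2l//.
  apply: (@le_trans _ _ (2 `^ (- (h' * a n)) * (2 ^+ J n.+1 * 1) `^ h)); last first.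
    by apply: (le_trans (rate_pow n ler01)); rewrite powR1 mulr1.
  rewrite ler_wpM2l ?powR_ge0// mulr1 -powR_mulrn ?exprn_ge0//; apply: ler_powR.
    by rewrite exprn_ege1// ler1n.
  case/andP: Dh => + _; apply: le_trans; rewrite ler_nat; exact: (ltn_ord i).
have [A A0 hA] := @geombd_eventually R 'I_D.+1 setT (fun=> 1) (fun n i => t n i) C rate n0
  r0 (fun _ _ => ler01) H1 H2.
by exists A => // i iD n; have := hA n (Ordinal iD) I; rewrite mulr1.
Qed.

(** With [u = 2 ^ J n.+1 * |x - x0|] there are three ranges. For [u <= 1] the Taylor remainder has
    order [D.+1 > h]. For [u > 1] the Taylor polynomial is controlled by [u ^ h], as its degree is
    at most [D <= h], and the layer itself by [layer_near] up to half a slot and by [layer_far]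
    beyond. *)
Lemma level_bound : exists2 C : R, 0 <= C & forall n x, `|x - x0| <= 1 ->
  `|layer psi b eta n 0 x - (taylor (layer psi b eta n 0) x0 D.+1).[x - x0]| <=
    C * rate ^+ n * `|x - x0| `^ h.
Proof.
have [r0 rr] := rate_itv.
have [C0 C00 hC0] := layer_near 0; have [C1 C10 hC1] := layer_near D.+1.
have [Ct Ct0 hCt] := taylor_coef_bound.
have [Cf [n1 Cf0 hCf]] := layer_far.
have /andP[D1 D2] := Dh.
pose C := C1 + C0 + Cf + Ct * D.+1%:R.
have CtD : 0 <= Ct * D.+1%:R by rewrite mulr_ge0.
apply: (@geombd_eventually R R [set x | `|x - x0| <= 1] (fun x => `|x - x0| `^ h)
   (fun n x => layer psi b eta n 0 x - (taylor (layer psi b eta n 0) x0 D.+1).[x - x0])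
   (C + Cf) rate (maxn n0 n1)) => //.
(* For each single layer some constant exists, whatever its label, since [h < D.+1] and
   [|x - x0| <= 1]; this handles the layers before [n0] and [n1]. *)
- move=> n; have [B B0 hB] := layer_bound Wpsi b eta_ge D.+1.
  exists ((2 ^+ J n.+1) ^+ D.+1 * (B * 2 `^ (- (m * a n)))) => x x1.
  have := taylor_bound_all x0 (@layer_smooth R psi Wpsi b eta n) (M := (2 ^+ J n.+1) ^+ D.+1 *
    (B * 2 `^ (- (m * a n)))) (N := D.+1).
  move=> /(_ _ x)/wrap[y|].
    rewrite layer_derive1n// normrM ger0_norm ?exprn_ge0 ?exprn_ge0//.
    by rewrite ler_wpM2l ?exprn_ge0 ?exprn_ge0.
  move=> /le_trans; apply; rewrite ler_wpM2l//.
    by rewrite !mulr_ge0 ?powR_ge0 ?exprn_ge0// ltW.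
  have [->|xx] := eqVneq x x0; first by rewrite subrr normr0 expr0n/= powR_ge0.
  by rewrite -powR_mulrn//; apply: ger_powR; [rewrite normr_gt0 subr_eq0 xx|exact: ltW].
move=> n x; rewrite geq_max => /andP[n0n n1n] /= x1.
set L := layer psi b eta n 0.
have P0 := powR2_gt0 (- (h' * a n)).
pose u := 2 ^+ J n.+1 * `|x - x0|.
have u0 : 0 <= u by rewrite mulr_ge0// exprn_ge0.
have w2 : 1 <= 2 ^+ wid n / 2 :> R.
  rewrite ler_pdivlMr// mul1r -[X in X <= _]expr1 ler_eXn2l ?ltr1n//.
  exact: wid_gt0.
have key : `|L x - (taylor L x0 D.+1).[x - x0]| <=
    C * (2 `^ (- (h' * a n)) * u `^ h) + Cf * 2 `^ (- (m / 2 * a n)) * `|x - x0| `^ h.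
  have rest : 0 <= Cf * 2 `^ (- (m / 2 * a n)) * `|x - x0| `^ h.
    by rewrite !mulr_ge0 ?powR_ge0// ltW.
  have [u1|u1] := lerP u 1.
    apply: (@le_trans _ _ (C * (2 `^ (- (h' * a n)) * u `^ h))); last by rewrite lerDl.
    have := @taylor_bound R L x0 ((2 ^+ J n.+1) ^+ D.+1 * (C1 * 2 `^ (- (h' *
      a n)))) `|x - x0| D.+1 (@layer_smooth R psi Wpsi b eta n).
    move=> /(_ _ (x - x0) (lexx _))/wrap[s sx|].
      rewrite layer_derive1n// normrM ger0_norm ?exprn_ge0 ?exprn_ge0//.
      rewrite ler_wpM2l ?exprn_ge0 ?exprn_ge0//; apply: hC1 => //.
      rewrite addrAC subrr add0r; apply: le_trans w2; apply: le_trans u1.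
      by rewrite /u ler_wpM2l ?exprn_ge0.
    rewrite subrKC => /le_trans; apply.
    have -> : (2 ^+ J n.+1) ^+ D.+1 * (C1 * 2 `^ (- (h' * a n))) * `|x - x0| ^+ D.+1 =
      C1 * (2 `^ (- (h' * a n)) * u ^+ D.+1) by rewrite /u exprMn; ring.
    apply: ler_pM => //; [exact: ltW|by rewrite mulr_ge0 ?exprn_ge0// ltW| |].
      by rewrite /C; lra.
    rewrite ler_wpM2l ?(ltW P0)//.
    have [->|un] := eqVneq u 0; first by rewrite expr0n/= powR_ge0.
    by rewrite -powR_mulrn//; apply: ger_powR; [rewrite lt_neqAle eq_sym un u0 u1|exact: ltW].
  have uh : 1 <= u `^ h by apply: powR_ge1 => //; exact: ltW.
  have Tb : `|(taylor L x0 D.+1).[x - x0]| <= Ct * D.+1%:R * (2 `^ (- (h' * a n)) * u `^ h).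
    rewrite (horner_coef_wide _ (size_poly _ _)); apply: (le_trans (ler_norm_sum _ _ _)).
    apply: (@le_trans _ _ (\sum_(i < D.+1) Ct * (2 `^ (- (h' * a n)) * u `^ h))); last first.
      by rewrite sumr_const card_ord -mulr_natr le_eqVlt; apply/orP; left; apply/eqP; ring.
    apply: ler_sum => i _; rewrite normrM normrX.
    apply: (le_trans (ler_wpM2r (exprn_ge0 _ (normr_ge0 _)) (hCt n i n0n (ltn_ord i)))).
    have -> : Ct * 2 `^ (- (h' * a n)) * (2 ^+ J n.+1) ^+ i * `|x - x0| ^+ i =
       Ct * (2 `^ (- (h' * a n)) * u ^+ i) by rewrite /u exprMn; ring.
    rewrite ler_wpM2l// ler_wpM2l ?(ltW P0)// -powR_mulrn//; apply: ler_powR; first exact: ltW.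
    by apply: le_trans D1; rewrite ler_nat; exact: (ltn_ord i).
  have Pu : 0 <= 2 `^ (- (h' * a n)) * u `^ h by rewrite mulr_ge0 ?powR_ge0.
  apply: (le_trans (ler_normB _ _)).
  have [uw|uw] := lerP u (2 ^+ wid n / 2).
    have := hC0 n x n0n uw; rewrite -/L => LC.
    have LC' : `|L x| <= C0 * (2 `^ (- (h' * a n)) * u `^ h).
      by apply: (le_trans LC); rewrite ler_pM2l// ler_peMr// ltW.
    have c0 : 0 <= (C1 + Cf) * (2 `^ (- (h' * a n)) * u `^ h) by rewrite mulr_ge0// addr_ge0 ?ltW.
    move: Tb LC' rest c0; rewrite /C; set X := 2 `^ _ * u `^ h; set Y := Cf * _ * _.
    by rewrite !mulrDl; lra.
  have := hCf n x n1n (ltW uw); rewrite -/L => LC.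
  have c0 : 0 <= (C1 + C0 + Cf) * (2 `^ (- (h' * a n)) * u `^ h).
    by rewrite mulr_ge0// !addr_ge0 ?ltW.
  move: Tb LC c0; rewrite /C; set X := 2 `^ _ * u `^ h; set Y := Cf * _ * _.
  by rewrite !mulrDl; lra.
apply: (le_trans key).
have k1 := rate_pow n (normr_ge0 (x - x0)).
have k2 : 2 `^ (- (m / 2 * a n)) * `|x - x0| `^ h <= rate ^+ n * `|x - x0| `^ h.
  by rewrite ler_wpM2r ?powR_ge0// rate_le// ge_min lexx orbT.
have CC : 0 <= C by move: C00 C10 Cf0 CtD; rewrite /C; set X := Ct * _; lra.
have l1 := ler_wpM2l CC k1; have l2 := ler_wpM2l (ltW Cf0) k2.
rewrite -/u in l1; apply: (le_trans (lerD l1 _)); first by rewrite -mulrA; exact: l2.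
by rewrite -mulrDl mulrA.
Qed.

(** The polynomial is the sum over all layers of their Taylor polynomials at [x0]; its coefficients
    converge by [taylor_geombd]. *)
Lemma holder_exponent_ge : (h%:E <= holder_exponent F x0)%E.
Proof.
have [r0 rr] := rate_itv.
have [Ct Ct0 hCt] := taylor_geombd.
have [C C0 hC] := level_bound.
have [Cl Cl0 hCl] := layer_geombd Wpsi b m_gt0 eta_ge.
have [_ rhor] := rho_itv m_gt0.
apply: ereal_sup_ubound; exists h => //=; split=> //.
exists (\poly_(i < D.+1) sumn_lim (fun n => t n i)), (C / (1 - rate)), 1; split=> // x /ltW x1.
rewrite horner_poly -(@sumn_lim_lin R D.+1 (fun i n => t n i) (fun i => (x - x0) ^+ i) Ct rate)//.
have gT : geombd (fun n => \sum_(i < D.+1) t n i * (x - x0) ^+ i)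
    (\sum_(i < D.+1) Ct * `|(x - x0) ^+ i|) rate.
  move=> n; apply: (le_trans (ler_norm_sum _ _ _)); rewrite mulr_suml; apply: ler_sum => i _.
  by rewrite normrM mulrAC ler_wpM2r//; exact: hCt.
rewrite -(sumn_limB rhor rr (hCl x) gT).
rewrite mulrAC; apply: geombd_sum => // n.
rewrite mulrAC; have := hC n x x1.
by rewrite (horner_coef_wide _ (size_poly _ _)).
Qed.

End ExponentLower.

(** * Hausdorff dimension *)

Section Hausdorff.
Variable R : realType.
Implicit Types (A : set R) (s C : R).

Lemma hcost_ge0 s A : 0 <= hcost s A.
Proof. by rewrite /hcost; destruct (pselect (A = set0)) => //; exact: powR_ge0. Qed.

Lemma hausdorff_pre_ge0 s d A : (0 <= hausdorff_pre s d A)%E.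
Proof.
apply: le_ereal_inf_tmp => _ [U _ <-]; apply: nneseries_ge0 => i _ _.
by rewrite lee_fin hcost_ge0.
Qed.

(** The bound [d] makes the supremum in [diam] genuine rather than a default value. *)
Lemma diam_ge A d x y : (forall x y, A x -> A y -> `|x - y| <= d) ->
  A x -> A y -> `|x - y| <= diam A.
Proof.
move=> Ad Ax Ay; apply: ub_le_sup; last by exists x => //; exists y.
by exists d => _ [x' Ax' [y' Ay' <-]]; exact: Ad.
Qed.

Lemma diam_le A d x : A x -> (forall x y, A x -> A y -> `|x - y| <= d) -> diam A <= d.
Proof.
move=> Ax Ad; apply: ge_sup; first by exists `|x - x|, x => //; exists x.
by move=> _ [x' Ax' [y' Ay' <-]]; exact: Ad.
Qed.

(* The inverse of [X] is Hoelder, so a cover of the range of [X] gives a cover of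
   [0, 1[ whose total length is at least 1. *)
Lemma hausdorff_measure_neq0 s C A (X : R -> R) : 0 < C ->
  (forall t, 0 <= t < 1 -> A (X t)) ->
  (forall t t', 0 <= t < 1 -> 0 <= t' < 1 -> `|t - t'| <= C * `|X t - X t'| `^ s) ->
  0 <= s -> hausdorff_measure s A != 0%E.
Proof.
move=> C0 AX hX s0; rewrite gt_eqF//.
apply: (@lt_le_trans _ _ (hausdorff_pre s 1 A)); last first.
  by apply: ereal_sup_ubound; exists 1 => //=.
have C2 : 0 < 2 * C by rewrite mulr_gt0.
apply: (@lt_le_trans _ _ ((2 * C)^-1)%:E); first by rewrite lte_fin invr_gt0.
apply: le_ereal_inf_tmp => _ [U [cov dU] <-].
set S := (\sum_(0 <= i <oo) _)%E.
(* A base parameter for each member of the cover; 0 is a dummy where the member misses the range of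
   [X]. *)
have [tt htt] : exists tt : nat -> R, forall i t, 0 <= t < 1 -> U i (X t) ->
    0 <= tt i < 1 /\ U i (X (tt i)).
  have /choice[tt htt] : forall i, exists t : R, forall t', 0 <= t' < 1 -> U i (X t') -> 0 <=
    t < 1 /\ U i (X t).
    move=> i; have [[t [t01 Ut]]|nt] := pselect (exists t, 0 <= t < 1 /\ U i (X t)).
      by exists t.
    by exists 0 => t' t01 Ut; exfalso; apply: nt; exists t'.
  by exists tt.
pose d i := C * hcost s (U i).
have d0 i : 0 <= d i by rewrite mulr_ge0 ?hcost_ge0// ltW.
pose V i : set R := [set` `[tt i - d i, tt i + d i]].
have sub : `[0, 1[%classic `<=` \bigcup_i V i.
  move=> t /=; rewrite in_itv/= => t01.
  have [i _ Ui] := cov _ (AX _ t01); exists i => //.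
  have [tt01 Utt] := htt _ _ t01 Ui.
  have : `|tt i - t| <= d i.
    apply: (le_trans (hX _ _ tt01 t01)); rewrite /d ler_pM2l// /hcost.
    destruct (pselect (U i = set0)) as [U0|U0]; first by rewrite U0 in Ui.
    apply: ge0_ler_powR; rewrite ?nnegrE//.
      by apply: le_trans (diam_ge (dU i) Ui Ui).
    exact: diam_ge (dU i) Utt Ui.
  by rewrite ler_norml /V/= in_itv/= => /andP[? ?]; apply/andP; split; lra.
have m01 : lebesgue_measure (`[0%R, 1%R[%classic : set R) = 1%E.
  by rewrite lebesgue_measure_itv/= lte_fin ltr01 oppr0 adde0.
have le1 : (1 <= \sum_(0 <= i <oo) lebesgue_measure (V i))%E.
  rewrite -m01; apply: (@measure_sigma_subadditive _ _ _ (@lebesgue_measure R) _ V) => //.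
  by move=> i; exact: measurable_itv.
have : (1 <= \sum_(0 <= i <oo) ((2 * C)%:E * (hcost s (U i))%:E))%E.
  apply: (le_trans le1); apply: lee_nneseries => [i _ _|i _]; first exact: measure_ge0.
  rewrite /V lebesgue_measure_itv/=; case: ifP => _; last first.
    by rewrite -EFinM lee_fin mulr_ge0 ?hcost_ge0// ltW.
  by rewrite -EFinD -EFinM lee_fin /d; lra.
rewrite nneseriesZl; last by move=> i _; rewrite lee_fin hcost_ge0.
rewrite -/S => le2.
rewrite -(@lee_pmul2l _ (2 * C)%:E)// ?lte_fin//.
by rewrite -EFinM mulfV ?gt_eqF.
Qed.

Lemma dimH_lower A a : A !=set0 ->
  (forall s, 0 <= s -> s < a -> hausdorff_measure s A != 0%E) -> (a%:E <= dimH A)%E.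
Proof.
move=> [x Ax] H; rewrite /dimH; destruct (pselect (A = set0)) as [A0|A0];
  first by rewrite A0 in Ax.
apply: le_ereal_inf_tmp => _ [s [s0 Hs] <-]; rewrite lee_fin leNgt; apply/negP => sa.
by have := H s s0 sa; rewrite Hs eqxx.
Qed.

Lemma dimH_upper A a : 0 <= a ->
  (forall s, a < s -> hausdorff_measure s A = 0%E) -> (dimH A <= a%:E)%E.
Proof.
move=> a0 H; rewrite /dimH; destruct (pselect (A = set0)) as [A0|A0]; first by rewrite leNye.
apply/lee_addgt0Pr => e e0; rewrite -EFinD.
apply: ereal_inf_lbound; exists (a + e) => //; split; first by rewrite addr_ge0// ltW.
by apply: H; rewrite ltrDl.
Qed.

Lemma dimH_set0 : dimH (@set0 R) = -oo%E.
Proof. by rewrite /dimH; destruct (pselect (@set0 R = set0)). Qed.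

Lemma nneseries_pair (c : nat * nat -> \bar R) (f : nat -> nat * nat) :
  set_bij setT setT f -> (forall p, 0 <= c p)%E ->
  (\sum_(i <oo) c (f i) = \sum_(i <oo) \sum_(j <oo) c (i, j))%E.
Proof.
move=> bf c0; rewrite nneseries_esumT; last by move=> i; exact: c0.
rewrite -(reindex_esum _ _ _ c bf) nneseries_esumT; last first.
  by move=> i; apply: nneseries_ge0 => j _ _; exact: c0.
have -> : (\esum_(i in [set: nat]) \sum_(j <oo) c (i, j) =
  \esum_(i in [set: nat]) \esum_(j in [set: nat]) c (i, j))%E.
  by apply: eq_esum => i _; rewrite nneseries_esumT.
rewrite (@esum_esum R nat nat setT (fun=> setT) (fun i j => c (i, j)))//.
congr esum; first by apply/seteqP; split.
by apply/funext => -[].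
Qed.

Lemma nneseries_le (u : nat -> \bar R) (x : \bar R) : (forall n, 0 <= u n)%E ->
  (forall M, \sum_(0 <= i < M) u i <= x)%E -> (\sum_(i <oo) u i <= x)%E.
Proof.
move=> u0 ux; apply: lime_le; first by apply: is_cvg_nneseries => n _ _; exact: u0.
by apply: nearW => M; exact: ux.
Qed.

Lemma sum_support_le (F : nat -> R) L M : (forall k, 0 <= F k) ->
  (forall k, (L <= k)%N -> F k = 0) -> \sum_(0 <= k < M) F k <= \sum_(0 <= k < L) F k.
Proof.
move=> F0 FL; have [ML|LM] := leqP M L.
  rewrite [leRHS](@big_cat_nat _ _ _ M)//= lerDl; exact: sumr_ge0.
rewrite (@big_cat_nat _ _ _ L)//= ?(ltnW LM)// gerDl.
by rewrite big_nat_cond big1// => k /andP[/andP[Lk _] _]; exact: FL.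
Qed.

(** A Borel-Cantelli covering: at depth [n.+1] there are at most [2 ^ (J n + n + 3 + s' * wid n)]
    nodes of the required kind, and their total cost at exponent [s] is the term of a geometric
    series. *)
Lemma hausdorff_limsup0 (b : nat -> nat -> nat) (s s' : R) A : 0 <= s' -> s' < s ->
  (forall n l, (b n l <= wid n)%N) ->
  A `<=` [set x | Kset b x /\ forall n0, exists2 n, (n0 <= n)%N &
            ((b n (lab n (kap n.+1 x)))%:R <= s' * (wid n)%:R :> R)] ->
  hausdorff_measure s A = 0%E.
Proof.
move=> s'0 ss' bw hA.
have s0 : 0 < s by exact: le_lt_trans ss'.
apply/eqP; rewrite eq_le; apply/andP; split; last first.
  by apply: (le_trans (hausdorff_pre_ge0 s 1 A)); apply: ereal_sup_ubound; exists 1 => //=.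
apply: ge_ereal_sup => _ [d /= d0 <-].
apply/lee_addgt0Pr => e e0; rewrite add0e.
(* Of the excess [2 * g * J n.+1] in the exponent, one half absorbs the [J n + n + 3] bits of the
   count once [g * n >= 1], the other half gives summability. *)
pose g : R := (s - s') / 2; have g0 : 0 < g by rewrite divr_gt0// subr_gt0.
pose r : R := 2 `^ (- g).
have r0 : 0 < r by exact: powR2_gt0.
have r1 : r < 1 by rewrite powR2_lt1// oppr_lt0.
pose n1 := Num.bound g^-1.
have [N [n1N Ne Nd]] : exists N, [/\ (n1 <= N)%N, r ^+ N / (1 - r) <= e & (2 ^+ N)^-1 <= d].
  have c1 : (fun N => r ^+ N / (1 - r)) @ \oo --> (0 : R).
    rewrite -[X in _ --> X](mul0r (1 - r)^-1); apply: cvgMl; apply: cvg_expr.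
    by rewrite ger0_norm// ltW.
  have c2 : (fun N => (2^-1 : R) ^+ N) @ \oo --> (0 : R).
    by apply: cvg_expr; rewrite ger0_norm// invf_lt1// ltr1n.
  have [N1 _ h1] : \forall N \near \oo, `|0 - r ^+ N / (1 - r)| <=
    e by exact: cvgr_dist_le c1 _ e0.
  have [N2 _ h2] : \forall N \near \oo, `|0 - (2^-1 : R) ^+ N| <=
    d by exact: cvgr_dist_le c2 _ d0.
  exists (maxn n1 (maxn N1 N2)); split; first by rewrite leq_maxl.
    have := h1 (maxn n1 (maxn N1 N2)); rewrite sub0r normrN /= => /(_ _)/wrap[|];
      first by rewrite !leq_max leqnn !orbT.
    by apply: le_trans; exact: ler_norm.
  have := h2 (maxn n1 (maxn N1 N2)); rewrite sub0r normrN /= exprVn => /(_ _)/wrap[|];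
    first by rewrite !leq_max leqnn !orbT.
  by apply: le_trans; exact: ler_norm.
have /card_esym/ppcard_eqP[f] := card_nat2.
pose sel n k := [&& (N <= n)%N, (k < 2 ^ J n.+1)%N, T b n.+1 k & ((b n (lab n k))%:R <= s' *
  (wid n)%:R :> R)].
(* Pairs that are not selected yield the empty set, whose cost is 0, so the cover can be indexed by
   all pairs. *)
pose V (p : nat * nat) : set R :=
  if sel p.1 p.2 then [set x | p.2%:R <= 2 ^+ J p.1.+1 * x <= p.2%:R + 1] else set0.
have Vd p x y : V p x -> V p y -> `|x - y| <= (2 ^+ J p.1.+1)^-1.
  rewrite /V; case: ifP => // _ /= /andP[x1 x2] /andP[y1 y2].
  have P := pow2_gt0 R (J p.1.+1).
  rewrite -[leRHS]mulr1 ler_pdivlMl// -[X in X * _](ger0_norm (ltW P)) -normrM.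
  by rewrite mulrBr ler_norml; apply/andP; split; lra.
apply: (@le_trans _ _ (\sum_(0 <= i <oo) (hcost s (V (f i)))%:E)%E).
  apply: ereal_inf_lbound; exists (V \o f) => //; split.
    move=> x /hA[[x0 Tx] /(_ N)[n Nn bn]].
    exists (f^-1%FUN (n, kap n.+1 x)) => //=; rewrite invK ?inE//.
    rewrite /V /sel /= Nn bn Tx (T_lt (Tx n.+1)) /=.
    have /andP[k1 k2] := kap_itv n.+1 x0; rewrite k1 /=.
    by move: k2; rewrite -[X in _ < X]natr1 => /ltW.
  move=> i x y Vx Vy; apply: (le_trans (Vd _ _ _ Vx Vy)).
  have Nn : (N <= (f i).1)%N.
    by have [//|nN] := leqP N (f i).1; move: Vx; rewrite /= /V /sel leqNgt nN.
  apply: le_trans Nd; rewrite lef_pV2 ?posrE ?pow2_gt0// ler_eXn2l ?ltr1n//.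
  by rewrite (leq_trans Nn)// (leq_trans (leqnSn _))// J_ge.
rewrite (nneseries_pair (c := fun p => (hcost s (V p))%:E)); last 2 first.
- exact: 'bij_f.
- by move=> p; rewrite lee_fin hcost_ge0.
have inner n : (\sum_(j <oo) (hcost s (V (n, j)))%:E <= (if (N <= n)%N then r ^+ n else 0)%:E)%E.
  apply: nneseries_le => [j|M]; first by rewrite lee_fin hcost_ge0.
  rewrite sumEFin lee_fin.
  pose c : R := 2 `^ (- (s * (J n.+1)%:R)).
  have c0 : 0 < c by exact: powR2_gt0.
  have hV j : hcost s (V (n, j)) <= if sel n j then c else 0.
    rewrite /hcost; destruct (pselect (V (n, j) = set0)) as [V0|V0].
      by case: ifP => // _; exact: ltW.
    have [x Vx] : V (n, j) !=set0 by apply/set0P/eqP.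
    rewrite /=; have -> : sel n j by move: Vx; rewrite /V/=; case: ifP.
    have P := pow2_gt0 R (J n.+1).
    apply: (@le_trans _ _ (((2 ^+ J n.+1)^-1) `^ s)).
      apply: ge0_ler_powR; rewrite ?nnegrE ?invr_ge0 ?(ltW P) ?(ltW s0)//.
        by apply: le_trans (diam_ge (Vd (n, j)) Vx Vx).
      exact: diam_le Vx (Vd (n, j)).
    by rewrite -powR2_nat -powRN -powRrM mulNr mulrC.
  apply: (le_trans (ler_sum _ (fun j _ => hV j))).
  apply: (le_trans (@sum_support_le _ (2 ^ J n.+1) M _ _)).
  - by move=> k; case: ifP => // _; exact: ltW.
  - by move=> k Lk; rewrite /sel ltnNge Lk /= andbF.
  case: (leqP N n) => [Nn|nN]; last by rewrite big1// => k _; rewrite /sel leqNgt nN.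
  have sw : 0 <= s' * (wid n)%:R by rewrite mulr_ge0.
  (* The minimum serves [count_T], since [s'] may exceed 1. *)
  pose B := minn (Num.truncn (s' * (wid n)%:R)) (wid n).
  apply: (@le_trans _ _ ((2 ^ (J n + (n + 3) + B))%N%:R * c)).
    apply: (@le_trans _ _ (\sum_(k < 2 ^ J n.+1 | T b n.+1 k && (b n (lab n k) <= B)%N) c)).
      rewrite big_mkord [leRHS]big_mkcond/=; apply: ler_sum => k _.
      rewrite /sel; case: ifP => [/and4P[_ _ Tk bk]|_]; last by case: ifP => // _; exact: ltW.
      by rewrite Tk /= leq_min bw andbT truncn_ge_nat// bk.
    rewrite sumr_const -[leLHS]mulr_natl ler_wpM2r ?(ltW c0)// ler_nat -sum1_card.
    by apply: count_T; rewrite geq_minr.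
  rewrite natrX -powR2_nat /c -powR2D.
  have a_ge : n%:R * (J n + n + 5)%:R <= (J n.+1)%:R :> R.
    by rewrite -natrM ler_nat J_S leq_mul2r; apply/orP; right; rewrite leq_addr.
  have gn : 1 <= g * n%:R.
    rewrite mulrC -ler_pdivrMr// mul1r; apply: ltW.
    apply: (lt_le_trans (archi_boundP _)); first by rewrite invr_ge0 ltW.
    by rewrite ler_nat (leq_trans n1N).
  have ga : (J n + n + 5)%:R <= g * (J n.+1)%:R.
    apply: (le_trans _ (ler_wpM2l (ltW g0) a_ge)); rewrite mulrA ler_peMl//.
  have wa : (wid n)%:R <= (J n.+1)%:R :> R by rewrite ler_nat J_wid leq_addl.
  have Bs : B%:R <= s' * (J n.+1)%:R.
    apply: (@le_trans _ _ (s' * (wid n)%:R)); last by rewrite ler_wpM2l.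
    apply: (@le_trans _ _ (Num.truncn (s' * (wid n)%:R))%:R); first by rewrite ler_nat geq_minl.
    by case/andP: (truncn_itv sw).
  apply: (le_trans _ (powR_scale_le n (ltW g0))); apply: powR2_le.
  have sE : s = s' + 2 * g by rewrite /g; field.
  rewrite sE; move: ga Bs; rewrite !natrD; set a := (J n.+1)%:R; rewrite mulrDl.
  set x1 := s' * a; have -> : 2 * g * a = g * a + g * a by ring.
  set x2 := g * a; lra.
apply: nneseries_le => [n|M].
  by apply: nneseries_ge0 => j _ _; rewrite lee_fin hcost_ge0.
apply: (le_trans (lee_sum _ (fun n _ => inner n))).
rewrite sumEFin lee_fin; apply: le_trans Ne.
have [MN|NM] := leqP M N.
  rewrite big_nat_cond big1 ?divr_ge0 ?exprn_ge0 ?subr_ge0 ?ltW//.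
  by move=> i /andP[/andP[_ iM] _]; rewrite ltn_geF// (leq_trans iM).
rewrite (@big_cat_nat _ _ _ N)//= ?(ltnW NM)// [X in X + _]big_nat_cond big1 ?add0r; last first.
  by move=> i /andP[/andP[_ iM] _]; rewrite ltn_geF.
have -> : \sum_(N <= i < M) (if (N <= i)%N then r ^+ i else 0) = \sum_(N <= i < M) r ^+ i.
  by rewrite [LHS]big_nat_cond [RHS]big_nat_cond; apply: eq_bigr => i /andP[/andP[-> _] _].
rewrite ler_pdivlMr ?subr_gt0//.
rewrite geometric_sum_nat ?(ltnW NM)//.
by rewrite gerBl exprn_ge0// ltW.
Qed.

End Hausdorff.

(** * Cantor sets below a node *)

Section CantorSubset.
Variables (R : realType) (b : nat -> nat -> nat).
Hypothesis b_le : forall n l, (b n l <= wid n)%N.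
Variables (n1 k0 : nat) (l : nat -> nat).
Hypothesis Tk0 : T b n1 k0.
Hypothesis l_le : forall n, (n1 <= n)%N -> (l n <= n)%N.
Implicit Types (t : R) (n : nat).

Definition bits n := b n (l n).
Definition Bsum n := (\sum_(n1 <= i < n) bits i)%N.
(** The binary digits of [t] are cut into blocks of lengths [bits n]: [prefix] is the integer formed
    by the blocks before depth [n], and [digit] is the next block, which selects a child with label
    [l n]. *)
Definition prefix t n : nat := Num.truncn (2 ^+ Bsum n * t).
Definition digit t n := (prefix t n.+1 %% 2 ^ bits n)%N.

Fixpoint kseq t n : nat :=
  if n is p.+1 then
    if (p < n1)%N then (k0 %/ 2 ^ (J n1 - J n))%N
    else child b p (kseq t p) (l p) (digit t p)
  else 0%N.

Lemma kseqS t n : kseq t n.+1 =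
    if (n < n1)%N then (k0 %/ 2 ^ (J n1 - J n.+1))%N
    else child b n (kseq t n) (l n) (digit t n).
Proof. by []. Qed.

Lemma kseq_le t n : (n <= n1)%N -> kseq t n = (k0 %/ 2 ^ (J n1 - J n))%N.
Proof.
case: n => [_|n nn1]; last by rewrite kseqS nn1.
by have := T_anc (leq0n n1) Tk0; rewrite /T => /eqP ->.
Qed.

Lemma digit_lt t n : (digit t n < 2 ^ bits n)%N.
Proof. by rewrite ltn_mod expn_gt0. Qed.

Lemma kseq_T t n : T b n (kseq t n).
Proof.
have [nn1|n1n] := leqP n n1; first by rewrite kseq_le//; exact: T_anc.
rewrite -(subnKC (ltnW n1n)); elim: (n - n1)%N => [|d IH].
  by rewrite addn0 kseq_le// subnn divn1.
rewrite addnS kseqS ltnNge leq_addr /=.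
by have [_ _] := @childP b b_le (n1 + d) (kseq t (n1 +
  d)) _ _ (l_le (leq_addr d n1)) (digit_lt t (n1 + d)); apply.
Qed.

Lemma kseq_div t n : (kseq t n.+1 %/ 2 ^ (J n.+1 - J n))%N = kseq t n.
Proof.
rewrite kseqS; case: ltnP => [nn1|n1n].
  rewrite (kseq_le _ (ltnW nn1)) -divnMA -expnD; congr (_ %/ 2 ^ _)%N.
  by have := J_mono nn1; have := J_lt n; lia.
by have [-> _ _] := @childP b b_le n (kseq t n) _ _ (l_le n1n) (digit_lt t n).
Qed.

Lemma kseq_lab t n : (n1 <= n)%N -> lab n (kseq t n.+1) = l n.
Proof.
move=> n1n; rewrite kseqS ltnNge n1n /=.
by have [_ -> _] := @childP b b_le n (kseq t n) _ _ (l_le n1n) (digit_lt t n).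
Qed.

Lemma Bsum_mono n n' : (n <= n')%N -> (Bsum n <= Bsum n')%N.
Proof.
move=> nn'; rewrite /Bsum; have [n1n|nn1] := leqP n1 n; last by rewrite big_geq// ltnW.
by rewrite [X in (_ <= X)%N](@big_cat_nat _ _ _ n)//= leq_addr.
Qed.

Lemma Bsum_S n : (n1 <= n)%N -> Bsum n.+1 = (Bsum n + bits n)%N.
Proof. by move=> n1n; rewrite /Bsum big_nat_recr. Qed.

Lemma truncn_div (x : R) (p : nat) : 0 <= x ->
  (Num.truncn (2 ^+ p * x) %/ 2 ^ p)%N = Num.truncn x.
Proof.
move=> x0; apply/esym/truncn_def.
have y0 : 0 <= 2 ^+ p * x by rewrite mulr_ge0// exprn_ge0.
have /andP[h1 h2] := truncn_itv y0.
set q := Num.truncn _ in h1 h2 *.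
have d0 : (0 < 2 ^ p)%N by rewrite expn_gt0.
have [e1 e2] := natr_divn_itv R q d0.
rewrite natrX in e1 e2.
have P := pow2_gt0 R p.
apply/andP; split; first by rewrite -(ler_pM2r P) [x * _]mulrC (le_trans e1 h1).
by rewrite -(ltr_pM2r P) [x * _]mulrC (lt_le_trans h2 e2).
Qed.

Lemma prefix_div t n n' : 0 <= t -> (n <= n')%N ->
  (prefix t n' %/ 2 ^ (Bsum n' - Bsum n))%N = prefix t n.
Proof.
move=> t0 nn'; rewrite /prefix -{1}(subnK (Bsum_mono nn')) exprD -mulrA truncn_div//.
by rewrite mulr_ge0// exprn_ge0.
Qed.

Lemma prefix_S t n : 0 <= t -> (n1 <= n)%N ->
  prefix t n.+1 = (prefix t n * 2 ^ bits n + digit t n)%N.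
Proof.
move=> t0 n1n; rewrite {1}(divn_eq (prefix t n.+1) (2 ^ bits n)); congr (_ * _ + _)%N.
by rewrite -(prefix_div t0 (leqnSn n)) Bsum_S// addKn.
Qed.

Lemma kseq_prefix t t' n : 0 <= t -> 0 <= t' -> prefix t n = prefix t' n ->
  kseq t n = kseq t' n.
Proof.
move=> t0 t'0; elim: n => // n IH e.
have {}IH : kseq t n = kseq t' n.
  by apply: IH; rewrite -(prefix_div t0 (leqnSn n)) e prefix_div.
by rewrite !kseqS IH /digit e.
Qed.

Lemma prefix_itv t n : 0 <= t -> (prefix t n)%:R <= 2 ^+ Bsum n * t < (prefix t n).+1%:R.
Proof. by move=> t0; apply: truncn_itv; rewrite mulr_ge0// exprn_ge0. Qed.

Lemma cantor_map : exists X : R -> R,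
  forall t, Kset b (X t) /\ forall n, kap n (X t) = kseq t n.
Proof.
have /choice[X hX] : forall t, exists x : R, Kset b x /\ forall n, kap n x = kseq t n.
  by move=> t; have [x Kx kx] := @Kset_exists R b (kseq t) (kseq_T t) (kseq_div t); exists x.
by exists X.
Qed.

(** Let [n] be the last depth with equal prefixes and let the next blocks differ by [D]. With
    [w = D / 2 ^ bits n <= 1], the parameters differ by at most [2 * w / 2 ^ Bsum n] and the points
    by at least [w * 2 ^ (- (J n + n + 4))]. As [s <= 1], [w <= w ^ s], and the hypothesis with [C0]
    compares the remaining factors. *)
Lemma cantor_dist (X : R -> R) (s C0 : R) : 0 <= s <= 1 -> 0 < C0 ->
  (forall t, Kset b (X t) /\ forall n, kap n (X t) = kseq t n) ->
  (forall n, (n1 <= n)%N -> 2 `^ (s * (J n + n + 4)%:R) <= C0 * 2 ^+ Bsum n) ->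
  (forall M, exists n, (M <= Bsum n)%N) ->
  forall t t', 0 <= t < 1 -> 0 <= t' < 1 -> `|t - t'| <= (2 * C0) * `|X t - X t'| `^ s.
Proof.
move=> /andP[s0 s1] C00 hX HC HB.
move=> t t' /andP[t0 t1] /andP[t'0 t'1].
have [->|tt'] := eqVneq t t'.
  by rewrite !subrr normr0 !mulr_ge0 ?powR_ge0// ltW.
have dt : 0 < `|t - t'| by rewrite normr_gt0 subr_eq0.
have ex : exists n, prefix t n != prefix t' n.
  have [n hn] := HB (Num.bound (`|t - t'|)^-1); exists n.
  apply/eqP => e.
  have /andP[p1 p2] := prefix_itv n t0; have /andP[q1 q2] := prefix_itv n t'0.
  rewrite e -[X in _ < X]natr1 in p1 p2; rewrite -[X in _ < X]natr1 in q2.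
  have P := pow2_gt0 R (Bsum n).
  have : `|2 ^+ Bsum n * (t - t')| < 1.
    by rewrite mulrBr ltr_norml; apply/andP; split; lra.
  rewrite normrM ger0_norm ?(ltW P)// mulrC -ltr_pdivlMl// mulr1 ltNge => /negP; apply.
  apply: (le_trans (ltW (archi_boundP _))); first by rewrite invr_ge0.
  by apply: (le_trans _ (ltW (ltr_nat_pow2 R (Bsum n)))); rewrite ler_nat.
case: (ex_minnP ex) => N pN minN.
have Nn1 : (n1 < N)%N.
  rewrite ltnNge; apply/negP => Nn1; move/eqP: pN; apply.
  have tr (u : R) : 0 <= u -> u < 1 -> prefix u N = 0%N.
    by move=> u0 u1; rewrite /prefix /Bsum big_geq// expr0 mul1r; apply: truncn_def; rewrite u0.
  by rewrite !tr.
case: N => // n in pN minN Nn1 *.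
rewrite ltnS in Nn1.
have pn : prefix t n = prefix t' n.
  by apply/eqP/negPn/negP => /minN; rewrite ltnn.
have kn := kseq_prefix t0 t'0 pn.
have [Kx kx] := hX t; have [Kx' kx'] := hX t'.
set i := digit t n; set i' := digit t' n.
have ii' : i != i'.
  by apply: contra pN => /eqP e; rewrite !prefix_S// pn -/i -/i' e.
pose D : R := `|i%:R - i'%:R|.
have D1 : 1 <= D.
  have [l1|l1|e] := ltngtP i i'; last by rewrite e eqxx in ii'.
    have : (i.+1%:R : R) <= i'%:R by rewrite ler_nat.
    by rewrite -natr1 /D => h; rewrite ler0_norm; lra.
  have : (i'.+1%:R : R) <= i%:R by rewrite ler_nat.
  by rewrite -natr1 /D => h; rewrite ger0_norm; lra.
have Db : D <= 2 ^+ bits n.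
  have := digit_lt t n; have := digit_lt t' n; rewrite -/i -/i' => h1 h2.
  have {}h1 : (i'%:R : R) <= 2 ^+ bits n by rewrite -natrX ler_nat ltnW.
  have {}h2 : (i%:R : R) <= 2 ^+ bits n by rewrite -natrX ler_nat ltnW.
  have := ler0n R i; have := ler0n R i'.
  by rewrite /D ler_norml => ? ?; apply/andP; split; lra.
have PB := pow2_gt0 R (Bsum n.+1).
(* Truncation costs at most one unit, and [D >= 1]. *)
have tD : `|t - t'| <= 2 * D / 2 ^+ Bsum n.+1.
  rewrite ler_pdivlMr// -[X in _ * X](ger0_norm (ltW PB)) -normrM mulrBl ![_ * 2 ^+ _]mulrC.
  have /andP[p1 p2] := prefix_itv n.+1 t0; have /andP[q1 q2] := prefix_itv n.+1 t'0.
  rewrite -[X in _ < X]natr1 in p2; rewrite -[X in _ < X]natr1 in q2.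
  have E : (prefix t n.+1)%:R - (prefix t' n.+1)%:R = i%:R - i'%:R :> R.
    by rewrite !prefix_S// pn !natrD; ring.
  have : `|(prefix t n.+1)%:R - (prefix t' n.+1)%:R| = D by rewrite E.
  move: p1 p2 q1 q2 D1; set x1 := (prefix t n.+1)%:R; set x2 := (prefix t' n.+1)%:R.
  move=> p1 p2 q1 q2 D1 hD.
  have := ler_norm (x1 - x2); have := ler_normr (x2 - x1) (x1 - x2).
  rewrite hD => _ h1; have h2 : x2 - x1 <= D by rewrite -hD distrC ler_norm.
  by rewrite ler_norml; apply/andP; split; lra.
have q := Kset_quarter n.+1 Kx; have q' := Kset_quarter n.+1 Kx'.
have [x0 _] := Kx; have [x'0 _] := Kx'.
have /andP[r1 _] := kap_itv n.+1 x0; have /andP[r1' _] := kap_itv n.+1 x'0.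
rewrite kx in q r1; rewrite kx' in q' r1'.
pose G : R := 2 ^+ (wid n - bits n).
have G1 : 1 <= G by rewrite exprn_ege1// ler1n.
have Ek : (kseq t n.+1)%:R - (kseq t' n.+1)%:R = (i%:R - i'%:R) * G :> R.
  rewrite !kseqS ltnNge Nn1 /= kn /child !natrD !natrM -/i -/i' /G.
  by rewrite -/(bits n) !natrX; ring.
(* The indices differ by [D * G >= 1], and by [Kset_quarter] the rescaled points differ from their
   indices by at most a quarter. *)
have DG : D * G <= 2 * (2 ^+ J n.+1 * `|X t - X t'|).
  have P := pow2_gt0 R (J n.+1).
  rewrite -[X in X * `|_|](ger0_norm (ltW P)) -normrM mulrBr.
  have DE : `|(kseq t n.+1)%:R - (kseq t' n.+1)%:R| = D * G :> R.
    by rewrite Ek normrM (ger0_norm (le_trans ler01 G1)).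
  have DG1 : 1 <= D * G by rewrite -[X in X <= _]mulr1 ler_pM.
  move: q q' r1 r1' DE; set y1 := _ * X t; set y2 := _ * X t'; set z1 := (kseq t n.+1)%:R;
    set z2 := (kseq t' n.+1)%:R.
  move=> q q' r1 r1' DE.
  have : `|z1 - z2| <= `|y1 - y2| + 4^-1.
    rewrite ler_norml; have := ler_norm (y1 - y2); have := ler_norm (y2 - y1);
      rewrite [`|y2 - y1|]distrC => h1 h2.
    by apply/andP; split; lra.
  by rewrite DE; lra.
have bw : (bits n <= wid n)%N by exact: b_le.
have XD : D / 2 ^+ bits n * 2 `^ (- (J n + n + 4)%:R) <= `|X t - X t'|.
  have P := pow2_gt0 R (J n.+1).
  have P2 := pow2_gt0 R (J n + n + 4).
  have Pb := pow2_gt0 R (bits n).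
  rewrite powRN powR2_nat mulrAC -[_ * _^-1 * _]mulrA -invfM -exprD.
  rewrite ler_pdivrMr ?pow2_gt0//.
  rewrite -(ler_pM2r (lt_le_trans ltr01 G1)); apply: (le_trans DG).
  have -> : `|X t - X t'| * 2 ^+ (J n + n + 4 + bits n) * G = `|X t - X t'| * (2 ^+ (J n + n +
    4 + bits n) * 2 ^+ (wid n - bits n)) by rewrite /G mulrA.
  rewrite -exprD (_ : (J n + n + 4 + bits n + (wid n - bits n) = J n.+1 + 1)%N); last first.
    by rewrite J_wid; clear -bw; lia.
  by rewrite exprD expr1; lra.
have u01 : 0 <= D / 2 ^+ bits n <= 1.
  apply/andP; split; first by rewrite divr_ge0 ?exprn_ge0// (le_trans ler01 D1).
  by rewrite ler_pdivrMr ?pow2_gt0// mul1r.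
have XDs : (D / 2 ^+ bits n) * 2 `^ (- (s * (J n + n + 4)%:R)) <= `|X t - X t'| `^ s.
  apply: (@le_trans _ _ ((D / 2 ^+ bits n * 2 `^ (- (J n + n + 4)%:R)) `^ s)).
    case/andP: (u01) => u0 _; rewrite powRM ?powR_ge0// -powRrM.
    have -> : - (J n + n + 4)%:R * s = - (s * (J n + n + 4)%:R) by ring.
    rewrite ler_pM2r ?powR2_gt0//; apply: powR_ge_id => //; by rewrite s0.
  have /andP[u0 _] := u01.
  by apply: ge0_ler_powR => //; rewrite nnegrE mulr_ge0 ?powR_ge0.
apply: (le_trans tD); rewrite -[leRHS]mulrA -[leLHS]mulrA ler_pM2l//.
apply: le_trans (ler_wpM2l (ltW C00) XDs).
rewrite powRN mulrA ler_pdivlMr ?powR2_gt0//.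
rewrite Bsum_S// exprD invfM.
have -> : D * ((2 ^+ Bsum n)^-1 * (2 ^+ bits n)^-1) * 2 `^ (s * (J n + n + 4)%:R) =
   D / 2 ^+ bits n * (2 `^ (s * (J n + n + 4)%:R) / 2 ^+ Bsum n) by ring.
rewrite [C0 * _]mulrC ler_wpM2l//; first by case/andP: u01.
by rewrite ler_pdivrMr ?pow2_gt0//; exact: HC.
Qed.

End CantorSubset.

(** * The prescribed spectrum *)

Section Labels.
Variables (R : realType) (f : \bar R -> \bar R) (m : R).
Hypothesis Hrange : forall h : \bar R, (0 <= h)%E ->
  ((0 <= f h)%E /\ (f h <= 1%:E)%E) \/ f h = -oo%E.
Hypothesis m_gt0 : 0 < m.
Hypothesis dom_m : dom_ext f m%:E.
Hypothesis m_min : forall h, dom_ext f h -> (m%:E <= h)%E.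

Definition spec_val (h : \bar R) : R := fine (f h).

Lemma dom_val h : dom_ext f h -> f h = (spec_val h)%:E /\ 0 <= spec_val h <= 1.
Proof.
move=> [h0 fh]; have [[f0 f1]|e] := Hrange h0; last by rewrite e ltxx in fh.
rewrite /spec_val; move: f0 f1 fh; case: (f h) => [r| |]//=.
by rewrite !lee_fin => -> ->.
Qed.

(* Proximity of points of the graph of [f], where the exponent [+oo] is isolated. *)
Definition close (p : nat) (h h' : \bar R) : Prop :=
  match h, h' with
  | r%:E, r'%:E => `|r' - r| <= (p.+1%:R)^-1
  | +oo%E, +oo%E => True
  | _, _ => False
  end /\ `|spec_val h' - spec_val h| <= (p.+1%:R)^-1.

Lemma close_le p p' h h' : (p <= p')%N -> close p' h h' -> close p h h'.
Proof.
move=> pp'; have le : (p'.+1%:R)^-1 <= (p.+1%:R)^-1 :> R.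
  by rewrite lef_pV2 ?posrE ?ltr0n// ler_nat.
rewrite /close => -[c1 c2]; split; last exact: le_trans c2 le.
by move: c1; case: h {c2} => [r| |]//; case: h' => [r'| |]// c1; exact: le_trans c1 le.
Qed.

Lemma floor_cell (p : nat) (x y : R) (u : nat) :
  u%:R <= p.+1%:R * x < u.+1%:R -> u%:R <= p.+1%:R * y < u.+1%:R ->
  `|y - x| <= (p.+1%:R)^-1.
Proof.
move=> /andP[x1 x2] /andP[y1 y2]; rewrite -[u.+1%:R]natr1 in x2 y2.
have P : 0 < (p.+1%:R : R) by rewrite ltr0n.
rewrite -(ler_pM2l P) mulfV ?gt_eqF// -[X in X * _](ger0_norm (ltW P)) -normrM mulrBr.
by rewrite ler_norml; apply/andP; split; lra.
Qed.

(** The graph of [f] is separable: choose a point in each non-empty cell of the square grids of mesh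
    [1 / p.+1], and treat [+oo] as a cell of its own. Empty cells get the default [m], which keeps
    all labels in the domain. *)
Lemma dense_labels : exists q : nat -> \bar R, (forall l, dom_ext f (q l)) /\
  forall h, dom_ext f h -> forall p, exists l, close p h (q l).
Proof.
pose cell (i : option (nat * nat * nat)) (h : \bar R) : Prop :=
  match i with
  | None => h = +oo%E
  | Some (p, u, v) => exists2 r, h = r%:E & u%:R <= p.+1%:R * r < u.+1%:R /\
      v%:R <= p.+1%:R * spec_val h < v.+1%:R
  end.
have /choice[g hg] : forall i, exists h, dom_ext f h /\
    forall h0, dom_ext f h0 -> cell i h0 -> cell i h.
  move=> i; have [[h0 [d0 c0]]|no] := pselect (exists h0, dom_ext f h0 /\ cell i h0).
    by exists h0.
  by exists m%:E; split=> // h0 d0 c0; exfalso; apply: no; exists h0.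
exists (fun l => g (odflt None (unpickle l))); split=> [l|h dh p]; first exact: (hg _).1.
have [_ /andP[v0 v1]] := dom_val dh; have [h0 _] := dh.
have P : 0 <= (p.+1%:R : R) by [].
have vc := truncn_itv (mulr_ge0 P v0).
case: h dh v0 v1 h0 vc => [r| |]// dh v0 v1 h0 vc.
  rewrite lee_fin in h0.
  pose i := Some (p, Num.truncn (p.+1%:R * r), Num.truncn (p.+1%:R * spec_val r%:E)).
  exists (pickle i); rewrite pickleK /=.
  have [|r' gE [c1 c2]] := (hg i).2 _ dh.
    by exists r => //; split=> //; exact: truncn_itv (mulr_ge0 P h0).
  rewrite /close gE; split; first by apply: (floor_cell _ c1); exact: truncn_itv (mulr_ge0 P h0).
  by apply: (floor_cell vc); rewrite -gE.
exists (pickle (None : option (nat * nat * nat))); rewrite pickleK /=.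
have gE : g None = +oo%E by exact: (hg None).2 _ dh erefl.
by rewrite gE; split=> //; rewrite subrr normr0 invr_ge0.
Qed.

(** Depth [n] offers only the labels up to [n]. The label used is that of the largest precision
    [p <= n] whose label [L p] is already available. *)
Lemma label_sequence (q : nat -> \bar R) h : (forall p, exists l, close p h (q l)) ->
  exists l : nat -> nat, (forall n, (l n <= n)%N) /\
    forall p, exists n0, forall n, (n0 <= n)%N -> close p h (q (l n)).
Proof.
move=> /choice[L hL].
have /choice[l hl] : forall n, exists ln, (ln <= n)%N /\
    forall p, (p <= n)%N -> (L p <= n)%N -> close p h (q ln).
  move=> n; case: (pickP (fun p : 'I_n.+1 => (L p <= n)%N)) => [i0 Pi0|none].
    case: (@arg_maxnP _ i0 (fun p : 'I_n.+1 => (L p <= n)%N) (fun p => val p) Pi0) => p' Lp' max.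
    exists (L p'); split=> // p pn Lp; apply: close_le (hL p').
    exact: (max (Ordinal (pn : (p < n.+1)%N)) Lp).
  exists 0%N; split=> // p pn Lp; have := none (Ordinal (pn : (p < n.+1)%N)).
  by rewrite /= Lp.
exists l; split=> [n|p]; first exact: (hl n).1.
exists (maxn p (L p)) => n; rewrite geq_max => /andP[pn Lp].
exact: (hl n).2.
Qed.

Section Construction.
Variable q : nat -> \bar R.
Hypothesis dom_q : forall l, dom_ext f (q l).

Definition branching n l : nat := Num.truncn (spec_val (q l) * (wid n)%:R).

(** [n + m] stands for the exponent [+oo]: it is unbounded along a branch, and the summand [m] keeps
    it at least [m]. *)
Definition label_exp n l : R :=
  if q l is r%:E then Num.min r (n%:R + m) else n%:R + m.

Let vw n l : 0 <= spec_val (q l) * (wid n)%:R.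
Proof. by have [_ /andP[v0 _]] := dom_val (dom_q l); rewrite mulr_ge0. Qed.

Lemma branching_le n l : (branching n l <= wid n)%N.
Proof.
have [_ /andP[v0 v1]] := dom_val (dom_q l).
have /andP[h _] := truncn_itv (vw n l).
rewrite -(ler_nat R); apply: (le_trans h); rewrite ler_piMl//.
Qed.

Lemma branching_itv n l : (branching n l)%:R <= spec_val (q l) * (wid n)%:R /\
  spec_val (q l) * (wid n)%:R - 1 <= (branching n l)%:R.
Proof.
have /andP[h1 h2] := truncn_itv (vw n l); split=> //.
by rewrite lerBlDr natr1 ltW.
Qed.

Lemma label_exp_ge n l : m <= label_exp n l.
Proof.
rewrite /label_exp; have := m_min (dom_q l); case: (q l) => [r| |]//=.
- by rewrite lee_fin => mr; rewrite le_min mr lerDr ler0n.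
- by rewrite lerDr ler0n.
Qed.

End Construction.

End Labels.

(** * Dimension of the level sets of the exponent *)

Lemma wid_ge n : (n.+1 * (J n + n + 5) <= wid n)%N.
Proof. by have := J_wid n; rewrite J_S; nia. Qed.

Section Spectrum.
Variables (R : realType) (psi : R -> R) (Wpsi : wavelet psi).
Variables (f : \bar R -> \bar R) (m : R).
Hypothesis Hrange : forall h : \bar R, (0 <= h)%E ->
  ((0 <= f h)%E /\ (f h <= 1%:E)%E) \/ f h = -oo%E.
Hypothesis Husc : usc_ext f.
Hypothesis Hclosed : closed_ext (dom_ext f).
Hypothesis m_gt0 : 0 < m.
Hypothesis m_min : forall h, dom_ext f h -> (m%:E <= h)%E.
Variable q : nat -> \bar R.
Hypothesis dom_q : forall l, dom_ext f (q l).
Hypothesis dense_q : forall h, dom_ext f h -> forall p, exists l, close f p h (q l).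

Let b := branching f q.
Let eta := label_exp m q.
Let F := Fsum psi b eta.
Let eta_ge n l : m <= eta n l := label_exp_ge m_min dom_q n l.
Let b_le n l : (b n l <= wid n)%N := branching_le Hrange dom_q n l.
Notation lbl n x := (lab n (kap n.+1 x)).

Let nat_ge (c : R) : exists n0 : nat, forall n, (n0 <= n)%N -> c <= n%:R + m.
Proof.
exists (Num.bound `|c|) => n hn; apply: (le_trans (ler_norm c)).
apply: (le_trans (ltW (archi_boundP (normr_ge0 c)))).
by apply: (@le_trans _ _ n%:R); rewrite ?ler_nat// lerDl ltW.
Qed.

(** If the labels eventually avoid a neighbourhood of [h], the exponent at [x] cannot be [h]. Used
    with [Q] the complement of the domain of [f], to show that a level set is empty, and with [Q] a
    strict upper bound on [f]. *)
Lemma near_label (Q : \bar R -> Prop) h x : (0 <= h)%E -> near_ext h Q -> Kset b x ->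
  holder_exponent F x = h ->
  forall n0, exists2 n, (n0 <= n)%N & Q (q (lbl n x)).
Proof.
move=> h0 nQ Kx hx n0; apply: contrapT => no.
have {}no n : (n0 <= n)%N -> ~ Q (q (lbl n x)).
  by move=> n0n Qn; apply: no; exists n.
case: h h0 nQ hx => [r| |]// r0 nQ hx; last first.
  have [al hal] := nQ.
  have : (holder_exponent F x <= al%:E)%E.
    apply: (holder_exponent_le Wpsi m_gt0 eta_ge Kx) => n1; exists (maxn n0 n1);
      first exact: leq_maxr.
    set n := maxn n0 n1; have := no n (leq_maxl _ _); rewrite /eta /label_exp.
    have : ~ (al%:E < q (lbl n x))%E by move=> /hal; exact: no (leq_maxl _ _).
    move=> /negP; rewrite -leNgt; case: (q _) (m_min (dom_q (lbl n x))) => [r'| |]//=.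
    by rewrite lee_fin => _ le _; move: le; rewrite lee_fin ge_min => ->.
  by rewrite hx.
have [e [e0 he]] := nQ; rewrite lee_fin in r0.
have [n1 hn1] := nat_ge (r + e).
have far n : (maxn n0 n1 <= n)%N -> eta n (lbl n x) <= r - e \/ r + e <= eta n (lbl n x).
  rewrite geq_max => /andP[n0n n1n]; have := no n n0n; have big := hn1 n n1n.
  rewrite /eta /label_exp; have := m_min (dom_q (lbl n x)).
  case: (q _) => [r'| |]//= mr; last by right.
  rewrite lee_fin in mr => nQr.
  have [l1|l1] := lerP (r + e) r'; first by right; rewrite le_min l1.
  left; rewrite ge_min; apply/orP; left; rewrite leNgt; apply/negP => l2; apply: nQr.
  apply: he; first exact: le_trans (ltW m_gt0) mr.
  by rewrite ltr_norml; apply/andP; split; lra.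
have [inf|] := pselect (forall n2, exists2 n, (n2 <= n)%N & eta n (lbl n x) <= r - e).
  have := holder_exponent_le Wpsi m_gt0 eta_ge Kx inf.
  by rewrite -/F hx lee_fin; lra.
move=> /existsNP[n2 hn2].
(* [holder_exponent_ge] requires a strict gap below the exponents of the branch, hence [e / 2]. *)
have : ((r + e / 2)%:E <= holder_exponent F x)%E.
  apply: (@holder_exponent_ge R psi Wpsi b eta m m_gt0 eta_ge x (r + e / 2) (r +
    e) (maxn n2 (maxn n0 n1)) Kx).
  - by rewrite addr_ge0// divr_ge0// ltW.
  - by lra.
  move=> n; rewrite geq_max => /andP[n2n n01n].
  by have [l1|//] := far n n01n; exfalso; apply: hn2; exists n.
by rewrite hx lee_fin; lra.
Qed.

Lemma exponent_limit h x (l : nat -> nat) n1 : Kset b x -> dom_ext f h ->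
  (forall n, (n1 <= n)%N -> lbl n x = l n) ->
  (forall p, exists n0, forall n, (n0 <= n)%N -> close f p h (q (l n))) ->
  holder_exponent F x = h.
Proof.
move=> Kx dh hl hc; have mh := m_min dh.
have GE (c c' : R) n0 : 0 <= c -> c < c' -> (forall n, (n0 <= n)%N -> c' <= eta n (lbl n x)) ->
    (c%:E <= holder_exponent F x)%E.
  by move=> c0 cc' H; exact: (@holder_exponent_ge R psi Wpsi b eta m m_gt0 eta_ge x c c' n0 Kx).
case: h dh mh hc => [r| |]// dh mh hc; last first.
  have [n0 hn0] := hc 0%N.
  apply/eqyP => A A0; have [n2 hn2] := nat_ge (A + 1).
  apply: (GE A (A + 1) (maxn n1 (maxn n0 n2))); [exact: ltW|lra|].
  move=> n; rewrite !geq_max => /and3P[n1n n0n n2n].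
  have [+ _] := hn0 n n0n; rewrite (hl n n1n) /eta /label_exp.
  by case: (q (l n)) => // _; exact: hn2.
rewrite lee_fin in mh.
have near_r e : 0 < e -> exists n0, forall n, (n0 <= n)%N -> `|eta n (lbl n x) - r| <= e.
  move=> e0; pose p := Num.bound e^-1; have [n0 hn0] := hc p; have [n2 hn2] := nat_ge (r + e).
  exists (maxn n1 (maxn n0 n2)) => n; rewrite !geq_max => /and3P[n1n n0n n2n].
  have pe : (p.+1%:R)^-1 <= e.
    rewrite -[leRHS]invrK lef_pV2 ?posrE ?invr_gt0//.
    apply: (le_trans (ltW (archi_boundP _))); first by rewrite invr_ge0 ltW.
    by rewrite ler_nat.
  have [+ _] := hn0 n n0n; rewrite (hl n n1n) /eta /label_exp.
  case: (q (l n)) => [r'| |]// /le_trans/(_ pe) r're.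
  have r'e : r' <= r + e by move: r're; rewrite ler_norml => /andP[_ ?]; lra.
  by rewrite min_l// (le_trans r'e)// hn2.
apply/eqP; rewrite eq_le; apply/andP; split.
  apply/lee_addgt0Pr => e e0; rewrite -EFinD; have [n0 hn0] := near_r e e0.
  apply: (holder_exponent_le Wpsi m_gt0 eta_ge Kx) => n2; exists (maxn n0 n2);
    first exact: leq_maxr.
  by have := hn0 _ (leq_maxl n0 n2); rewrite ler_norml => /andP[_]; rewrite -/eta; lra.
apply/lee_subgt0Pr => e e0; rewrite -EFinB.
(* [holder_exponent_ge] applies only to non-negative orders. *)
have [re|re] := ltP (r - e) 0.
  by apply: (@le_trans _ _ 0%E); [rewrite lee_fin ltW|exact: (holder_exponent_ge0 Wpsi b m_gt0
    eta_ge)].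
have e2 : 0 < e / 2 by rewrite divr_gt0.
have [n0 hn0] := near_r _ e2.
apply: (GE (r - e) (r - e / 2) n0 re); first lra.
by move=> n n0n; have := hn0 n n0n; rewrite ler_norml => /andP[? _]; lra.
Qed.

Lemma dimH_iso_le h A : (0 <= h)%E -> A `<=` iso_set psi F h -> (dimH A <= f h)%E.
Proof.
move=> h0 AI.
have AK x : A x -> Kset b x /\ holder_exponent F x = h.
  by move=> /AI[]; rewrite (wsupp_Fsum Wpsi b m_gt0 eta_ge).
have [dh|ndh] := pselect (dom_ext f h); last first.
  have -> : A = set0.
    apply/seteqP; split=> // x /AK[Kx hx].
    have [n _ nd] := near_label h0 (Hclosed h0 ndh) Kx hx 0.
    exact: nd (dom_q _).
  by rewrite dimH_set0 leNye.
have [fE /andP[v0 v1]] := dom_val Hrange dh; rewrite fE.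
apply: dimH_upper => // s vs; pose s' := (spec_val f h + s) / 2.
have vs' : (f h < s'%:E)%E by rewrite fE lte_fin /s'; lra.
apply: (@hausdorff_limsup0 R b s s') => //; [by rewrite /s'; lra|by rewrite /s'; lra|].
move=> x /AK[Kx hx]; split=> // n0.
have [n n0n Qn] := near_label h0 (Husc h0 vs') Kx hx n0.
exists n => //; have [bi _] := branching_itv Hrange dom_q n (lbl n x).
apply: (le_trans bi); rewrite ler_wpM2r//.
by have [E _] := dom_val Hrange (dom_q (lbl n x)); move: Qn; rewrite E lte_fin => /ltW.
Qed.

Lemma dimH_iso_ge h A n1 k0 : dom_ext f h -> T b n1 k0 ->
  (forall x, Kset b x -> kap n1 x = k0 -> holder_exponent F x = h -> A x) ->
  (f h <= dimH A)%E.
Proof.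
move=> dh Tk0 HA.
have [fE /andP[v0 v1]] := dom_val Hrange dh; rewrite fE.
have [l [l_le hl]] := label_sequence (dense_q dh).
have pts n2 k2 : T b n2 k2 -> exists X : R -> R, [/\
     forall t, Kset b (X t) /\ forall n, kap n (X t) = kseq b n2 k2 l t n,
     forall t, kap n2 (X t) = k2 & forall t, holder_exponent F (X t) = h].
  move=> Tk2; have l_le' n : (n2 <= n)%N -> (l n <= n)%N by [].
  have [X hX] := @cantor_map R b b_le n2 k2 l Tk2 l_le'.
  exists X; split=> // t; have [Kx kx] := hX t.
    by rewrite kx kseq_le// subnn divn1.
  apply: (@exponent_limit h (X t) l n2 Kx dh _ hl) => n n2n.
  by rewrite kx kseq_lab.
have [X0 [hX0 X0k X0h]] := pts _ _ Tk0.
have [Kx0 _] := hX0 0.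
(* The point [X0 0] settles the case [f h = 0], where no [s] is left and only non-emptiness
   counts. *)
apply: dimH_lower; first by exists (X0 0); exact: HA.
move=> s s0 sv; pose e := (spec_val f h - s) / 2.
have e0 : 0 < e by rewrite divr_gt0// subr_gt0.
have s1 : s <= 1 by lra.
have [p pe] : exists p : nat, (p.+1%:R)^-1 <= e.
  exists (Num.bound e^-1); rewrite -[leRHS]invrK lef_pV2 ?posrE ?invr_gt0//.
  apply: (le_trans (ltW (archi_boundP _))); first by rewrite invr_ge0 ltW.
  by rewrite ler_nat.
have [n0 hn0] := hl p.
pose n3 := Num.bound (2 / e).
(* The estimates on the labels and widths hold only from depth [N] on, so the Cantor set is built
   below a descendant of [k0], namely the node of [X0 0] at depth [N]. *)
pose N := maxn n1 (maxn n0 n3).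
have n1N : (n1 <= N)%N by exact: leq_maxl.
pose k2 := kap N (X0 0).
have Tk2 : T b N k2 by case: Kx0.
have [X [hX Xk Xh]] := pts _ _ Tk2.
have phi n : (N <= n)%N -> s + e <= spec_val f (q (l n)).
  move=> Nn; have n0n : (n0 <= n)%N by apply: leq_trans Nn; rewrite !leq_max leqnn orbT.
  have [_ c] := hn0 n n0n; have := le_trans c pe.
  by rewrite ler_norml => /andP[c1 _]; move: c1; rewrite /e; lra.
have ewid n : (N <= n)%N -> 2 * (J n + n + 5)%:R <= e * (wid n)%:R.
  move=> Nn; have n3n : (n3 <= n)%N by apply: leq_trans Nn; rewrite !leq_max leqnn !orbT.
  have w2 : n.+1%:R * (J n + n + 5)%:R <= (wid n)%:R :> R.
    by rewrite -natrM ler_nat wid_ge.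
  apply: (le_trans _ (ler_wpM2l (ltW e0) w2)); rewrite mulrA ler_wpM2r//.
  rewrite mulrC -ler_pdivrMr//; apply: (le_trans (ltW (archi_boundP _)));
    first by rewrite divr_ge0// ltW.
  by rewrite ler_nat -/n3 leqW.
have bits_ge n : (N <= n)%N -> (s + e) * (wid n)%:R - 1 <= (bits b l n)%:R.
  move=> Nn; have [_ bi] := branching_itv Hrange dom_q n (l n).
  apply: le_trans bi; rewrite lerD2r ler_wpM2r//; exact: phi.
have Bb n : (N <= n)%N -> (bits b l n <= Bsum b N l n.+1)%N.
  by move=> Nn; rewrite Bsum_S// leq_addl.
(* [C0] covers depth [N], where no digit of the parameter has been read; at greater depths the last
   block alone has enough digits. *)
pose C0 : R := 2 `^ (s * (J N + N + 4)%:R).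
have C01 : 1 <= C0 by rewrite /C0 -[X in X <= _](powRr0 2) powR2_le// mulr_ge0.
have HC n : (N <= n)%N -> 2 `^ (s * (J n + n + 4)%:R) <= C0 * 2 ^+ Bsum b N l n.
  rewrite leq_eqVlt => /predU1P[<-|]; first by rewrite /Bsum big_geq// expr0 mulr1.
  case: n => // n; rewrite ltnS => Nn.
  apply: (@le_trans _ _ (2 ^+ Bsum b N l n.+1)); last by rewrite ler_peMl// exprn_ge0.
  rewrite -powR2_nat powR2_le//.
  apply: (@le_trans _ _ (bits b l n)%:R); last by rewrite ler_nat Bb.
  apply: le_trans (bits_ge n Nn).
  have := ewid n Nn; rewrite J_wid !natrD mulrDl.
  set x1 := (J n)%:R; set x2 := n%:R; set x3 := (wid n)%:R => ew.
  have x10 : 0 <= x1 by rewrite /x1.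
  have x20 : 0 <= x2 by rewrite /x2.
  have n1E : (n.+1%:R : R) = x2 + 1 by rewrite -natr1.
  rewrite n1E; have sx1 : s * x1 <= x1 by rewrite ler_piMl.
  have sx2 : s * x2 <= x2 by rewrite ler_piMl.
  rewrite !mulrDr; lra.
have HB M : exists n, (M <= Bsum b N l n)%N.
  exists (maxn N M).+1; set n := maxn N M; have Nn : (N <= n)%N by exact: leq_maxl.
  apply: leq_trans (Bb n Nn); rewrite -(ler_nat R); apply: le_trans (bits_ge n Nn).
  have := ewid n Nn; have Mn : (M%:R : R) <= n%:R by rewrite ler_nat leq_maxr.
  have sw : 0 <= s * (wid n)%:R by rewrite mulr_ge0.
  have x10 : 0 <= (J n)%:R :> R by [].
  have x20 : 0 <= n%:R :> R by [].
  by rewrite !natrD mulrDl; lra.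
apply: (@hausdorff_measure_neq0 R s (2 * C0) A X) => //.
- by rewrite mulr_gt0// (lt_le_trans ltr01).
- move=> t _; have [Kx kx] := hX t; apply: HA => //.
  have [x0 _] := Kx; have [x00 _] := Kx0.
  by rewrite -(kap_div n1N x0) Xk /k2 (kap_div n1N x00) X0k.
- apply: (@cantor_dist R b b_le N k2 l X s C0) => //.
  + by rewrite s0.
  + exact: lt_le_trans ltr01 C01.
Qed.

(** Any set between the level set and its part in one cylinder has the same dimension. The level set
    itself gives the spectrum, its intersection with a ball gives homogeneity. *)
Lemma dimH_iso h A n1 k0 : (0 <= h)%E -> T b n1 k0 -> A `<=` iso_set psi F h ->
  (forall x, iso_set psi F h x -> kap n1 x = k0 -> A x) -> dimH A = f h.
Proof.
move=> h0 Tk0 AI IA; apply/eqP; rewrite eq_le dimH_iso_le//=.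
have [dh|ndh] := pselect (dom_ext f h).
  apply: (dimH_iso_ge dh Tk0) => x Kx kx hx; apply: IA => //.
  by split=> //; rewrite (wsupp_Fsum Wpsi b m_gt0 eta_ge).
suff -> : f h = -oo%E by rewrite leNye.
have [[f0 _]|//] := Hrange h0; exfalso; apply: ndh; split=> //.
exact: lt_le_trans (ltNyr 0) f0.
Qed.

Lemma ball_cylinder (c r : R) : (exists x, wsupp psi F x /\ `|x - c| < r) ->
  exists n k, T b n k /\ forall x, Kset b x -> kap n x = k -> cball c r x.
Proof.
move=> [x1 []]; rewrite (wsupp_Fsum Wpsi b m_gt0 eta_ge) => -[x10 Tx1] x1c.
have d0 : 0 < r - `|x1 - c| by rewrite subr_gt0.
pose n := Num.bound (r - `|x1 - c|)^-1.
exists n, (kap n x1); split=> // x [x0 Tx] kx.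
have nJ : (2 ^+ J n)^-1 <= r - `|x1 - c|.
  rewrite -[leRHS]invrK lef_pV2 ?posrE ?invr_gt0 ?pow2_gt0//.
  apply: (le_trans (ltW (archi_boundP _))); first by rewrite invr_ge0 ltW.
  apply: (@le_trans _ _ (J n)%:R); first by rewrite ler_nat J_ge.
  exact: ltW (ltr_nat_pow2 _ _).
have /andP[a1 a2] := kap_itv n x10; have /andP[a3 a4] := kap_itv n x0.
rewrite kx -[(kap n x1).+1%:R]natr1 in a2 a3 a4.
have P := pow2_gt0 R (J n).
have xx : `|x - x1| <= (2 ^+ J n)^-1.
  rewrite -[leRHS]mulr1 ler_pdivlMl// -[X in X * _](ger0_norm (ltW P)) -normrM mulrBr.
  by rewrite ler_norml; apply/andP; split; lra.
rewrite /cball/=; apply: (le_trans (ler_distD x1 _ _)).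
by rewrite -lerBrDr (le_trans xx).
Qed.

Lemma spectrum_Fsum : bounded_fun F /\ holder_continuous F /\ homogeneously_multifractal psi F /\
  forall h : \bar R, (0 <= h)%E -> dimH (iso_set psi F h) = f h.
Proof.
split; last split; last split.
- have [B B0 hB] := Fsum_bounded Wpsi b m_gt0 eta_ge.
  exists B; split; first exact: num_real.
  by move=> y By x _; apply: (le_trans (hB x)); exact: ltW.
- exact: (Fsum_holder Wpsi b m_gt0 eta_ge).
- move=> h c1 r1 c2 r2 _ _ H1 H2.
  have [h0|h0] := leP 0%E h.
    have [n1 [k1 [T1 B1]]] := ball_cylinder H1; have [n2 [k2 [T2 B2]]] := ball_cylinder H2.
    have E c r n k : T b n k -> (forall x, Kset b x -> kap n x = k -> cball c r x) ->
        dimH (iso_set psi F h `&` cball c r) = f h.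
      move=> Tk Bk; apply: (dimH_iso h0 Tk) => [x []//|x Ix kx]; split=> //.
      by apply: Bk => //; have [] := Ix; rewrite (wsupp_Fsum Wpsi b m_gt0 eta_ge).
    by rewrite (E _ _ _ _ T1 B1) (E _ _ _ _ T2 B2).
  (* Negative exponents do not occur, as [F] is bounded. *)
  have -> : iso_set psi F h = set0.
    apply/seteqP; split=> // x [_ hx]; move: h0; rewrite -hx ltNge.
    by rewrite (holder_exponent_ge0 Wpsi b m_gt0 eta_ge).
  by rewrite !set0I.
- by move=> h h0; apply: (dimH_iso (n1 := 0) (k0 := 0) h0).
Qed.

End Spectrum.

Unset Implicit Arguments.

Theorem theorem1p11 (R : realType) (psi : R -> R) (Hpsi : wavelet psi)
  (f : \bar R -> \bar R)
  (Hrange : forall h : \bar R, (0 <= h)%E ->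
              ((0 <= f h)%E /\ (f h <= 1%:E)%E) \/ f h = -oo%E)
  (Husc : usc_ext f)
  (Hclosed : closed_ext (dom_ext f))
  (Hmin : exists m : R, 0 < m /\ dom_ext f m%:E /\
            forall h, dom_ext f h -> (m%:E <= h)%E) :
  exists F : R -> R,
    bounded_fun F /\ holder_continuous F /\ homogeneously_multifractal psi F /\
    forall h : \bar R, (0 <= h)%E -> dimH (iso_set psi F h) = f h.
Proof.
have [m [m0 [dm mm]]] := Hmin.
have [q [dq hq]] := dense_labels Hrange dm.
by eexists; exact: (spectrum_Fsum Hpsi Hrange Husc Hclosed m0 mm dq hq).
Qed.
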